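(* Let $f_1,f_2,f_3,f_4:\mathbb{R}\to\mathbb{R}$ be quadratic functions as in the context (so that $x_1^\epsilon x_2^\epsilon x_3^\epsilon x_4^\epsilon$ is a convex quadrilateral with vertices in counterclockwise order), and let $w_\epsilon$, $z_{4,\epsilon}$ and the gradient tree $I$ be as in the context. Let $\delta>0$ be a real number such that $D_i(\delta)\cap D_j(\delta)=\emptyset$ for all $i\neq j$, $i,j\in\{0,1,\infty\}$. Let $p_0\in\{p_1,p_2\}$ be the one whose Morse index is zero, and let $p_0'\in\{p_3,p_4\}$ be the one whose Morse index is zero. Let $I_i$ be the restriction of $I$ to the external edge $e_i$ and $I_{int}$ the restriction of $I$ to the internal edge. If $(p_3-p_1)(p_4-p_2)>0$, then $$\lim_{\epsilon\to+0}\ \sup_{z\in D(\delta)}\left|w_\epsilon(z)-p_0\right|=0,$$ $$\lim_{\epsilon\to+0}\ \sup_{z\in D(\delta)}\left|w_\epsilon\circ\psi_\epsilon^{-1}(z)-p_0'\right|=0,$$ $$\lim_{\epsilon\to+0}\ \sup_{(\tau,\sigma)\in\Theta_{ext}}\left|w_\epsilon\circ\phi^\epsilon_{z_i,\delta}(\tau,\sigma)-I_i(\epsilon\tau)\right|=0\qquad(i=1,2,3,4),$$ $$\lim_{\epsilon\to+0}\ \sup_{(\tau,\sigma)\in\Theta^\epsilon_{int}(\delta)}\left|w_\epsilon\circ\phi_{int}(\tau,\sigma)-I_{int}(\epsilon\tau)\right|=0.$$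
   Context: **Lines and quadrilateral.** Indices are mod $4$. $f_i$ is a real quadratic polynomial with $f_i'(x)=a_ix+b_i$ ($a_i,b_i\in\mathbb{R}$, $i=1,\dots,4$). For $\epsilon>0$ let $L_i^\epsilon=\operatorname{graph}(\epsilon\,df_i)=\{(x,y)\in\mathbb{R}^2: y=\epsilon(a_ix+b_i)\}\subset T^*\mathbb{R}\simeq\mathbb{R}^2\simeq\mathbb{C}$ (with $(x,y)\mapsto x+iy$). Assume $a_i\ne a_{i+1}$ for all $i$; let $x_i^\epsilon$ be the intersection point of $L_i^\epsilon$ and $L_{i+1}^\epsilon$, and $p_i\in\mathbb{R}$ its first coordinate (independent of $\epsilon$), i.e. the critical point of $f_{i+1}-f_i$. Standing assumption: $x_1^\epsilon,x_2^\epsilon,x_3^\epsilon,x_4^\epsilon$ are, in counterclockwise order, the vertices of a (nondegenerate) convex quadrilateral (this does not depend on $\epsilon$). The Morse index of $p_i$ means its index as a critical point of $f_{i+1}-f_i$ (zero iff $a_{i+1}>a_i$). **Holomorphic disk.** $\mathbb{H}$ is the open upper half plane, $\overline{\mathbb{H}}$ its closure. $w_\epsilon$ is the Schwarz–Christoffel map, i.e. the conformal map of $\mathbb{H}$ onto the interior of the quadrilateral $x_1^\epsilon x_2^\epsilon x_3^\epsilon x_4^\epsilon$, extended continuously to the boundary, with $w_\epsilon(1)=x_1^\epsilon$, $w_\epsilon(\infty)=x_2^\epsilon$, $w_\epsilon(0)=x_3^\epsilon$; $z_{4,\epsilon}\in(0,1)$ is the point with $w_\epsilon(z_{4,\epsilon})=x_4^\epsilon$.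 Put $z_1=1$, $z_2=\infty$, $z_3=0$, $z_4=z_{4,\epsilon}$. **Gradient tree.** A gradient tree for $(f_1,\dots,f_4)$ consists of a real number $l\ge0$ (length of the internal edge) and curves $I_i:(-\infty,0]\to\mathbb{R}$ (restriction to the external edge $e_i$), $i=1,\dots,4$, with $\frac{dI_i}{dt}=-(f_{i+1}-f_i)'(I_i)$, $\lim_{t\to-\infty}I_i(t)=p_i$, such that one of the following holds: (a) $l=0$ and $I_1(0)=I_2(0)=I_3(0)=I_4(0)$; (b) $l>0$ and there is $I_{int}:[0,l]\to\mathbb{R}$ with $\frac{dI_{int}}{dt}=-(f_3-f_1)'(I_{int})$, $I_{int}(0)=I_1(0)=I_2(0)$, $I_{int}(l)=I_3(0)=I_4(0)$; (c) $l>0$ and there is $I_{int}:[0,l]\to\mathbb{R}$ with $\frac{dI_{int}}{dt}=-(f_4-f_2)'(I_{int})$, $I_{int}(0)=I_2(0)=I_3(0)$, $I_{int}(l)=I_4(0)=I_1(0)$. It is known that under the standing assumption there is exactly one gradient tree, denoted $I$, of type (b) if $(p_3-p_1)(p_4-p_2)>0$, type (c) if $(p_3-p_1)(p_4-p_2)<0$, type (a) if $(p_3-p_1)(p_4-p_2)=0$. $I_{int}(t)$ for $t$ outside $[0,l]$ denotes the extension of $I_{int}$ as a solution of the same ODE. **Regions and maps.** For $\delta>0$: $D_p(\delta)=\{z\in\overline{\mathbb{H}}:|z-p|<\delta\}$ for $p\in\mathbb{R}$, $D_\infty(\delta)=\{z\in\overline{\mathbb{H}}:|z|^{-1}<\delta\}$,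 and $D(\delta)=\overline{\mathbb{H}}\setminus(D_0(\delta)\cup D_1(\delta)\cup D_\infty(\delta))$. $\Theta_{ext}=(-\infty,0)\times[0,1]$. For $(\tau,\sigma)\in\Theta_{ext}$: $\phi_{p,\delta}(\tau,\sigma)=p+\delta\exp[\pi(\tau+i\sigma)]$ for $p\in\mathbb{R}$, and $\phi_{\infty,\delta}(\tau,\sigma)=-\delta^{-1}\exp[-\pi(\tau+i\sigma)]$. $\psi_\epsilon(z)=z/z_{4,\epsilon}$. $\phi^\epsilon_{z_i,\delta}=\phi_{z_i,\delta}$ for $i=1,2$ and $\phi^\epsilon_{z_i,\delta}=\psi_\epsilon^{-1}\circ\phi_{\psi_\epsilon(z_i),\delta}$ for $i=3,4$ (so $\psi_\epsilon(z_3)=0$, $\psi_\epsilon(z_4)=1$). $\phi_{int}(\tau,\sigma)=\exp[-\pi\tau+i\pi(1-\sigma)]$ and $$\Theta^\epsilon_{int}(\delta)=\left\{(\tau,\sigma):\tau\in\left(-\tfrac1\pi\log\delta,\,-\tfrac1\pi\log z_{4,\epsilon}+\tfrac1\pi\log\delta\right),\ \sigma\in[0,1]\right\}.$$ *)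

(* Defs.v *)
(* Stdlib reals and Coquelicot; T^*R is identified with C by (x, y) |-> x + iy. *)
From Stdlib Require Import Reals Lra.
From Coquelicot Require Import Coquelicot.
Open Scope R_scope.

Inductive idx : Set := i1 | i2 | i3 | i4.

Definition next (i : idx) : idx :=
  match i with i1 => i2 | i2 => i3 | i3 => i4 | i4 => i1 end.

(** * Lines and quadrilateral *)

(* The leading coefficient a / 2 may vanish. *)
Definition is_quadratic (g : R -> R) (a b : R) : Prop :=
  exists c : R, forall x : R, g x = a / 2 * x ^ 2 + b * x + c.

Definition graph_d (eps : R) (g : R -> R) (z : C) : Prop :=
  Im z = eps * Derive g (Re z).

Definition fdiff (f : idx -> R -> R) (i j : idx) : R -> R :=
  fun x => f i x - f j x.

(* Number of negative eigenvalues of the (1 x 1) Hessian. *)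
Definition morse_index (g : R -> R) (q : R) : nat :=
  if Rlt_dec (Derive_n g 2 q) 0 then 1%nat else 0%nat.

(* Positive iff (u, v, w) is a strict left turn. *)
Definition orient (u v w : C) : R :=
  (Re v - Re u) * (Im w - Im u) - (Im v - Im u) * (Re w - Re u).

(* Every vertex off the oriented edge from x i to x (next i) lies strictly to
   its left; in particular no three vertices are collinear. *)
Definition ccw_convex (x : idx -> C) : Prop :=
  forall i j : idx, j <> i -> j <> next i -> 0 < orient (x i) (x (next i)) (x j).

Definition hull (x : idx -> C) (z : C) : Prop :=
  exists t : idx -> R,
    (forall i, 0 <= t i) /\ t i1 + t i2 + t i3 + t i4 = 1 /\
    z = (RtoC (t i1) * x i1 + RtoC (t i2) * x i2 +
         RtoC (t i3) * x i3 + RtoC (t i4) * x i4)%C.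

Definition quad_interior (x : idx -> C) (z : C) : Prop := locally z (hull x).

(** * Holomorphic disk *)

Definition upper (z : C) : Prop := 0 < Im z.
Definition upper_closed (z : C) : Prop := 0 <= Im z.

(* Neighbourhoods of infinity in the one-point compactification of C. *)
Definition C_infty (P : C -> Prop) : Prop :=
  exists M : R, forall z : C, M < Cmod z -> P z.

Definition conformal_onto (U V : C -> Prop) (w : C -> C) : Prop :=
  (forall z, U z -> ex_derive (K := C_AbsRing) (V := C_NormedModule) w z) /\
  (forall z z', U z -> U z' -> w z = w z' -> z = z') /\
  (forall y, V y <-> exists z, U z /\ w z = y).

(* The value of the extended map at infinity is encoded as a limit, so only the
   values of w on the closed half plane in C matter. *)
Definition is_schwarz_christoffel (x : idx -> C) (w : C -> C) (z4 : R) : Prop :=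
  conformal_onto upper (quad_interior x) w /\
  continuous_on upper_closed w /\
  w (RtoC 1) = x i1 /\
  filterlim w (within upper_closed C_infty) (locally (x i2)) /\
  w (RtoC 0) = x i3 /\
  0 < z4 < 1 /\
  w (RtoC z4) = x i4.

(** * Gradient trees *)

(* Derivative relative to D, hence one-sided at the endpoints of an interval. *)
Definition is_derive_in (D : R -> Prop) (g : R -> R) (t l : R) : Prop :=
  filterdiff g (within D (locally t)) (fun h : R => scal h l).

Definition gradient_flow_on (D : R -> Prop) (g I : R -> R) : Prop :=
  forall t, D t -> is_derive_in D I t (- Derive g (I t)).

(* Shape of the tree: no internal edge, or the external edges 1, 2
   (resp. 2, 3) meet at the initial vertex of the internal edge. *)
Inductive tree_shape : Set := shape_a | shape_b | shape_c.

(* Only the values of ext i on (-oo, 0] and of int on [0, len] (the latter for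
   shapes b and c) are meaningful. *)
Record tree : Type := Tree {
  shape : tree_shape;
  len : R;
  ext : idx -> R -> R;
  int : R -> R
}.

Definition int_edge (l t : R) : Prop := 0 <= t <= l.

Definition is_gradient_tree (f : idx -> R -> R) (p : idx -> R) (T : tree) : Prop :=
  (forall i, gradient_flow_on (fun t => t <= 0) (fdiff f (next i) i) (ext T i) /\
             is_lim (ext T i) m_infty (p i)) /\
  match shape T with
  | shape_a =>
      len T = 0 /\ forall i j, ext T i 0 = ext T j 0
  | shape_b =>
      0 < len T /\
      gradient_flow_on (int_edge (len T)) (fdiff f i3 i1) (int T) /\
      int T 0 = ext T i1 0 /\ int T 0 = ext T i2 0 /\
      int T (len T) = ext T i3 0 /\ int T (len T) = ext T i4 0
  | shape_c =>
      0 < len T /\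
      gradient_flow_on (int_edge (len T)) (fdiff f i4 i2) (int T) /\
      int T 0 = ext T i2 0 /\ int T 0 = ext T i3 0 /\
      int T (len T) = ext T i4 0 /\ int T (len T) = ext T i1 0
  end.

(* J extends the internal edge of T to all times as a solution of the same ODE;
   a tree of shape a has no internal edge to extend. *)
Definition extends_int (f : idx -> R -> R) (T : tree) (J : R -> R) : Prop :=
  (forall t, int_edge (len T) t -> J t = int T t) /\
  match shape T with
  | shape_a => False
  | shape_b => gradient_flow_on (fun _ => True) (fdiff f i3 i1) J
  | shape_c => gradient_flow_on (fun _ => True) (fdiff f i4 i2) J
  end.

(** * Regions and maps *)

Definition D_at (q delta : R) (z : C) : Prop :=
  upper_closed z /\ Cmod (z - RtoC q)%C < delta.

(* z = 0 has to be excluded by hand, since / 0 = 0 in R. *)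
Definition D_infty (delta : R) (z : C) : Prop :=
  upper_closed z /\ z <> RtoC 0 /\ / Cmod z < delta.

Definition D_main (delta : R) (z : C) : Prop :=
  upper_closed z /\ ~ (D_at 0 delta z \/ D_at 1 delta z \/ D_infty delta z).

Definition disjoint (A B : C -> Prop) : Prop := forall z, ~ (A z /\ B z).

Definition Cexp (z : C) : C :=
  (exp (Re z) * cos (Im z), exp (Re z) * sin (Im z)).

Definition Theta_ext (ts : R * R) : Prop := fst ts < 0 /\ 0 <= snd ts <= 1.

Definition Theta_int (delta z4 : R) (ts : R * R) : Prop :=
  - (1 / PI) * ln delta < fst ts < - (1 / PI) * ln z4 + 1 / PI * ln delta /\
  0 <= snd ts <= 1.

(* A point (tau, sigma) of the strip, seen in C as the pair it is, is
   tau + i sigma. *)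
Definition phi (q : C) (delta : R) (ts : R * R) : C :=
  (q + RtoC delta * Cexp (RtoC PI * ts))%C.

Definition phi_infty (delta : R) (ts : R * R) : C :=
  (- (RtoC (/ delta) * Cexp (- (RtoC PI * ts))))%C.

Definition psi (z4 : R) (z : C) : C := (z / RtoC z4)%C.
Definition psi_inv (z4 : R) (z : C) : C := (RtoC z4 * z)%C.

Lemma psiK (z4 : R) (z : C) : z4 <> 0 -> psi_inv z4 (psi z4 z) = z.
Proof.
intros h; unfold psi_inv, psi; field.
intros E; apply h; now injection E.
Qed.

Lemma psi_invK (z4 : R) (z : C) : z4 <> 0 -> psi z4 (psi_inv z4 z) = z.
Proof.
intros h; unfold psi_inv, psi; field.
intros E; apply h; now injection E.
Qed.

Definition phi_end (i : idx) (z4 delta : R) (ts : R * R) : C :=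
  match i with
  | i1 => phi (RtoC 1) delta ts
  | i2 => phi_infty delta ts
  | i3 => psi_inv z4 (phi (psi z4 (RtoC 0)) delta ts)
  | i4 => psi_inv z4 (phi (psi z4 (RtoC z4)) delta ts)
  end.

Definition phi_int (ts : R * R) : C :=
  Cexp (- PI * fst ts, PI * (1 - snd ts)).

(** * Limits of suprema *)

Definition sup_on {A : Type} (S : A -> Prop) (g : A -> R) : Rbar :=
  Lub_Rbar (fun r => exists s, S s /\ r = g s).

(* F eps -> 0 in the extended reals as eps -> 0+. *)
Definition tends_to_0 (F : R -> Rbar) : Prop :=
  forall eta : posreal,
    at_right 0 (fun eps => Rbar_lt (- eta) (F eps) /\ Rbar_lt (F eps) eta).

(* Main.v *)
Require Import Defs.
From Stdlib Require Import Reals Lra Lia Classical ClassicalEpsilon FunctionalExtensionality.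
From Coquelicot Require Import Coquelicot.
Open Scope R_scope.

(** The Schwarz-Christoffel formula is not needed.  Since Im w = O(eps) and every boundary arc
    of the half plane is mapped into a line of slope O(eps), a barrier argument gives
    |w'(z)| = O(eps / dist(z, {0, z4, 1})).  Hence w is nearly constant on D(delta); the constant
    is squeezed to the vertex of index zero by the two edges that meet there, and z4 tends to 0
    because the edges x1 x2 and x3 x4 stay at a positive horizontal distance.

    The two sides of a strip-like region are mapped into two lines.  So are they by
    x0 + c exp(kappa zeta), where x0 is the common point of the lines and kappa their angle, and
    the difference of w and such a map satisfies the maximum principle up to the sides, because
    it is real there after a rotation.  This reduces every estimate to the ends of the strip.  On
    the internal strip the same c fits both ends: a holomorphic function that is real on both
    sides has a mean over {tau} x [0, 1] that does not depend on tau.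

    That w maps each arc into the expected edge is a crossing argument: if an edge and a point
    of its arc were separated by a line, then the preimages of the two convex pieces of the
    quadrilateral would be disjoint connected sets linking interlaced boundary points. *)

(** * Complex differentiability *)

(** The gradient flow enters through one expansion: lines of slopes eps a_i and eps a_j meet at an
    angle kappa = eps (a_i - a_j) + o(eps), so exp(kappa tau) is close to exp(eps (a_i - a_j) tau),
    the flow of -(f_j - f_i)' at time eps tau. The obstacle is uniformity. The strips are infinite,
    or finite of a length not known in advance, so neither kappa tau nor eps tau is bounded
    beforehand. On an end the decay of the exponential absorbs the relative error of kappa. On the
    internal strip a bound for the exponential is read off from its two ends, where the map is
    already known to be near p_0 and p_0'. At a vertex of index zero kappa is negative and a
    nonconstant exponential would blow up; there c = 0, and the edge of the tree is constant too.
    The function theory rests on a single integral theorem, for rectangles. The exponential carries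
    it to sectors, hence to discs and half discs, and a half disc is treated like a disc as soon as
    the function is real on its diameter after a rotation. *)

Lemma Ceq_intro (z z' : C) : Re z = Re z' -> Im z = Im z' -> z = z'.
Proof. destruct z, z'; cbn; congruence. Qed.

Ltac creal :=
  unfold Cdiv, Cminus, Cplus, Cmult, Copp, RtoC, Cconj, Ci, Re, Im in *; cbn [fst snd] in *.
Ltac ceq := apply Ceq_intro; creal.
Ltac minmax := unfold Rmin, Rmax; repeat destruct Rle_dec; lra.

Lemma Im_le_Cmod (z : C) : Rabs (Im z) <= Cmod z.
Proof. eapply Rle_trans; [apply Rmax_r | apply (Rmax_Cmod z)]. Qed.

Lemma Cmod_le_abs (z : C) : Cmod z <= Rabs (Re z) + Rabs (Im z).
Proof.
assert (E : z = (RtoC (Re z) + RtoC (Im z) * Ci)%C) by (ceq; ring).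
rewrite E at 1. eapply Rle_trans; [apply Cmod_triangle|].
rewrite Cmod_mult, Cmod_Ci, !Cmod_R. lra.
Qed.

Lemma Cmod_minus_sym (z z' : C) : Cmod (z - z') = Cmod (z' - z).
Proof. rewrite <- Cmod_opp. f_equal. ring. Qed.

Lemma Cmod_triangle_minus (z y x : C) : Cmod (z - x) <= Cmod (z - y) + Cmod (y - x).
Proof. replace (z - x)%C with ((z - y) + (y - x))%C by ring. apply Cmod_triangle. Qed.

(** The uniform structure of [C] is that of a product, whose balls are squares; the modulus agrees
    with it up to a factor 2. *)
Lemma locally_Cmod (z : C) (P : C -> Prop) :
  locally z P <-> exists d, 0 < d /\ forall z', Cmod (z' - z) < d -> P z'.
Proof.
split.
- intros [e He]. exists e. split; [apply cond_pos|].
  intros z' h. apply He.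
  split.
  + apply Rle_lt_trans with (2 := h).
    apply (Rle_trans _ _ _ (re_le_Cmod (z' - z)%C)). lra.
  + apply Rle_lt_trans with (2 := h).
    apply (Rle_trans _ _ _ (Im_le_Cmod (z' - z)%C)). lra.
- intros [d [hd Hd]].
  assert (hd2 : 0 < d / 2) by lra.
  exists (mkposreal _ hd2). intros z' [h1 h2]. apply Hd.
  apply Rle_lt_trans with (1 := Cmod_le_abs _).
  cbn in h1, h2. unfold ball in *; cbn in *. unfold AbsRing_ball, abs, minus, plus, opp in *; cbn in *.
  unfold Cminus, Cplus, Copp, Re, Im; cbn. lra.
Qed.

Lemma continuous_Cmod_eps (F : C -> C) (z : C) :
  continuous F z <->
  forall e, 0 < e -> exists d, 0 < d /\ forall z', Cmod (z' - z) < d -> Cmod (F z' - F z) < e.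
Proof.
split.
- intros h e he. apply (proj1 (locally_Cmod z (fun z' => Cmod (F z' - F z) < e))).
  apply (h (fun y => Cmod (y - F z) < e)). apply locally_Cmod. exists e; auto.
- intros h P hP. apply locally_Cmod in hP. destruct hP as [e [he hP]].
  destruct (h e he) as [d [hd Hd]].
  apply locally_Cmod. exists d; split; auto.
Qed.

(** * Continuity of real and complex valued functions *)

Section Cont.
Context {U : UniformSpace}.
Implicit Types f g : U -> R.
Implicit Types F G : U -> C.

Lemma continuous_Re F x : continuous F x -> continuous (fun u => Re (F u)) x.
Proof. intros h. apply (continuous_comp F fst); [exact h | apply continuous_fst]. Qed.

Lemma continuous_Im F x : continuous F x -> continuous (fun u => Im (F u)) x.
Proof. intros h. apply (continuous_comp F snd); [exact h | apply continuous_snd]. Qed.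

Lemma continuous_Cpair f g x :
  continuous f x -> continuous g x -> continuous (fun u => (f u, g u) : C) x.
Proof.
intros hf hg. apply (continuous_comp_2 f g (fun a b => (a, b) : C)); auto.
apply (continuous_ext (fun z : C => z)); [now intros [] | apply continuous_id].
Qed.

Lemma continuous_Rmult f g x :
  continuous f x -> continuous g x -> continuous (fun u => f u * g u) x.
Proof. apply (continuous_mult (K := R_AbsRing)). Qed.

Lemma continuous_Rplus f g x :
  continuous f x -> continuous g x -> continuous (fun u => f u + g u) x.
Proof. apply (continuous_plus (V := R_NormedModule)). Qed.

Lemma continuous_Ropp f x : continuous f x -> continuous (fun u => - f u) x.
Proof. apply (continuous_opp (V := R_NormedModule)). Qed.

Lemma continuous_Rminus f g x :
  continuous f x -> continuous g x -> continuous (fun u => f u - g u) x.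
Proof. apply (continuous_minus (V := R_NormedModule)). Qed.

Lemma continuous_Rfun (h : R -> R) f x :
  (forall y, continuous h y) -> continuous f x -> continuous (fun u => h (f u)) x.
Proof. intros hh hf. apply (continuous_comp f h); auto. Qed.

Lemma continuous_Cplus F G x :
  continuous F x -> continuous G x -> continuous (fun u => (F u + G u)%C) x.
Proof.
intros hF hG. apply continuous_Cpair; apply continuous_Rplus.
- now apply continuous_Re.
- now apply continuous_Re.
- now apply continuous_Im.
- now apply continuous_Im.
Qed.

Lemma continuous_Copp F x : continuous F x -> continuous (fun u => (- F u)%C) x.
Proof.
intros hF. apply continuous_Cpair; apply continuous_Ropp;
[now apply continuous_Re | now apply continuous_Im].
Qed.

Lemma continuous_Cminus F G x :
  continuous F x -> continuous G x -> continuous (fun u => (F u - G u)%C) x.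
Proof. intros hF hG. apply continuous_Cplus; auto. now apply continuous_Copp. Qed.

Lemma continuous_Cmult F G x :
  continuous F x -> continuous G x -> continuous (fun u => (F u * G u)%C) x.
Proof.
intros hF hG.
pose proof (continuous_Re _ _ hF). pose proof (continuous_Im _ _ hF).
pose proof (continuous_Re _ _ hG). pose proof (continuous_Im _ _ hG).
apply continuous_Cpair; [apply continuous_Rminus | apply continuous_Rplus];
apply continuous_Rmult; auto.
Qed.

Lemma continuous_norm2 F x :
  continuous F x -> continuous (fun u => fst (F u) ^ 2 + snd (F u) ^ 2) x.
Proof.
intros hF.
pose proof (continuous_Re _ _ hF) as h1. pose proof (continuous_Im _ _ hF) as h2.
apply (continuous_ext (fun u => Re (F u) * Re (F u) + Im (F u) * Im (F u))).
- intros u. change (fst (F u) * fst (F u) + snd (F u) * snd (F u) = fst (F u) ^ 2 + snd (F u) ^ 2 :> R).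
  ring.
- apply continuous_Rplus; apply continuous_Rmult; assumption.
Qed.

Lemma continuous_Cmod F x : continuous F x -> continuous (fun u => Cmod (F u)) x.
Proof.
intros hF.
apply (continuous_Rfun sqrt (fun u => fst (F u) ^ 2 + snd (F u) ^ 2)).
- apply continuous_sqrt.
- now apply continuous_norm2.
Qed.

Lemma continuous_Cinv F x :
  F x <> 0%C -> continuous F x -> continuous (fun u => (/ F u)%C) x.
Proof.
intros h hF.
assert (h0 : fst (F x) ^ 2 + snd (F x) ^ 2 <> 0).
{ intros E. apply h.
  destruct (F x) as [u v]; cbn in E. assert (0 <= u ^ 2 /\ 0 <= v ^ 2) as [hu hv] by (split; apply pow2_ge_0).
  assert (u ^ 2 = 0) as eu by lra. assert (v ^ 2 = 0) as ev by lra.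
  apply Rsqr_0_uniq in eu || (rewrite <- Rsqr_pow2 in eu, ev; apply Rsqr_0_uniq in eu; apply Rsqr_0_uniq in ev; now subst). }
pose proof (continuous_Re _ _ hF) as h1. pose proof (continuous_Im _ _ hF) as h2.
assert (hd : continuous (fun u => / (fst (F u) ^ 2 + snd (F u) ^ 2)) x).
{ apply (continuous_comp (fun u => fst (F u) ^ 2 + snd (F u) ^ 2) Rinv).
  - now apply continuous_norm2.
  - apply continuous_Rinv. exact h0. }
apply continuous_Cpair; apply continuous_Rmult; auto.
apply (continuous_Ropp (fun u => Im (F u))); auto.
Qed.
End Cont.

(* Caratheodory's form of the difference quotient makes the differentiation rules algebraic. *)
Definition cder (F : C -> C) (z l : C) : Prop :=
  exists q : C -> C, continuous q z /\ q z = l /\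
    forall z', F z' = (F z + q z' * (z' - z))%C.

Definition hol (F : C -> C) (z : C) : Prop := exists l, cder F z l.

Lemma cder_ext_at (F G : C -> C) (z l : C) : (forall z, F z = G z) -> cder F z l -> cder G z l.
Proof. intros e [q [h1 [h2 h3]]]. exists q. repeat split; auto. intros z'. rewrite <- !e. auto. Qed.

Lemma cder_continuous F z l : cder F z l -> continuous F z.
Proof.
intros [q [h1 [h2 h3]]].
apply (continuous_ext (fun z' => (F z + q z' * (z' - z))%C)).
- intros; now rewrite <- h3.
- apply continuous_Cplus; [apply continuous_const|].
  apply continuous_Cmult; auto. apply continuous_Cminus; [apply continuous_id | apply continuous_const].
Qed.

Lemma hol_continuous F z : hol F z -> continuous F z.
Proof. intros [l h]. eapply cder_continuous; eauto. Qed.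

Lemma cder_const (k z : C) : cder (fun _ => k) z 0%C.
Proof. exists (fun _ => 0%C). repeat split; [apply continuous_const | intros; ring]. Qed.

Lemma cder_id (z : C) : cder (fun z => z) z 1%C.
Proof. exists (fun _ => 1%C). repeat split; [apply continuous_const | intros; ring]. Qed.

Lemma cder_plus F G z l m : cder F z l -> cder G z m -> cder (fun z => (F z + G z)%C) z (l + m)%C.
Proof.
intros [q [h1 [h2 h3]]] [r [k1 [k2 k3]]]. exists (fun z => (q z + r z)%C). repeat split.
- now apply continuous_Cplus.
- now rewrite h2, k2.
- intros z'. rewrite (h3 z'), (k3 z'). ring.
Qed.

Lemma cder_mult F G z l m :
  cder F z l -> cder G z m -> cder (fun z => (F z * G z)%C) z (l * G z + F z * m)%C.
Proof.
intros hF hG. pose proof (cder_continuous _ _ _ hG) as cG.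
destruct hF as [q [h1 [h2 h3]]], hG as [r [k1 [k2 k3]]].
exists (fun z' => (q z' * G z' + F z * r z')%C). repeat split.
- apply continuous_Cplus; apply continuous_Cmult; auto. apply continuous_const.
- now rewrite h2, k2.
- intros z'. rewrite (h3 z'), (k3 z'). ring.
Qed.

Lemma cder_comp F G z l m :
  cder F (G z) l -> cder G z m -> cder (fun z => F (G z)) z (l * m)%C.
Proof.
intros hF hG. pose proof (cder_continuous _ _ _ hG) as cG.
destruct hF as [q [h1 [h2 h3]]], hG as [r [k1 [k2 k3]]].
exists (fun z' => (q (G z') * r z')%C). repeat split.
- apply continuous_Cmult; auto. apply (continuous_comp G q); auto.
- now rewrite h2, k2.
- intros z'. rewrite (h3 (G z')).
  replace (G z' - G z)%C with (r z' * (z' - z))%C by (rewrite (k3 z'); ring). ring.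
Qed.

Lemma cder_eq F z l m : cder F z l -> l = m -> cder F z m.
Proof. intros; subst; auto. Qed.

Lemma hol_const k z : hol (fun _ => k) z.
Proof. eexists; apply cder_const. Qed.
Lemma hol_id z : hol (fun z => z) z.
Proof. eexists; apply cder_id. Qed.
Lemma hol_plus F G z : hol F z -> hol G z -> hol (fun z => (F z + G z)%C) z.
Proof. intros [] []; eexists; apply cder_plus; eauto. Qed.
Lemma hol_mult F G z : hol F z -> hol G z -> hol (fun z => (F z * G z)%C) z.
Proof. intros [] []; eexists; apply cder_mult; eauto. Qed.
Lemma hol_comp F G z : hol F (G z) -> hol G z -> hol (fun z => F (G z)) z.
Proof. intros [] []; eexists; apply cder_comp; eauto. Qed.
Lemma hol_opp F z : hol F z -> hol (fun z => (- F z)%C) z.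
Proof.
intros [l h]. destruct (cder_mult _ _ z _ _ (cder_const (- (1)) z) h) as [q [h1 [h2 h3]]].
eexists; exists q; split; [exact h1 | split; [reflexivity|]].
intros z'. specialize (h3 z').
replace (- F z')%C with (- (1) * F z')%C by ring. rewrite h3. ring.
Qed.
Lemma hol_minus F G z : hol F z -> hol G z -> hol (fun z => (F z - G z)%C) z.
Proof. intros; apply hol_plus; auto; now apply hol_opp. Qed.

Lemma hol_inv (F : C -> C) z : (forall z', F z' <> 0%C) -> hol F z -> hol (fun z => (/ F z)%C) z.
Proof.
intros h0 [l h]. pose proof (cder_continuous _ _ _ h) as cF.
destruct h as [q [h1 [h2 h3]]].
eexists; exists (fun z' => (- q z' * / F z' * / F z)%C). split; [|split; [reflexivity|]].
- apply continuous_Cmult; [|apply continuous_const].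
  apply continuous_Cmult; [now apply continuous_Copp|]. apply continuous_Cinv; auto.
- intros z'.
  transitivity (/ F z - (F z' - F z) * / F z' * / F z)%C; [field; auto|].
  rewrite (h3 z') at 1. ring.
Qed.

Lemma hol_ext F G z : (forall z, F z = G z) -> hol F z -> hol G z.
Proof. intros e [l h]; exists l; eapply cder_ext_at; eauto. Qed.

Lemma Cminus_neq (z z' : C) : z' <> z -> (z' - z)%C <> 0%C.
Proof. intros h E. apply h. replace z' with (z' - z + z)%C by ring. rewrite E. ring. Qed.

(** The identity in [cder] is required at every point of the plane. Where F and G differ, the slope
    function is replaced by the difference quotient of G; its continuity at z only sees the
    neighbourhood where they agree. *)
Lemma cder_ext_loc (F G : C -> C) (z l : C) :
  locally z (fun z' => F z' = G z') -> cder F z l -> cder G z l.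
Proof.
intros hl [q [h1 [h2 h3]]].
assert (ez : F z = G z) by now apply locally_singleton in hl.
set (r := fun z' => if excluded_middle_informative (F z' = G z') then q z'
  else ((G z' - G z) / (z' - z))%C).
assert (Er : forall z', F z' = G z' -> r z' = q z').
{ intros z' e. unfold r. destruct (excluded_middle_informative (F z' = G z')); tauto. }
exists r. split; [|split; [now rewrite Er|]].
- unfold continuous. rewrite Er by auto.
  apply (filterlim_ext_loc q); auto.
  revert hl; apply filter_imp. intros z' e. now rewrite Er.
- intros z'. unfold r. destruct (excluded_middle_informative (F z' = G z')) as [e | n].
  + rewrite <- e, <- ez; auto.
  + assert (z' <> z) by (intros ->; tauto).
    field. now apply Cminus_neq.
Qed.

Lemma hol_ext_loc (F G : C -> C) (z : C) : locally z (fun z' => F z' = G z') -> hol F z -> hol G z.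
Proof. intros e [l h]; exists l; eapply cder_ext_loc; eauto. Qed.

Lemma cder_eps F z l : cder F z l <-> forall e, 0 < e -> exists d, 0 < d /\
  forall z', Cmod (z' - z) < d -> Cmod (F z' - F z - l * (z' - z)) <= e * Cmod (z' - z).
Proof.
split.
- intros [q [h1 [h2 h3]]] e he.
  destruct (proj1 (continuous_Cmod_eps q z) h1 e he) as [d [hd Hd]].
  exists d; split; auto. intros z' h.
  rewrite (h3 z'), <- h2.
  replace (F z + q z' * (z' - z) - F z - q z * (z' - z))%C
    with ((q z' - q z) * (z' - z))%C by ring.
  rewrite Cmod_mult. apply Rmult_le_compat_r; [apply Cmod_ge_0|]. left; auto.
- intros h.
  exists (fun z' => if excluded_middle_informative (z' = z) then l else ((F z' - F z) / (z' - z))%C).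
  repeat split.
  + apply continuous_Cmod_eps. intros e he.
    destruct (h (e / 2)) as [d [hd Hd]]; [lra|]. exists d; split; auto.
    intros z' hz'. destruct (excluded_middle_informative (z = z)); [|tauto].
    destruct (excluded_middle_informative (z' = z)) as [-> | n].
    * replace (l - l)%C with (RtoC 0) by ring. rewrite Cmod_0; auto.
    * pose proof (Cminus_neq _ _ n) as n'.
      replace ((F z' - F z) / (z' - z) - l)%C with ((F z' - F z - l * (z' - z)) / (z' - z))%C
        by (field; auto).
      rewrite Cmod_div by auto. pose proof (proj1 (Cmod_gt_0 _) n') as hp.
      apply Rle_lt_trans with (e / 2); [|lra].
      apply Rmult_le_reg_r with (Cmod (z' - z)); auto.
      unfold Rdiv at 1. rewrite Rmult_assoc, Rinv_l, Rmult_1_r by lra. auto.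
  + destruct (excluded_middle_informative (z = z)); tauto.
  + intros z'. destruct (excluded_middle_informative (z' = z)) as [-> | n]; [ring|].
    field. now apply Cminus_neq.
Qed.

Lemma ex_derive_hol (F : C -> C) (z : C) :
  ex_derive (K := C_AbsRing) (V := C_NormedModule) F z -> hol F z.
Proof.
intros [l [_ hl]]. exists l. apply cder_eps. intros e he.
specialize (hl z (fun P h => h) (mkposreal _ he)).
apply locally_C, locally_Cmod in hl. destruct hl as [d [hd Hd]].
exists d; split; auto. intros z' hz'.
replace (F z' - F z - l * (z' - z))%C with
  (minus (minus (F z') (F z)) (scal (minus z' z) l)); [exact (Hd z' hz')|].
unfold minus, scal, plus, opp; cbn. unfold mult; cbn. ring.
Qed.

(** * The complex exponential *)

Lemma Cexp_plus (z z' : C) : Cexp (z + z') = (Cexp z * Cexp z')%C.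
Proof.
destruct z as [x y], z' as [x' y']. unfold Cexp. ceq;
rewrite exp_plus, ?cos_plus, ?sin_plus; ring.
Qed.

Lemma Cmod_Cexp (z : C) : Cmod (Cexp z) = exp (Re z).
Proof.
unfold Cexp, Cmod; cbn [fst snd].
replace ((exp (Re z) * cos (Im z)) ^ 2 + (exp (Re z) * sin (Im z)) ^ 2) with (Rsqr (exp (Re z))).
- apply sqrt_Rsqr. left; apply exp_pos.
- pose proof (sin2_cos2 (Im z)). unfold Rsqr in *.
  transitivity (exp (Re z) * exp (Re z) * (sin (Im z) * sin (Im z) + cos (Im z) * cos (Im z))).
  + rewrite H; ring.
  + ring.
Qed.

Lemma Cexp_0 : Cexp 0 = 1%C.
Proof. unfold Cexp. ceq; rewrite exp_0, ?cos_0, ?sin_0; ring. Qed.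

Lemma derivable_eps (f : R -> R) (x l : R) : is_derive f x l ->
  forall e, 0 < e -> exists d, 0 < d /\
    forall h, Rabs h < d -> Rabs (f (x + h) - f x - l * h) <= e * Rabs h.
Proof.
intros H e he. destruct (proj1 (is_derive_Reals f x l) H e he) as [d Hd].
exists d; split; [apply cond_pos|]. intros h hh.
destruct (Req_dec h 0) as [-> | hn].
- rewrite Rplus_0_r, Rmult_0_r. replace (f x - f x - 0) with 0 by ring. rewrite Rabs_R0; lra.
- specialize (Hd h hn hh).
  replace (f (x + h) - f x - l * h) with (((f (x + h) - f x) / h - l) * h) by (field; auto).
  rewrite Rabs_mult. apply Rmult_le_compat_r; [apply Rabs_pos | lra].
Qed.

Lemma cder_Cexp_0 : cder Cexp 0 1%C.
Proof.
assert (hexp : is_derive exp 0 1) by (pose proof (is_derive_exp 0) as h; rewrite exp_0 in h; exact h).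
assert (hcos : is_derive cos 0 0)
  by (pose proof (is_derive_cos 0) as h; rewrite sin_0, Ropp_0 in h; exact h).
assert (hsin : is_derive sin 0 1) by (pose proof (is_derive_sin 0) as h; rewrite cos_0 in h; exact h).
apply cder_eps. intros e he.
(* The real part of the remainder is at most [4 * m * n] and the imaginary part at most [5 * m * n],
   hence the nine. *)
set (m := Rmin (e / 9) 1).
assert (hm : 0 < m <= 1 /\ m <= e / 9).
{ unfold m. split; [split; [apply Rmin_pos; lra | apply Rmin_r] | apply Rmin_l]. }
destruct (derivable_eps _ _ _ hexp m) as [d1 [hd1 H1]]; [lra|].
destruct (derivable_eps _ _ _ hcos m) as [d2 [hd2 H2]]; [lra|].
destruct (derivable_eps _ _ _ hsin m) as [d3 [hd3 H3]]; [lra|].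
exists (Rmin m (Rmin d1 (Rmin d2 d3))). split.
{ repeat apply Rmin_pos; lra. }
intros z' hz'.
replace (z' - 0)%C with z' in * by ring.
assert (K : forall u v w t : R, t < Rmin u (Rmin v (Rmin w d3)) -> t < u /\ t < v /\ t < w /\ t < d3).
{ intros u v w t ht. pose proof (Rmin_l u (Rmin v (Rmin w d3))). pose proof (Rmin_r u (Rmin v (Rmin w d3))).
  pose proof (Rmin_l v (Rmin w d3)). pose proof (Rmin_r v (Rmin w d3)).
  pose proof (Rmin_l w d3). pose proof (Rmin_r w d3). lra. }
apply K in hz'. destruct hz' as [hz0 [hz1 [hz2 hz3]]]. clear K.
destruct z' as [x y].
pose proof (re_le_Cmod (x, y)) as rx. pose proof (Im_le_Cmod (x, y)) as ry. cbn in rx, ry.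
set (n := Cmod (x, y)) in *.
specialize (H1 x ltac:(lra)). specialize (H2 y ltac:(lra)). specialize (H3 y ltac:(lra)).
rewrite !Rplus_0_l, exp_0 in H1. rewrite !Rplus_0_l, cos_0 in H2. rewrite !Rplus_0_l, sin_0 in H3.
rewrite Cexp_0.
set (A := exp x - 1 - 1 * x) in *. set (B := cos y - 1 - 0 * y) in *. set (D := sin y - 0 - 1 * y) in *.
assert (hn : 0 <= n) by apply Cmod_ge_0.
assert (hA : Rabs A <= m * n) by (eapply Rle_trans; [exact H1|]; apply Rmult_le_compat_l; lra).
assert (hB : Rabs B <= m * n) by (eapply Rle_trans; [exact H2|]; apply Rmult_le_compat_l; lra).
assert (hD : Rabs D <= m * n) by (eapply Rle_trans; [exact H3|]; apply Rmult_le_compat_l; lra).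
apply Rle_trans with (1 := Cmod_le_abs _).
replace (Re (Cexp (x, y) - 1 - 1 * (x, y))%C) with (A + (A + 1 + x) * B)
  by (unfold Cexp, A, B; creal; ring).
replace (Im (Cexp (x, y) - 1 - 1 * (x, y))%C) with (D + (A + x) * (D + y))
  by (unfold Cexp, A, D; creal; ring).
assert (mn : m * n <= n) by nra.
assert (T1 : Rabs (A + (A + 1 + x) * B) <= m * n + 3 * (m * n)).
{ eapply Rle_trans; [apply Rabs_triang|]. rewrite Rabs_mult.
  assert (Rabs (A + 1 + x) <= 3).
  { pose proof (Rabs_triang (A + 1) x). pose proof (Rabs_triang A 1). rewrite Rabs_R1 in H0. lra. }
  apply Rplus_le_compat; auto. apply Rmult_le_compat; auto using Rabs_pos. }
assert (T2 : Rabs (D + (A + x) * (D + y)) <= m * n + (2 * n) * (2 * m)).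
{ eapply Rle_trans; [apply Rabs_triang|]. rewrite Rabs_mult.
  apply Rplus_le_compat; auto. apply Rmult_le_compat; auto using Rabs_pos.
  - pose proof (Rabs_triang A x). lra.
  - pose proof (Rabs_triang D y). nra. }
assert (m * n <= e / 9 * n) by (apply Rmult_le_compat_r; lra).
replace (2 * n * (2 * m)) with (4 * (m * n)) in T2 by ring.
fold n. lra.
Qed.

Lemma cder_Cexp (z : C) : cder Cexp z (Cexp z).
Proof.
destruct cder_Cexp_0 as [q [h1 [h2 h3]]].
exists (fun z' => (Cexp z * q (z' - z))%C). repeat split.
- apply continuous_Cmult; [apply continuous_const|].
  apply (continuous_comp (fun z' : C => (z' - z)%C) q).
  + apply continuous_Cminus; [apply continuous_id | apply continuous_const].
  + replace (z - z)%C with (RtoC 0) by ring. auto.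
- replace (z - z)%C with (RtoC 0) by ring. rewrite h2. ring.
- intros z'. replace z' with (z + (z' - z))%C at 1 by ring.
  rewrite Cexp_plus, (h3 (z' - z)%C), Cexp_0. ring.
Qed.

Lemma hol_Cexp z : hol Cexp z.
Proof. eexists; apply cder_Cexp. Qed.

Lemma continuous_Cexp {U : UniformSpace} (F : U -> C) x :
  continuous F x -> continuous (fun u => Cexp (F u)) x.
Proof.
intros h. apply (continuous_comp F Cexp); auto. apply hol_continuous, hol_Cexp.
Qed.

(** * Bisection on rectangles *)

Record box := Box { bl : R; br : R; bd : R; bu : R }.

Definition sub_box (r s : box) : Prop :=
  bl r <= bl s /\ bl s <= br s /\ br s <= br r /\ bd r <= bd s /\ bd s <= bu s /\ bu s <= bu r.

Definition in_box (r : box) (z : C) : Prop := bl r <= Re z <= br r /\ bd r <= Im z <= bu r.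
Definition in_box_int (r : box) (z : C) : Prop := bl r < Re z < br r /\ bd r < Im z < bu r.
(** Equality is allowed on purpose: the sides of a rectangle and the interval [[0, 1]] are treated
    as boxes as well. *)
Definition wf_box (r : box) : Prop := bl r <= br r /\ bd r <= bu r.

Definition quarter (h v : bool) (r : box) : box :=
  let m := (bl r + br r) / 2 in let n := (bd r + bu r) / 2 in
  Box (if h then bl r else m) (if h then m else br r)
      (if v then bd r else n) (if v then n else bu r).

Lemma sub_box_quarter h v r : wf_box r -> sub_box r (quarter h v r).
Proof. intros [h1 h2]. destruct h, v; unfold sub_box; cbn; lra. Qed.

Lemma sub_box_trans r s t : sub_box r s -> sub_box s t -> sub_box r t.
Proof. unfold sub_box; lra. Qed.

Lemma sub_box_wf r s : sub_box r s -> wf_box s.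
Proof. unfold sub_box, wf_box; lra. Qed.

Section BoxInd.
Variables (P : box -> Prop) (r0 : box).
Hypothesis wf0 : wf_box r0.
Hypothesis P_quarter :
  forall r, sub_box r0 r -> (forall h v, P (quarter h v r)) -> P r.
(* The small boxes are similar to r0, so that diameter times perimeter is comparable to area. *)
Hypothesis P_small : forall z, in_box r0 z -> exists e, 0 < e /\
  forall r (k : R), sub_box r0 r -> in_box r z -> 0 < k ->
    br r - bl r = k * (br r0 - bl r0) -> bu r - bd r = k * (bu r0 - bd r0) ->
    br r - bl r < e -> bu r - bd r < e -> P r.

Let bad := {r | sub_box r0 r /\ ~ P r}.

Lemma bad_step (r : bad) : {s : bad | exists h v, proj1_sig s = quarter h v (proj1_sig r)}.
Proof.
apply constructive_indefinite_description.
destruct r as [r [h1 h2]].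
assert (E : exists h v, ~ P (quarter h v r)).
{ apply NNPP. intros N. apply h2, P_quarter; auto. intros h v. apply NNPP. intros N'.
  apply N. eauto. }
destruct E as [h [v E]].
unshelve eexists (exist _ (quarter h v r) _); [|cbn; eauto].
split; auto. eapply sub_box_trans; eauto. apply sub_box_quarter. eapply sub_box_wf; eauto.
Qed.

Fixpoint bad_seq (b : bad) (n : nat) : bad :=
  match n with O => b | S n => proj1_sig (bad_step (bad_seq b n)) end.

(** Otherwise each bad box has a bad quarter, and the nested bad boxes shrink to a point, near which
    [P_small] applies. Compactness, the theorem of Goursat and the chaining of a path into small
    steps are all instances. *)
Lemma box_ind : P r0.
Proof.
apply NNPP. intros N0.
assert (s0 : sub_box r0 r0) by (destruct wf0; unfold sub_box; lra).
set (B := fun n => proj1_sig (bad_seq (exist _ r0 (conj s0 N0)) n)).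
assert (Bsub : forall n, sub_box r0 (B n)).
{ intros n. unfold B. destruct (bad_seq _ n) as [r [h1 h2]]; auto. }
assert (Bbad : forall n, ~ P (B n)).
{ intros n. unfold B. destruct (bad_seq _ n) as [r [h1 h2]]; auto. }
assert (BS : forall n, exists h v, B (S n) = quarter h v (B n)).
{ intros n. unfold B. cbn. destruct (bad_step _) as [s hs]; auto. }
assert (Bw : forall n, br (B n) - bl (B n) = / 2 ^ n * (br r0 - bl r0) /\
   bu (B n) - bd (B n) = / 2 ^ n * (bu r0 - bd r0)).
{ induction n as [|n [IH1 IH2]]; [cbn; rewrite Rinv_1; lra|].
  destruct (BS n) as [h [v ->]].
  replace (/ 2 ^ S n) with (/ 2 ^ n / 2) by (cbn; field; apply pow_nonzero; lra).
  destruct h, v; cbn; split; lra. }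
assert (Bmon : forall n k, sub_box (B n) (B (n + k)%nat)).
{ intros n k; induction k as [|k IH].
  - rewrite Nat.add_0_r. destruct (sub_box_wf _ _ (Bsub n)). unfold sub_box; lra.
  - rewrite Nat.add_succ_r. eapply sub_box_trans; [exact IH|].
    destruct (BS (n + k)%nat) as [h [v ->]]. apply sub_box_quarter. eapply sub_box_wf; apply Bsub. }
assert (Bl : forall n m, bl (B m) <= br (B n) /\ bd (B m) <= bu (B n)).
{ intros n m. destruct (Nat.le_ge_cases n m) as [h | h].
  - pose proof (Bmon n (m - n)%nat) as H. replace (n + (m - n))%nat with m in H by lia.
    unfold sub_box in H; lra.
  - pose proof (Bmon m (n - m)%nat) as H. replace (m + (n - m))%nat with n in H by lia.
    unfold sub_box in H; lra. }
destruct (completeness (fun x => exists n, x = bl (B n))) as [x [hx1 hx2]].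
{ exists (br (B O)). intros x [n ->]. apply Bl. }
{ exists (bl (B O)). eauto. }
destruct (completeness (fun x => exists n, x = bd (B n))) as [y [hy1 hy2]].
{ exists (bu (B O)). intros y [n ->]. apply Bl. }
{ exists (bd (B O)). eauto. }
assert (inB : forall n, in_box (B n) (x, y)).
{ intros n. split; cbn; split.
  - apply hx1; eauto.
  - apply hx2. intros ? [m ->]. apply Bl.
  - apply hy1; eauto.
  - apply hy2. intros ? [m ->]. apply Bl. }
destruct (P_small (x, y)) as [e [he He]].
{ destruct (inB O) as [h1 h2]. destruct (Bsub O) as [? [? [? [? [? ?]]]]]. split; lra. }
set (D := (br r0 - bl r0) + (bu r0 - bd r0) + 1).
assert (hD : 0 < D) by (destruct wf0; unfold D; lra).
destruct (pow_lt_1_zero (/ 2)) with (y := e / D) as [n Hn].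
{ rewrite Rabs_right; lra. }
{ apply Rdiv_lt_0_compat; auto. }
specialize (Hn n (le_n n)).
assert (pn : 0 < / 2 ^ n) by (apply Rinv_0_lt_compat, pow_lt; lra).
rewrite pow_inv, Rabs_right in Hn by lra.
assert (hk : / 2 ^ n * D < e).
{ apply Rmult_lt_reg_r with (/ D); [now apply Rinv_0_lt_compat|].
  rewrite Rmult_assoc, Rinv_r, Rmult_1_r by lra. exact Hn. }
destruct (Bw n) as [w1 w2], wf0 as [wa wb].
apply (Bbad n), (He _ (/ 2 ^ n)); auto.
- rewrite w1. apply Rle_lt_trans with (2 := hk). apply Rmult_le_compat_l; unfold D; lra.
- rewrite w2. apply Rle_lt_trans with (2 := hk). apply Rmult_le_compat_l; unfold D; lra.
Qed.
End BoxInd.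

Lemma in_box_quarter r z : wf_box r -> in_box r z -> exists h v, in_box (quarter h v r) z.
Proof.
intros [w1 w2] [h1 h2].
exists (if Rle_dec (Re z) ((bl r + br r) / 2) then true else false),
  (if Rle_dec (Im z) ((bd r + bu r) / 2) then true else false).
unfold in_box, quarter; cbn.
destruct Rle_dec, Rle_dec; lra.
Qed.

Lemma in_box_Cmod r z z' e : in_box r z -> in_box r z' ->
  br r - bl r < e -> bu r - bd r < e -> Cmod (z' - z) < 2 * e.
Proof.
intros [h1 h2] [h3 h4] w1 w2. apply Rle_lt_trans with (1 := Cmod_le_abs _).
assert (Rabs (Re (z' - z)%C) < e) by (apply Rabs_def1; creal; lra).
assert (Rabs (Im (z' - z)%C) < e) by (apply Rabs_def1; creal; lra). lra.
Qed.

(** Compactness of a box in the form used below: local positive constants that may be decreased can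
    be replaced by one constant. Boundedness, attained maxima and uniform continuity are obtained
    from it. *)
Lemma box_local_global (r : box) (Q : C -> R -> Prop) :
  wf_box r ->
  (forall z s t, 0 < s <= t -> Q z t -> Q z s) ->
  (forall z, in_box r z -> exists d e, 0 < d /\ 0 < e /\
     forall z', in_box r z' -> Cmod (z' - z) < d -> Q z' e) ->
  exists e, 0 < e /\ forall z, in_box r z -> Q z e.
Proof.
intros wf mono loc.
apply (box_ind (fun s => exists e, 0 < e /\ forall z, in_box s z -> Q z e) r wf).
- intros s hs hq.
  destruct (hq true true) as [e1 [p1 q1]], (hq true false) as [e2 [p2 q2]],
    (hq false true) as [e3 [p3 q3]], (hq false false) as [e4 [p4 q4]].
  set (e := Rmin (Rmin e1 e2) (Rmin e3 e4)).
  assert (he : 0 < e /\ e <= e1 /\ e <= e2 /\ e <= e3 /\ e <= e4) by (unfold e; minmax).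
  exists e. split; [lra|]. intros z hz.
  destruct (in_box_quarter s z (sub_box_wf _ _ hs) hz) as [[] [[] hh]];
  [apply mono with e1 | apply mono with e2 | apply mono with e3 | apply mono with e4];
  auto; lra.
- intros z hz. destruct (loc z hz) as [d [e [hd [he H]]]].
  exists (d / 2). split; [lra|].
  intros s k hs hzs _ _ _ w1 w2. exists e. split; auto.
  intros z' hz'. apply H.
  + destruct hs as [? [? [? [? [? ?]]]]], hz' as [? ?]; split; lra.
  + replace d with (2 * (d / 2)) by field. eapply in_box_Cmod; eauto.
Qed.

Lemma box_max (r : box) (u : C -> R) :
  wf_box r -> (forall z, in_box r z -> continuous u z) ->
  exists p, in_box r p /\ forall z, in_box r z -> u z <= u p.
Proof.
intros wf hc.
assert (ceps : forall z, in_box r z -> forall e, 0 < e -> exists d, 0 < d /\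
  forall z', Cmod (z' - z) < d -> Rabs (u z' - u z) < e).
{ intros z hz e he. apply (proj1 (locally_Cmod z (fun z' => Rabs (u z' - u z) < e))).
  apply (hc z hz (fun y => Rabs (y - u z) < e)). exists (mkposreal _ he). intros y hy. exact hy. }
(* The bound is written as [/ e] so that decreasing e weakens the claim, as [box_local_global]
   demands. *)
assert (hb : exists e, 0 < e /\ forall z, in_box r z -> u z <= / e).
{ apply box_local_global; auto.
  - intros z s t hst h. apply Rle_trans with (1 := h). apply Rinv_le_contravar; lra.
  - intros z hz. destruct (ceps z hz 1 ltac:(lra)) as [d [hd Hd]].
    pose proof (Rabs_pos (u z)).
    exists d, (/ (Rabs (u z) + 1)). repeat split; auto.
    + apply Rinv_0_lt_compat; lra.
    + intros z' _ hz'. rewrite Rinv_inv. specialize (Hd z' hz').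
      apply Rabs_def2 in Hd. pose proof (Rle_abs (u z)). lra. }
destruct hb as [e0 [he0 hb]].
destruct (completeness (fun y => exists z, in_box r z /\ y = u z)) as [M [hM1 hM2]].
{ exists (/ e0). intros y [z [hz ->]]; auto. }
{ exists (u (bl r, bd r)). exists (bl r, bd r). split; auto. destruct wf; unfold in_box; cbn; lra. }
(* If the supremum M were not attained, the gap between u and M would have a positive lower bound on
   the box, so M would not be the least upper bound. *)
apply NNPP. intros N.
assert (hlt : forall z, in_box r z -> u z < M).
{ intros z hz. destruct (Rle_lt_or_eq_dec (u z) M) as [h | h]; auto; [apply hM1; eauto|].
  exfalso. apply N. exists z. split; auto. intros z' hz'. rewrite h. apply hM1; eauto. }
assert (hg : exists e, 0 < e /\ forall z, in_box r z -> u z <= M - e).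
{ apply box_local_global; auto.
  - intros z s t hst h. lra.
  - intros z hz. pose proof (hlt z hz).
    destruct (ceps z hz ((M - u z) / 2) ltac:(lra)) as [d [hd Hd]].
    exists d, ((M - u z) / 2). repeat split; auto; [lra|].
    intros z' _ hz'. specialize (Hd z' hz'). apply Rabs_def2 in Hd. lra. }
destruct hg as [e [he hg]].
assert (M <= M - e); [|lra].
apply hM2. intros y [z [hz ->]]; auto.
Qed.

(** * Cauchy's theorem on rectangles *)

(* The imaginary part of the integral of F over the boundary; the real part is the same
   expression for -iF. *)
Definition contour (F : C -> C) (r : box) : R :=
  RInt (fun y => Re (F (br r, y)) - Re (F (bl r, y))) (bd r) (bu r) +
  RInt (fun x => Im (F (x, bd r)) - Im (F (x, bu r))) (bl r) (br r).

Lemma continuous_vert (F : C -> C) (x y : R) :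
  continuous F (x, y) -> continuous (fun y => F (x, y)) y.
Proof.
intros h. apply (continuous_comp (fun y : R => (x, y) : C) F); auto.
apply continuous_Cpair; [apply continuous_const | apply continuous_id].
Qed.

Lemma continuous_horiz (F : C -> C) (x y : R) :
  continuous F (x, y) -> continuous (fun x => F (x, y)) x.
Proof.
intros h. apply (continuous_comp (fun x : R => (x, y) : C) F); auto.
apply continuous_Cpair; [apply continuous_id | apply continuous_const].
Qed.

Lemma ex_RInt_cont (f : R -> R) (a b : R) : a <= b ->
  (forall x, a <= x <= b -> continuous f x) -> ex_RInt f a b.
Proof. intros h H. apply (ex_RInt_continuous (V := R_CompleteNormedModule)). intros x. rewrite Rmin_left, Rmax_right by lra. auto. Qed.

Section Contour.
Variables (F : C -> C) (r : box).
Hypothesis wf : wf_box r.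
Hypothesis cF : forall z, in_box r z -> continuous F z.

Lemma ex_RInt_vert x a b : bl r <= x <= br r -> bd r <= a <= b -> b <= bu r ->
  ex_RInt (fun y => Re (F (x, y))) a b.
Proof.
intros hx h1 h2. apply ex_RInt_cont; [lra|]. intros y hy.
apply (continuous_Re (fun y => F (x, y))), continuous_vert, cF. split; cbn; lra.
Qed.

Lemma ex_RInt_horiz y a b : bd r <= y <= bu r -> bl r <= a <= b -> b <= br r ->
  ex_RInt (fun x => Im (F (x, y))) a b.
Proof.
intros hy h1 h2. apply ex_RInt_cont; [lra|]. intros x hx.
apply (continuous_Im (fun x => F (x, y))), continuous_horiz, cF. split; cbn; lra.
Qed.

Lemma contour_split : contour F r =
  RInt (fun y => Re (F (br r, y))) (bd r) (bu r) - RInt (fun y => Re (F (bl r, y))) (bd r) (bu r) +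
  (RInt (fun x => Im (F (x, bd r))) (bl r) (br r) - RInt (fun x => Im (F (x, bu r))) (bl r) (br r)).
Proof.
destruct wf. unfold contour. f_equal.
- apply (RInt_minus (V := R_CompleteNormedModule)); apply ex_RInt_vert; lra.
- apply (RInt_minus (V := R_CompleteNormedModule)); apply ex_RInt_horiz; lra.
Qed.
End Contour.

Lemma contour_quarters F r : wf_box r -> (forall z, in_box r z -> continuous F z) ->
  contour F r = contour F (quarter true true r) + contour F (quarter true false r) +
    contour F (quarter false true r) + contour F (quarter false false r).
Proof.
intros wf cF.
assert (cq : forall h v z, in_box (quarter h v r) z -> continuous F z).
{ intros h v z hz. apply cF. pose proof (sub_box_quarter h v r wf) as [? [? [? [? [? ?]]]]].
  destruct hz. split; lra. }
assert (wq : forall h v, wf_box (quarter h v r)).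
{ intros h v. eapply sub_box_wf; apply sub_box_quarter; auto. }
rewrite (contour_split F r), !contour_split by eauto.
unfold quarter; cbn [bl br bd bu].
destruct wf as [w1 w2].
set (m := (bl r + br r) / 2). set (n := (bd r + bu r) / 2).
assert (hm : bl r <= m <= br r) by (unfold m; lra).
assert (hn : bd r <= n <= bu r) by (unfold n; lra).
assert (V : forall x, bl r <= x <= br r -> RInt (fun y => Re (F (x, y))) (bd r) (bu r) =
  RInt (fun y => Re (F (x, y))) (bd r) n + RInt (fun y => Re (F (x, y))) n (bu r)).
{ intros x hx. symmetry. apply (RInt_Chasles (V := R_CompleteNormedModule));
  apply (ex_RInt_vert F r); auto; lra. }
assert (H : forall y, bd r <= y <= bu r -> RInt (fun x => Im (F (x, y))) (bl r) (br r) =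
  RInt (fun x => Im (F (x, y))) (bl r) m + RInt (fun x => Im (F (x, y))) m (br r)).
{ intros x hx. symmetry. apply (RInt_Chasles (V := R_CompleteNormedModule));
  apply (ex_RInt_horiz F r); auto; lra. }
rewrite !V, !H by lra. ring.
Qed.

Lemma RInt_near_const (f : R -> R) (a b k e : R) : a <= b -> ex_RInt f a b ->
  (forall x, a <= x <= b -> Rabs (f x - k) <= e) -> Rabs (RInt f a b - k * (b - a)) <= e * (b - a).
Proof.
intros hab hf h.
assert (E : RInt f a b - k * (b - a) = RInt (fun x => f x - k) a b).
{ assert (E := RInt_minus (V := R_CompleteNormedModule) f (fun _ => k) a b hf
    (ex_RInt_const a b k)).
  rewrite RInt_const in E. change (RInt (fun x => f x - k) a b = RInt f a b - (b - a) * k) in E.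
  rewrite E. ring. }
rewrite E, (Rmult_comm e). apply abs_RInt_le_const; auto.
apply (ex_RInt_minus (V := R_CompleteNormedModule)); auto. apply ex_RInt_const.
Qed.

(** For an affine function the vertical sides contribute [Re l] times the area and the horizontal
    sides the opposite. What remains is an error of size e times the diameter, integrated over the
    perimeter. *)
Lemma contour_affine F r p l e : wf_box r -> (forall z, in_box r z -> continuous F z) ->
  in_box r p ->
  (forall z, in_box r z -> Cmod (F z - F p - l * (z - p)) <= e * Cmod (z - p)) -> 0 <= e ->
  Rabs (contour F r) <= 2 * e * ((br r - bl r) + (bu r - bd r)) ^ 2.
Proof.
intros wf cF hp H he.
set (W := br r - bl r). set (Hh := bu r - bd r).
assert (hd : forall z, in_box r z -> Cmod (z - p) <= W + Hh).
{ intros z [h1 h2]. destruct hp as [h3 h4]. apply Rle_trans with (1 := Cmod_le_abs _).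
  apply Rplus_le_compat; apply Rabs_le; unfold W, Hh; creal; lra. }
assert (H' : forall z, in_box r z -> Cmod (F z - F p - l * (z - p)) <= e * (W + Hh)).
{ intros z hz. apply Rle_trans with (1 := H z hz). apply Rmult_le_compat_l; auto. }
destruct wf as [w1 w2].
assert (A : Rabs (RInt (fun y => Re (F (br r, y)) - Re (F (bl r, y))) (bd r) (bu r) -
   (Re l * W) * (bu r - bd r)) <= 2 * (e * (W + Hh)) * (bu r - bd r)).
{ apply RInt_near_const; auto.
  - apply (ex_RInt_minus (V := R_CompleteNormedModule)); apply (ex_RInt_vert F r); auto; lra.
  - intros y hy.
    assert (i1 : in_box r (br r, y)) by (split; cbn; lra).
    assert (i2 : in_box r (bl r, y)) by (split; cbn; lra).
    pose proof (Rle_trans _ _ _ (re_le_Cmod _) (H' _ i1)) as k1.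
    pose proof (Rle_trans _ _ _ (re_le_Cmod _) (H' _ i2)) as k2.
    set (u := Re (F (br r, y))) in *. set (v := Re (F (bl r, y))) in *.
    replace (u - v - Re l * W) with
      (Re (F (br r, y) - F p - l * ((br r, y) - p))%C - Re (F (bl r, y) - F p - l * ((bl r, y) - p))%C)
      by (unfold u, v, W; creal; ring).
    unfold Rminus at 1. eapply Rle_trans; [apply Rabs_triang|]. rewrite Rabs_Ropp. lra. }
assert (B : Rabs (RInt (fun x => Im (F (x, bd r)) - Im (F (x, bu r))) (bl r) (br r) -
   (- Re l * Hh) * (br r - bl r)) <= 2 * (e * (W + Hh)) * (br r - bl r)).
{ apply RInt_near_const; auto.
  - apply (ex_RInt_minus (V := R_CompleteNormedModule)); apply (ex_RInt_horiz F r); auto; lra.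
  - intros x hx.
    assert (i1 : in_box r (x, bd r)) by (split; cbn; lra).
    assert (i2 : in_box r (x, bu r)) by (split; cbn; lra).
    pose proof (Rle_trans _ _ _ (Im_le_Cmod _) (H' _ i1)) as k1.
    pose proof (Rle_trans _ _ _ (Im_le_Cmod _) (H' _ i2)) as k2.
    set (u := Im (F (x, bd r))) in *. set (v := Im (F (x, bu r))) in *.
    replace (u - v - - Re l * Hh) with
      (Im (F (x, bd r) - F p - l * ((x, bd r) - p))%C - Im (F (x, bu r) - F p - l * ((x, bu r) - p))%C)
      by (unfold u, v, Hh; creal; ring).
    unfold Rminus at 1. eapply Rle_trans; [apply Rabs_triang|]. rewrite Rabs_Ropp. lra. }
unfold contour.
set (I := RInt _ _ _) in *. set (J := RInt _ (bl r) (br r)) in *.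
replace (I + J) with ((I - Re l * W * (bu r - bd r)) + (J - - Re l * Hh * (br r - bl r)))
  by (unfold W, Hh; ring).
eapply Rle_trans; [apply Rabs_triang|].
eapply Rle_trans; [apply Rplus_le_compat; [exact A | exact B]|].
right. unfold W, Hh. ring.
Qed.

Lemma sub_box_in r s z : sub_box r s -> in_box s z -> in_box r z.
Proof. intros [? [? [? [? [? ?]]]]] [? ?]; split; lra. Qed.

(** The claim passed down the bisection is that the contour is at most eta times the area, relative
    to the whole box; both sides are additive over the quarters. Near a point of differentiability
    the contour is o(diameter^2), and for boxes of a fixed shape this is o(area). *)
Lemma goursat_closed F r : bl r < br r -> bd r < bu r ->
  (forall z, in_box r z -> hol F z) -> contour F r = 0.
Proof.
intros w1 w2 hF.
assert (wf : wf_box r) by (split; lra).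
assert (cF : forall z, in_box r z -> continuous F z) by (intros; now apply hol_continuous, hF).
set (W := br r - bl r). set (H := bu r - bd r).
assert (hW : 0 < W) by (unfold W; lra). assert (hH : 0 < H) by (unfold H; lra).
assert (K : forall eta, 0 < eta -> Rabs (contour F r) <= eta).
{ intros eta he.
  enough (T : Rabs (contour F r) * (W * H) <= eta * ((br r - bl r) * (bu r - bd r))).
  { apply Rmult_le_reg_r with (W * H); [now apply Rmult_lt_0_compat | exact T]. }
  apply (box_ind (fun s => Rabs (contour F s) * (W * H) <= eta * ((br s - bl s) * (bu s - bd s))) r wf).
  - intros s hs hq.
    rewrite contour_quarters; [|now apply (sub_box_wf _ _ hs)|intros; now apply cF, (sub_box_in _ s)].
    pose proof (hq true true) as q1. pose proof (hq true false) as q2.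
    pose proof (hq false true) as q3. pose proof (hq false false) as q4.
    cbn [quarter bl br bd bu] in q1, q2, q3, q4.
    set (c1 := contour F (quarter true true s)) in *. set (c2 := contour F (quarter true false s)) in *.
    set (c3 := contour F (quarter false true s)) in *. set (c4 := contour F (quarter false false s)) in *.
    change (contour F _) with c1 in q1. change (contour F _) with c2 in q2.
    change (contour F _) with c3 in q3. change (contour F _) with c4 in q4.
    assert (Rabs (c1 + c2 + c3 + c4) <= Rabs c1 + Rabs c2 + Rabs c3 + Rabs c4).
    { pose proof (Rabs_triang (c1 + c2 + c3) c4). pose proof (Rabs_triang (c1 + c2) c3).
      pose proof (Rabs_triang c1 c2). lra. }
    apply Rle_trans with ((Rabs c1 + Rabs c2 + Rabs c3 + Rabs c4) * (W * H)).
    + apply Rmult_le_compat_r; auto. apply Rmult_le_pos; lra.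
    + rewrite !Rmult_plus_distr_r.
      eapply Rle_trans; [apply Rplus_le_compat; [apply Rplus_le_compat; [apply Rplus_le_compat|]|]|];
        [exact q1 | exact q2 | exact q3 | exact q4|].
      right. field.
  - intros z hz. destruct (hF z hz) as [l hl].
    (* With this e the bound of [contour_affine] for a box of scale k is [eta * k ^ 2], which is
       exactly the share of its area. *)
    set (e := eta / (2 * (W + H) ^ 2)).
    assert (hD : 0 < 2 * (W + H) ^ 2) by (apply Rmult_lt_0_compat; [lra | apply pow_lt; lra]).
    assert (he' : 0 < e) by (apply Rdiv_lt_0_compat; auto).
    destruct (proj1 (cder_eps _ _ _) hl e he') as [d [hd Hd]].
    exists (d / 2). split; [lra|].
    intros s k hs hzs hk k1 k2 d1 d2.
    assert (A : Rabs (contour F s) <= 2 * e * ((br s - bl s) + (bu s - bd s)) ^ 2).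
    { apply contour_affine with z l; auto; [now apply (sub_box_wf _ _ hs)| | |lra].
      - intros; now apply cF, (sub_box_in _ s).
      - intros z' hz'. apply Hd. replace d with (2 * (d / 2)) by field.
        apply in_box_Cmod with s; auto. }
    fold W in k1. fold H in k2. rewrite k1, k2 in A |- *.
    apply Rle_trans with (2 * e * (k * W + k * H) ^ 2 * (W * H)).
    + apply Rmult_le_compat_r; auto. apply Rmult_le_pos; lra.
    + right. unfold e. field. lra. }
apply Rle_antisym; [|].
- apply le_epsilon. intros e he. pose proof (Rle_abs (contour F r)). specialize (K e he). lra.
- apply le_epsilon. intros e he. pose proof (Rle_abs (- contour F r)). rewrite Rabs_Ropp in H0.
  specialize (K e he). lra.
Qed.

(** F is only continuous up to the sides. Its dilates [F (c + t (z - c))] with t < 1 are holomorphic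
    on the closed box, and they tend to F uniformly as t tends to 1. *)
Lemma goursat F r : bl r < br r -> bd r < bu r ->
  (forall z, in_box r z -> continuous F z) ->
  (forall z, in_box_int r z -> hol F z) -> contour F r = 0.
Proof.
intros w1 w2 cF hF.
assert (wf : wf_box r) by (split; lra).
set (c := ((bl r + br r) / 2, (bd r + bu r) / 2) : C).
set (W := br r - bl r). set (H := bu r - bd r).
set (sc := fun (t : R) (z : C) => (c + RtoC t * (z - c))%C).
assert (scin : forall t z, 0 <= t <= 1 -> in_box r z -> in_box r (sc t z)).
{ intros t z ht [h1 h2]. unfold sc, c in *. creal. unfold in_box. cbn.
  split; split; nra. }
assert (scint : forall t z, 0 <= t < 1 -> in_box r z -> in_box_int r (sc t z)).
{ intros t z ht [h1 h2]. unfold sc, c in *. creal. unfold in_box_int. cbn.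
  split; split; nra. }
assert (schol : forall t z, hol (sc t) z).
{ intros. unfold sc. apply hol_plus; [apply hol_const|]. apply hol_mult; [apply hol_const|].
  apply hol_minus; [apply hol_id | apply hol_const]. }
assert (K : forall eta, 0 < eta -> Rabs (contour F r) <= eta * (2 * H + 2 * W)).
{ intros eta he.
  destruct (box_local_global r (fun z e => forall t, 1 - e < t < 1 -> 0 <= t ->
     Cmod (F z - F (sc t z)) <= eta)) as [e [hep He]]; auto.
  - intros z s t hst h u hu. apply h; lra.
  - intros z hz.
    destruct (proj1 (continuous_Cmod_eps F z) (cF z hz) (eta / 2)) as [d [hd Hd]]; [lra|].
    set (D := 2 * (W + H + 1)). assert (hD : 0 < D) by (unfold D, W, H; lra).
    exists (d / 2), (d / 2 / D). repeat split; [lra | apply Rdiv_lt_0_compat; lra|].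
    intros z' hz' hzz t ht ht0.
    assert (hs : Cmod (sc t z' - z) < d).
    { replace (sc t z' - z)%C with ((z' - z) + RtoC (- (1 - t)) * (z' - c))%C
        by (unfold sc; rewrite RtoC_opp, RtoC_minus; ring).
      eapply Rle_lt_trans; [apply Cmod_triangle|].
      rewrite Cmod_mult, Cmod_R, Rabs_Ropp, Rabs_right by lra.
      assert (hc : in_box r c) by (unfold in_box, c; cbn; lra).
      assert (Cmod (z' - c) < D).
      { unfold D. apply in_box_Cmod with r; auto; unfold W, H; lra. }
      assert ((1 - t) * Cmod (z' - c) <= d / 2 / D * D).
      { apply Rmult_le_compat; try lra. apply Cmod_ge_0. }
      replace (d / 2 / D * D) with (d / 2) in H1 by (field; lra). lra. }
    assert (hs' : Cmod (z' - z) < d) by lra.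
    pose proof (Hd _ hs). pose proof (Hd _ hs').
    replace (F z' - F (sc t z'))%C with ((F z' - F z) - (F (sc t z') - F z))%C by ring.
    unfold Cminus at 1. eapply Rle_trans; [apply Cmod_triangle|]. rewrite Cmod_opp. lra.
  - set (t := Rmax (1 / 2) (1 - e / 2)).
    assert (ht : 1 - e < t < 1 /\ 0 <= t) by (unfold t; minmax).
    set (G := fun z => F (sc t z)).
    assert (cG : forall z, in_box r z -> continuous G z).
    { intros z hz. apply (continuous_comp (sc t) F); [apply hol_continuous, schol|].
      apply cF, scin; auto; lra. }
    assert (G0 : contour G r = 0).
    { apply goursat_closed; auto. intros z hz. apply (hol_comp F (sc t)); auto. apply hF, scint; auto; lra. }
    rewrite contour_split in G0 by auto. rewrite contour_split by auto.
    assert (V : forall x, bl r <= x <= br r ->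
      Rabs (RInt (fun y => Re (F (x, y))) (bd r) (bu r) - RInt (fun y => Re (G (x, y))) (bd r) (bu r))
      <= H * eta).
    { intros x hx. replace (_ - _) with
        (RInt (fun y => Re (F (x, y)) - Re (G (x, y))) (bd r) (bu r)).
      - unfold H. apply abs_RInt_le_const; [lra| |].
        + apply (ex_RInt_minus (V := R_CompleteNormedModule)); apply (fun F cF => ex_RInt_vert F r cF); auto; lra.
        + intros y hy. assert (hz : in_box r (x, y)) by (split; cbn; lra).
          pose proof (He _ hz t (proj1 ht) (proj2 ht)) as Hq.
          eapply Rle_trans; [|exact Hq].
          eapply Rle_trans; [|apply re_le_Cmod]. right. f_equal.
      - apply (RInt_minus (V := R_CompleteNormedModule)); apply (fun F cF => ex_RInt_vert F r cF); auto; lra. }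
    assert (Hz : forall y, bd r <= y <= bu r ->
      Rabs (RInt (fun x => Im (F (x, y))) (bl r) (br r) - RInt (fun x => Im (G (x, y))) (bl r) (br r))
      <= W * eta).
    { intros y hy. replace (_ - _) with
        (RInt (fun x => Im (F (x, y)) - Im (G (x, y))) (bl r) (br r)).
      - unfold W. apply abs_RInt_le_const; [lra| |].
        + apply (ex_RInt_minus (V := R_CompleteNormedModule)); apply (fun F cF => ex_RInt_horiz F r cF); auto; lra.
        + intros x hx. assert (hz : in_box r (x, y)) by (split; cbn; lra).
          pose proof (He _ hz t (proj1 ht) (proj2 ht)) as Hq.
          eapply Rle_trans; [|exact Hq].
          eapply Rle_trans; [|apply Im_le_Cmod]. right. f_equal.
      - apply (RInt_minus (V := R_CompleteNormedModule)); apply (fun F cF => ex_RInt_horiz F r cF); auto; lra. }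
    pose proof (V (br r) ltac:(lra)) as v1. pose proof (V (bl r) ltac:(lra)) as v2.
    pose proof (Hz (bd r) ltac:(lra)) as v3. pose proof (Hz (bu r) ltac:(lra)) as v4.
    apply Rabs_le_between in v1, v2, v3, v4. apply Rabs_le_between. lra. }
assert (hWH : 0 < 2 * H + 2 * W) by (unfold H, W; lra).
assert (Rabs (contour F r) <= 0).
{ apply le_epsilon. intros e he. rewrite Rplus_0_l.
  specialize (K (e / (2 * H + 2 * W)) ltac:(now apply Rdiv_lt_0_compat)).
  replace (e / (2 * H + 2 * W) * (2 * H + 2 * W)) with e in K by (field; lra). exact K. }
pose proof (Rabs_pos (contour F r)). apply Rabs_eq_0. lra.
Qed.

(** * Mean values and the maximum principle *)

Lemma Re_le_Cmod (z : C) : Re z <= Cmod z.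
Proof. eapply Rle_trans; [apply Rle_abs | apply re_le_Cmod]. Qed.

(** In the contour the two horizontal sides cancel, because [Im P] takes equal values on them; the
    two vertical sides are left. *)
Lemma strip_mean (P : C -> C) (a b c d : R) : a < b -> c < d ->
  (forall z, in_box (Box a b c d) z -> continuous P z) ->
  (forall z, in_box_int (Box a b c d) z -> hol P z) ->
  (forall x, a <= x <= b -> Im (P (x, c)) = Im (P (x, d))) ->
  RInt (fun y => Re (P (b, y))) c d = RInt (fun y => Re (P (a, y))) c d.
Proof.
intros hab hcd cP hP hI.
pose proof (goursat P (Box a b c d) hab hcd cP hP) as G.
rewrite contour_split in G; [|split; cbn; lra|exact cP]. cbn [bl br bd bu] in G.
assert (E : RInt (fun x => Im (P (x, c))) a b = RInt (fun x => Im (P (x, d))) a b).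
{ apply RInt_ext. intros x. rewrite Rmin_left, Rmax_right by lra. intros hx. apply hI; lra. }
lra.
Qed.

Lemma mean_limit (P : C -> C) (c d L : R) : c < d ->
  (forall z, Re z <= 0 -> c <= Im z <= d -> continuous P z) ->
  (forall z, Re z < 0 -> c < Im z < d -> hol P z) ->
  (forall x, x <= 0 -> Im (P (x, c)) = Im (P (x, d))) ->
  (forall e, 0 < e -> exists A, A < 0 /\ forall y, c <= y <= d -> Rabs (Re (P (A, y)) - L) <= e) ->
  RInt (fun y => Re (P (0, y))) c d = L * (d - c).
Proof.
intros hcd cP hP hI hL.
assert (K : forall e, 0 < e -> Rabs (RInt (fun y => Re (P (0, y))) c d - L * (d - c)) <= e).
{ intros e he. destruct (hL (e / (d - c))) as [A [hA H]]; [apply Rdiv_lt_0_compat; lra|].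
  rewrite (strip_mean P A 0 c d); auto.
  - replace e with (e / (d - c) * (d - c)) by (field; lra).
    apply RInt_near_const; [lra| |exact H].
    apply (ex_RInt_vert P (Box A 0 c d)); cbn; try lra. intros z [h1 h2]; cbn in *; apply cP; lra.
  - intros z [h1 h2]; cbn in *. apply cP; lra.
  - intros z [h1 h2]; cbn in *. apply hP; lra.
  - intros x hx. apply hI; lra. }
apply Rminus_diag_uniq.
assert (Rabs (RInt (fun y => Re (P (0, y))) c d - L * (d - c)) <= 0).
{ apply le_epsilon. intros e he. rewrite Rplus_0_l. auto. }
pose proof (Rabs_pos (RInt (fun y => Re (P (0, y))) c d - L * (d - c))). apply Rabs_eq_0; lra.
Qed.

(* A negative r describes the lower half circle when t ranges over [0, PI]. *)
Definition circ (z0 : C) (r t : R) : C := (z0 + RtoC r * Cexp (0, t))%C.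
(** Exponential coordinates around z0: horizontal strips become sectors, and the left end becomes
    the centre. Means over vertical segments turn into means over arcs. *)
Definition polar (z0 : C) (r : R) (z : C) : C := (z0 + RtoC r * Cexp z)%C.

Lemma polar_circ z0 r x t : polar z0 r (x, t) = circ z0 (r * exp x) t.
Proof.
unfold polar, circ, Cexp. ceq; rewrite exp_0; ring.
Qed.

Lemma hol_polar z0 r z : hol (polar z0 r) z.
Proof. apply hol_plus; [apply hol_const|]. apply hol_mult; [apply hol_const | apply hol_Cexp]. Qed.

Lemma continuous_circ z0 r t : continuous (circ z0 r) t.
Proof.
apply continuous_Cplus; [apply continuous_const|].
apply continuous_Cmult; [apply continuous_const|].
apply continuous_Cexp, continuous_Cpair; [apply continuous_const | apply continuous_id].
Qed.

Lemma Cmod_circ z0 r t : Cmod (circ z0 r t - z0) = Rabs r.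
Proof.
unfold circ. replace (z0 + r * Cexp (0, t) - z0)%C with (RtoC r * Cexp (0, t))%C by ring.
rewrite Cmod_mult, Cmod_R, Cmod_Cexp. cbn. rewrite exp_0. ring.
Qed.

Lemma circ_re z0 r t : Re (circ z0 r t) = Re z0 + r * cos t.
Proof. unfold circ, Cexp. creal. rewrite exp_0. ring. Qed.
Lemma circ_im z0 r t : Im (circ z0 r t) = Im z0 + r * sin t.
Proof. unfold circ, Cexp. creal. rewrite exp_0. ring. Qed.

Lemma continuous_polar_fun (F : C -> C) z0 r z :
  continuous F (polar z0 r z) -> continuous (fun z => F (polar z0 r z)) z.
Proof.
intros h. apply (continuous_comp (polar z0 r) F); auto. apply hol_continuous, hol_polar.
Qed.

Lemma small_exp (r d : R) : 0 < d -> exists A, A < 0 /\ Rabs r * exp A < d.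
Proof.
intros hd. pose proof (Rabs_pos r).
set (q := d / (Rabs r + d)).
assert (hq : 0 < q) by (apply Rdiv_lt_0_compat; lra).
assert (hr : Rabs r * q < d).
{ unfold q. apply Rmult_lt_reg_r with (Rabs r + d); [lra|].
  replace (Rabs r * (d / (Rabs r + d)) * (Rabs r + d)) with (Rabs r * d) by (field; lra). nra. }
exists (Rmin (ln q) (-1)). split; [apply Rle_lt_trans with (1 := Rmin_r _ _); lra|].
apply Rle_lt_trans with (2 := hr). apply Rmult_le_compat_l; auto.
apply Rle_trans with (exp (ln q)); [|rewrite exp_ln; lra].
destruct (Rle_lt_or_eq_dec _ _ (Rmin_l (ln q) (-1))) as [h | h].
- left. now apply exp_increasing.
- now rewrite h; right.
Qed.

(** One statement for two uses: with [d = 2 * PI] the two radii coincide and it is the mean value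
    property on a disc; with [d = PI] the radii form a diameter, on which F is real up to rotation.
    The condition on the radii is the cancellation that [strip_mean] asks for. *)
Lemma sector_mean (F : C -> C) (z0 : C) (r d : R) : 0 < d ->
  (forall s t, 0 <= s <= 1 -> 0 <= t <= d -> continuous F (circ z0 (r * s) t)) ->
  (forall s t, 0 < s < 1 -> 0 < t < d -> hol F (circ z0 (r * s) t)) ->
  (forall s, 0 < s <= 1 -> Im (F (circ z0 (r * s) 0)) = Im (F (circ z0 (r * s) d))) ->
  RInt (fun t => Re (F (circ z0 r t))) 0 d = Re (F z0) * d.
Proof.
intros hd cF hF hI.
assert (ex : forall x, x <= 0 -> 0 < exp x <= 1).
{ intros x hx. split; [apply exp_pos|]. rewrite <- exp_0.
  destruct hx as [hx | ->]; [left; now apply exp_increasing | lra]. }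
transitivity (RInt (fun y => Re (F (polar z0 r (0, y)))) 0 d).
{ apply RInt_ext. intros y _. rewrite polar_circ, exp_0, Rmult_1_r. reflexivity. }
rewrite <- (Rminus_0_r d) at 2.
apply (mean_limit (fun z => F (polar z0 r z))); auto.
- intros [x y] h1 h2; cbn in h1, h2. apply continuous_polar_fun. rewrite polar_circ.
  apply cF; auto. specialize (ex x h1); lra.
- intros [x y] h1 h2; cbn in h1, h2. apply (hol_comp F); [|apply hol_polar]. rewrite polar_circ.
  apply hF; auto. split; [apply exp_pos|]. rewrite <- exp_0. now apply exp_increasing.
- intros x hx. rewrite !polar_circ. apply hI. auto.
- intros e he.
  assert (c0 : continuous F z0).
  { replace z0 with (circ z0 (r * 0) 0); [apply cF; lra|]. unfold circ. rewrite Rmult_0_r. ring. }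
  destruct (proj1 (continuous_Cmod_eps F z0) c0 e he) as [q [hq Hq]].
  destruct (small_exp r q hq) as [A [hA HA]].
  exists A. split; auto. intros y hy. left.
  apply Rle_lt_trans with (Cmod (F (polar z0 r (A, y)) - F z0)).
  + eapply Rle_trans; [|apply re_le_Cmod]. right. f_equal.
  + apply Hq. rewrite polar_circ, Cmod_circ, Rabs_mult, (Rabs_right (exp A)); auto.
    pose proof (exp_pos A); lra.
Qed.

Lemma hol_scal (k : C) (F : C -> C) z : hol F z -> hol (fun z => (k * F z)%C) z.
Proof. intros. apply hol_mult; auto. apply hol_const. Qed.

Lemma continuous_scal_C {U : UniformSpace} (k : C) (F : U -> C) z :
  continuous F z -> continuous (fun z => (k * F z)%C) z.
Proof. intros. apply continuous_Cmult; auto. apply continuous_const. Qed.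

Lemma ex_RInt_circ (u : C -> R) z0 r d : 0 <= d ->
  (forall t, 0 <= t <= d -> continuous u (circ z0 r t)) ->
  ex_RInt (fun t => u (circ z0 r t)) 0 d.
Proof.
intros hd h. apply ex_RInt_cont; auto. intros t ht.
apply (continuous_comp (circ z0 r) u); [apply continuous_circ | auto].
Qed.

(** The factor l turns [F z0] into a nonnegative real number, so that its modulus is the mean of
    [Re (l * F)], which is at most the mean of the modulus. *)
Lemma sector_submean (F : C -> C) (l z0 : C) (r d : R) : 0 < d -> l <> 0%C ->
  (forall s t, 0 <= s <= 1 -> 0 <= t <= d -> continuous F (circ z0 (r * s) t)) ->
  (forall s t, 0 < s < 1 -> 0 < t < d -> hol F (circ z0 (r * s) t)) ->
  (forall s, 0 < s <= 1 -> Im (l * F (circ z0 (r * s) 0)) = Im (l * F (circ z0 (r * s) d))) ->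
  Cmod (l * F z0) = Re (l * F z0) ->
  Cmod (F z0) * d <= RInt (fun t => Cmod (F (circ z0 r t))) 0 d.
Proof.
intros hd hl cF hF hI h0.
assert (hl' : 0 < Cmod l) by now apply Cmod_gt_0.
pose proof (sector_mean (fun z => (l * F z)%C) z0 r d hd) as S.
cbn beta in S. rewrite <- h0, Cmod_mult in S.
apply Rmult_le_reg_l with (Cmod l); auto.
rewrite <- Rmult_assoc, <- S; clear S.
- rewrite <- (RInt_scal (V := R_CompleteNormedModule)).
  + assert (c1 : forall t, 0 <= t <= d -> continuous F (circ z0 r t)).
    { intros t ht. rewrite <- (Rmult_1_r r). apply cF; auto; lra. }
    apply RInt_le; [lra| | |].
    * apply (ex_RInt_circ (fun z => Re (l * F z)%C)); [lra|].
      intros t ht. apply (continuous_Re (fun z => (l * F z)%C)), continuous_scal_C; auto.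
    * apply (ex_RInt_scal (V := R_NormedModule)).
      apply (ex_RInt_circ (fun z => Cmod (F z))); [lra|]. intros t ht. apply continuous_Cmod; auto.
    * intros t _. change (Re (l * F (circ z0 r t)) <= Cmod l * Cmod (F (circ z0 r t))).
      rewrite <- Cmod_mult. apply Re_le_Cmod.
  + apply (ex_RInt_circ (fun z => Cmod (F z))); [lra|]. intros t ht. apply continuous_Cmod.
    rewrite <- (Rmult_1_r r). apply cF; auto; lra.
- intros s t hs ht. apply continuous_scal_C; auto.
- intros s t hs ht. apply hol_scal; auto.
- intros s hs. auto.
Qed.

Lemma circ_2PI z0 r : circ z0 r (2 * PI) = circ z0 r 0.
Proof. unfold circ, Cexp. cbn. now rewrite cos_2PI, sin_2PI, cos_0, sin_0. Qed.

Lemma disc_submean (F : C -> C) (z0 : C) (r : R) : 0 < r ->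
  (forall z, Cmod (z - z0) <= r -> continuous F z) ->
  (forall z, Cmod (z - z0) < r -> hol F z) ->
  Cmod (F z0) * (2 * PI) <= RInt (fun t => Cmod (F (circ z0 r t))) 0 (2 * PI).
Proof.
intros hr cF hF. pose proof PI_RGT_0.
assert (c1 : forall t, continuous F (circ z0 r t)).
{ intros t. apply cF. rewrite Cmod_circ, Rabs_right; lra. }
destruct (classic (F z0 = 0%C)) as [E | N].
- rewrite E, Cmod_0, Rmult_0_l. apply RInt_ge_0; [lra| |intros; apply Cmod_ge_0].
  apply (ex_RInt_circ (fun z => Cmod (F z))); [lra|]. intros. now apply continuous_Cmod.
- apply sector_submean with (Cconj (F z0)); [lra| | | | |].
  + intros E. apply N. rewrite <- (Cconj_conj (F z0)), E. ceq; ring.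
  + intros s t hs ht. apply cF. rewrite Cmod_circ, Rabs_mult, !Rabs_right by lra. nra.
  + intros s t hs ht. apply hF. rewrite Cmod_circ, Rabs_mult, !Rabs_right by lra. nra.
  + intros s hs. now rewrite circ_2PI.
  + rewrite Cmod_mult, Cmod_conj, (Cmult_comm (Cconj _)), <- Cmod2_conj.
    cbn. ring.
Qed.

(** A substitute for Schwarz reflection: [l * F] is real on the diameter, and one of the factors l
    and -l makes the value at the centre nonnegative, as [sector_submean] requires. *)
Lemma half_submean (F : C -> C) (l z0 : C) (r : R) : l <> 0%C -> r <> 0 ->
  (forall s t, 0 <= s <= 1 -> 0 <= t <= PI -> continuous F (circ z0 (r * s) t)) ->
  (forall s t, 0 < s < 1 -> 0 < t < PI -> hol F (circ z0 (r * s) t)) ->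
  (forall x, Rabs x <= Rabs r -> Im (l * F (z0 + RtoC x)%C) = 0) ->
  Cmod (F z0) * PI <= RInt (fun t => Cmod (F (circ z0 r t))) 0 PI.
Proof.
intros hl hr cF hF hI. pose proof PI_RGT_0.
assert (I0 : Im (l * F z0) = 0).
{ specialize (hI 0). rewrite Rabs_R0 in hI. specialize (hI (Rabs_pos r)).
  now replace (z0 + RtoC 0)%C with z0 in hI by ring. }
assert (K : forall k : R, k <> 0 -> 0 <= k * Re (l * F z0) ->
  Cmod (F z0) * PI <= RInt (fun t => Cmod (F (circ z0 r t))) 0 PI).
{ intros k hk hk0.
  assert (IK : forall z, Im (l * F z) = 0 -> Im (RtoC k * l * F z)%C = 0).
  { intros z hz. rewrite <- Cmult_assoc, im_scal_l, hz. ring. }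
  apply sector_submean with (RtoC k * l)%C; auto.
  - apply Cmult_neq_0; auto. intros E. now apply RtoC_inj in E.
  - intros s hs.
    rewrite !IK; auto.
    + replace (circ z0 (r * s) PI) with (z0 + RtoC (- (r * s)))%C.
      * apply hI. rewrite Rabs_Ropp, Rabs_mult, (Rabs_right s) by lra. pose proof (Rabs_pos r). nra.
      * unfold circ, Cexp. ceq; rewrite ?cos_PI, ?sin_PI, exp_0; ring.
    + replace (circ z0 (r * s) 0) with (z0 + RtoC (r * s))%C.
      * apply hI. rewrite Rabs_mult, (Rabs_right s) by lra. pose proof (Rabs_pos r). nra.
      * unfold circ, Cexp. ceq; rewrite ?cos_0, ?sin_0, exp_0; ring.
  - specialize (IK z0 I0). rewrite <- Cmult_assoc in IK |- *. rewrite im_scal_l in IK.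
    assert (E : (l * F z0)%C = RtoC (Re (l * F z0))) by (apply Ceq_intro; [reflexivity | exact I0]).
    rewrite E. rewrite <- RtoC_mult, Cmod_R. rewrite Rabs_right; [reflexivity | apply Rle_ge; exact hk0]. }
destruct (Rle_dec 0 (Re (l * F z0))) as [h | h].
- apply (K 1); lra.
- apply (K (- (1))); lra.
Qed.

(** The condition [sin d = 0] admits full circles and half circles. It is what makes the integral of
    cos over the arc vanish in [RInt_sq_circ]. *)
Definition submean_at (u : C -> R) (r : box) (p : C) : Prop :=
  exists q d, q <> 0 /\ 0 < d /\ sin d = 0 /\ (forall t, 0 <= t <= d -> in_box r (circ p q t)) /\
    u p * d <= RInt (fun t => u (circ p q t)) 0 d.

Lemma RInt_sq_circ (x q d : R) : sin d = 0 ->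
  is_RInt (fun t => (x + q * cos t) ^ 2) 0 d (d * (x ^ 2 + q ^ 2 / 2)).
Proof.
intros hd.
set (G := fun t => x ^ 2 * t + 2 * x * q * sin t + q ^ 2 * (t / 2 + sin t * cos t / 2)).
replace (d * (x ^ 2 + q ^ 2 / 2)) with (minus (G d) (G 0)).
2:{ unfold G, minus, plus, opp; cbn -[pow]. rewrite hd, sin_0. field. }
apply (is_RInt_derive (V := R_CompleteNormedModule) G).
- intros t _. unfold G. auto_derive; auto.
  pose proof (sin2_cos2 t) as h. unfold Rsqr in h.
  replace (sin t * (1 * - sin t)) with (cos t * cos t - 1) by lra. field.
- intros t _. apply (continuous_Rmult (fun t => x + q * cos t) (fun t => (x + q * cos t) * 1)).
  + apply continuous_Rplus; [apply continuous_const|]. apply continuous_Rmult; [apply continuous_const|].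
    apply continuous_cos.
  + apply continuous_Rmult; [|apply continuous_const].
    apply continuous_Rplus; [apply continuous_const|]. apply continuous_Rmult; [apply continuous_const|].
    apply continuous_cos.
Qed.

(* Adding a multiple of x^2 makes the mean value inequality strict. *)
Lemma max_principle (u : C -> R) (r : box) (B : R) : wf_box r ->
  (forall z, in_box r z -> continuous u z) ->
  (forall p, in_box r p -> u p <= B \/ submean_at u r p) ->
  forall p, in_box r p -> u p <= B.
Proof.
intros wf cu hu.
set (K := (Rabs (bl r) + Rabs (br r)) ^ 2).
assert (hK : forall z, in_box r z -> 0 <= Re z ^ 2 <= K).
{ intros z [hz _]. split; [apply pow2_ge_0|]. unfold K. apply pow_maj_Rabs.
  apply Rabs_le. pose proof (Rle_abs (br r)). pose proof (Rle_abs (- bl r)). rewrite Rabs_Ropp in H0.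
  pose proof (Rabs_pos (bl r)). pose proof (Rabs_pos (br r)). lra. }
assert (C2 : forall z : C, continuous (fun z : C => Re z ^ 2) z).
{ intros z. apply (continuous_Rmult (fun z : C => Re z) (fun z : C => Re z * 1)).
  - apply (continuous_Re (fun z : C => z)), continuous_id.
  - apply continuous_Rmult; [|apply continuous_const]. apply (continuous_Re (fun z : C => z)), continuous_id. }
intros p hp. apply le_epsilon. intros e he.
set (eta := e / (K + 1)).
assert (hK0 : 0 <= K) by (unfold K; apply pow2_ge_0).
assert (heta : 0 < eta) by (apply Rdiv_lt_0_compat; lra).
assert (hek : eta * K <= e).
{ unfold eta. apply Rmult_le_reg_r with (K + 1); [lra|].
  replace (e / (K + 1) * K * (K + 1)) with (e * K) by (field; lra). nra. }
set (v := fun z => u z + eta * Re z ^ 2).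
assert (cv : forall z, in_box r z -> continuous v z).
{ intros z hz. apply continuous_Rplus; auto.
  apply continuous_Rmult; [apply continuous_const | apply C2]. }
destruct (box_max r v wf cv) as [m [hm Hm]].
assert (hup : u p <= v p) by (unfold v; destruct (hK p hp); nra).
destruct (hu m hm) as [hB | [q [d [hq [hd [hs [hin hmean]]]]]]].
- pose proof (Hm p hp). destruct (hK m hm). unfold v in *. nra.
- exfalso.
  assert (eu : ex_RInt (fun t => u (circ m q t)) 0 d).
  { apply ex_RInt_circ; [lra|]. intros t ht. apply cu, hin; auto. }
  pose proof (RInt_sq_circ (Re m) q d hs) as I2.
  assert (iv : is_RInt (fun t => v (circ m q t)) 0 d
    (RInt (fun t => u (circ m q t)) 0 d + eta * (d * (Re m ^ 2 + q ^ 2 / 2)))).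
  { apply (is_RInt_ext (fun t => plus (u (circ m q t)) (scal eta ((Re m + q * cos t) ^ 2)))).
    - intros t _. unfold v. rewrite circ_re. reflexivity.
    - apply (is_RInt_plus (V := R_NormedModule)).
      + now apply (RInt_correct (V := R_CompleteNormedModule)).
      + now apply (is_RInt_scal (V := R_NormedModule)). }
  assert (le : RInt (fun t => u (circ m q t)) 0 d + eta * (d * (Re m ^ 2 + q ^ 2 / 2)) <= v m * d).
  { rewrite <- (is_RInt_unique (V := R_CompleteNormedModule) _ _ _ _ iv).
    replace (v m * d) with (RInt (fun _ => v m) 0 d).
    - apply RInt_le; [lra | eexists; exact iv | apply ex_RInt_const|].
      intros t ht. apply Hm, hin; lra.
    - rewrite RInt_const. cbn. unfold scal; cbn. unfold mult; cbn. ring. }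
  assert (0 < q ^ 2) by (apply pow2_gt_0; auto).
  unfold v in le.
  assert (0 < eta * (d * (q ^ 2 / 2))) by (apply Rmult_lt_0_compat; [|apply Rmult_lt_0_compat]; lra).
  lra.
Qed.

(** Only [Im F] is controlled, while the derivative is a Fourier coefficient of all of F. The
    opposite coefficient of F vanishes, so it may be subtracted freely: on the circle this turns the
    integrand P into D times a purely imaginary factor, and [Re P] only involves [Im D]. Towards the
    centre [Re P] tends to r times the modulus of l. *)
Lemma gradient_bound (F : C -> C) (z0 l : C) (r M mu : R) : 0 < r ->
  (forall z, Cmod (z - z0) <= r -> continuous F z) ->
  (forall z, Cmod (z - z0) < r -> hol F z) ->
  cder F z0 l ->
  (forall z, Cmod (z - z0) <= r -> Rabs (Im (F z) - mu) <= M) ->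
  Cmod l <= 4 * M / r.
Proof.
intros hr cF hF hl hM.
assert (z00 : Cmod (z0 - z0) <= r).
{ replace (z0 - z0)%C with (RtoC 0) by ring. rewrite Cmod_0. lra. }
assert (hM0 : 0 <= M) by (apply Rle_trans with (2 := hM z0 z00), Rabs_pos).
destruct (classic (l = 0%C)) as [E | N].
{ rewrite E, Cmod_0. apply Rmult_le_pos; [lra|]. left; now apply Rinv_0_lt_compat. }
pose proof PI_RGT_0.
set (n := Cmod l). assert (hn : 0 < n) by now apply Cmod_gt_0.
(* A unit chosen so that [k * l] is the modulus of l. *)
set (k := (Cconj l * RtoC (/ n))%C).
assert (hk : Cmod k = 1).
{ unfold k. rewrite Cmod_mult, Cmod_conj, Cmod_R. fold n.
  rewrite Rabs_right; [field; lra|]. left. now apply Rinv_0_lt_compat. }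
assert (hkl : Re (k * l) = n).
{ unfold k. replace (Cconj l * RtoC (/ n) * l)%C with (RtoC (/ n) * (l * Cconj l))%C by ring.
  rewrite <- Cmod2_conj, <- RtoC_mult. fold n. cbn. field. lra. }
set (D := fun z => (F (polar z0 r z) - F z0)%C).
set (P := fun z => (k * (D z * Cexp (- z)) - Cconj k * (D z * Cexp z))%C).
assert (pm : forall x y, Cmod (polar z0 r (x, y) - z0) = r * exp x).
{ intros x y. rewrite polar_circ, Cmod_circ. apply Rabs_right. left. apply Rmult_lt_0_compat; auto. apply exp_pos. }
assert (ex : forall x, x <= 0 -> r * exp x <= r).
{ intros x hx. rewrite <- (Rmult_1_r r) at 2. apply Rmult_le_compat_l; [lra|]. rewrite <- exp_0.
  destruct hx as [hx | ->]; [left; now apply exp_increasing | lra]. }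
assert (cD : forall z, Re z <= 0 -> continuous D z).
{ intros [x y] hx. apply continuous_Cminus; [|apply continuous_const].
  apply continuous_polar_fun, cF. rewrite pm. auto. }
assert (hopp : forall z, hol (fun z => Cexp (- z)) z).
{ intros z. apply (hol_comp Cexp); [apply hol_Cexp | apply hol_opp, hol_id]. }
assert (cP : forall z, Re z <= 0 -> continuous P z).
{ intros z hx. apply continuous_Cminus; apply continuous_scal_C.
  - apply (continuous_Cmult D (fun z => Cexp (- z))); [exact (cD z hx) | exact (hol_continuous _ _ (hopp z))].
  - apply (continuous_Cmult D Cexp); [exact (cD z hx) | exact (hol_continuous _ _ (hol_Cexp z))]. }
assert (I : RInt (fun y => Re (P (0, y))) 0 (2 * PI) = r * n * (2 * PI - 0)).
{ apply mean_limit; [lra| | | |].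
  - intros z hx _. apply cP; auto.
  - intros [x y] hx _. cbn in hx.
    assert (hD : hol D (x, y)).
    { apply hol_minus; [|apply hol_const]. apply (hol_comp F); [|apply hol_polar].
      apply hF. rewrite pm. rewrite <- (Rmult_1_r r) at 2. apply Rmult_lt_compat_l; auto.
      rewrite <- exp_0. now apply exp_increasing. }
    apply hol_minus; apply hol_scal, hol_mult; auto. apply hol_Cexp.
  - intros x hx.
    assert (E1 : Cexp (x, 2 * PI) = Cexp (x, 0)) by (unfold Cexp; cbn; now rewrite cos_2PI, sin_2PI, cos_0, sin_0).
    assert (E2 : Cexp (- (x, (2 * PI)%R))%C = Cexp (- (x, 0))%C).
    { unfold Cexp; cbn. now rewrite Ropp_0, cos_neg, sin_neg, cos_2PI, sin_2PI, cos_0, sin_0, Ropp_0. }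
    unfold P, D, polar. now rewrite E1, E2.
  - intros e he.
    destruct (proj1 (cder_eps _ _ _) hl (e / (4 * r))) as [q [hq Hq]]; [apply Rdiv_lt_0_compat; lra|].
    assert (hn1 : 0 < n + e / (4 * r)) by (pose proof (Rdiv_lt_0_compat e (4 * r) he ltac:(lra)); lra).
    set (q' := Rmin q (Rmin 1 (e / (4 * (n + e / (4 * r)))))).
    assert (hq' : 0 < q').
    { unfold q'. repeat apply Rmin_pos; try lra. apply Rdiv_lt_0_compat; lra. }
    destruct (small_exp (r + 1) q' hq') as [A [hA HA]].
    exists A. split; auto. intros y _.
    rewrite (Rabs_right (r + 1)) in HA by lra.
    pose proof (exp_pos A) as hpA.
    assert (hq1 : r * exp A < q /\ exp A < e / (4 * (n + e / (4 * r)))).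
    { unfold q' in HA. pose proof (Rmin_l q (Rmin 1 (e / (4 * (n + e / (4 * r)))))).
      pose proof (Rmin_r q (Rmin 1 (e / (4 * (n + e / (4 * r)))))).
      pose proof (Rmin_r 1 (e / (4 * (n + e / (4 * r))))). nra. }
    destruct hq1 as [hq1 hq2].
    set (z := polar z0 r (A, y)).
    assert (hz : Cmod (z - z0) = r * exp A) by apply pm.
    specialize (Hq z ltac:(now rewrite hz)). rewrite hz in Hq.
    set (R1 := (D (A, y) - l * (z - z0))%C).
    change (Cmod R1 <= e / (4 * r) * (r * exp A)) in Hq.
    assert (ED : D (A, y) = (R1 + l * (z - z0))%C) by (unfold R1; ring).
    assert (Ez : (z - z0)%C = (RtoC r * Cexp (A, y))%C) by (unfold z, polar; ring).
    assert (EE : (Cexp (A, y) * Cexp (- (A, y)))%C = 1%C).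
    { rewrite <- Cexp_plus, Cplus_opp_r. apply Cexp_0. }
    assert (EP : (P (A, y) - k * l * RtoC r)%C =
       (k * (R1 * Cexp (- (A, y))) - Cconj k * (D (A, y) * Cexp (A, y)))%C).
    { unfold P. rewrite ED at 1. rewrite Ez.
      replace (k * ((R1 + l * (r * Cexp (A, y))) * Cexp (- (A, y))))%C with
        (k * (R1 * Cexp (- (A, y))) + k * l * r * (Cexp (A, y) * Cexp (- (A, y))))%C by ring.
      rewrite EE. ring. }
    replace (Re (P (A, y)) - r * n) with (Re (P (A, y) - k * l * RtoC r)%C).
    2:{ rewrite <- hkl. creal. ring. }
    eapply Rle_trans; [apply re_le_Cmod|]. rewrite EP.
    unfold Cminus. eapply Rle_trans; [apply Cmod_triangle|].
    rewrite Cmod_opp, !Cmod_mult, Cmod_conj, hk, !Cmod_Cexp. cbn [Re Copp fst].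
    assert (mD : Cmod (D (A, y)) <= (n + e / (4 * r)) * (r * exp A)).
    { rewrite ED. eapply Rle_trans; [apply Cmod_triangle|]. rewrite Cmod_mult, hz. fold n. lra. }
    assert (t1 : Cmod R1 * exp (- A) <= e / 4).
    { apply Rle_trans with (e / (4 * r) * (r * exp A) * exp (- A)).
      - apply Rmult_le_compat_r; auto. left; apply exp_pos.
      - rewrite exp_Ropp. right. field. lra. }
    assert (t2 : Cmod (D (A, y)) * exp A <= r * exp A * (e / 4)).
    { apply Rle_trans with ((n + e / (4 * r)) * (r * exp A) * exp A).
      - apply Rmult_le_compat_r; auto; lra.
      - assert (Q : forall m, 0 < m -> r * exp A * (e / 4) = m * (r * exp A) * (e / (4 * m))) by (intros; field; lra).
        rewrite (Q _ hn1).
        apply Rmult_le_compat_l; [|lra]. apply Rmult_le_pos; [lra|]. apply Rmult_le_pos; lra. }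
    assert (r * exp A <= 1).
    { left. unfold q' in HA. pose proof (Rmin_r q (Rmin 1 (e / (4 * (n + e / (4 * r)))))).
      pose proof (Rmin_l 1 (e / (4 * (n + e / (4 * r))))). nra. }
    unfold Re in *; cbn [fst snd] in *.
    assert (r * exp A * (e / 4) <= 1 * (e / 4)) by (apply Rmult_le_compat_r; lra). lra. }
assert (J : RInt (fun y => Re (P (0, y))) 0 (2 * PI) <= 4 * M * (2 * PI - 0)).
{ apply Rle_trans with (RInt (fun _ => 4 * M) 0 (2 * PI)).
  - apply RInt_le; [lra| |apply ex_RInt_const|].
    + apply (ex_RInt_vert P (Box 0 0 0 (2 * PI))); cbn; try lra.
      intros z [h1 h2]. cbn in h1. apply cP; lra.
    + intros y _.
      assert (E1 : Cexp (- (0, y))%C = Cconj (Cexp (0, y))).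
      { unfold Cexp. ceq; rewrite Ropp_0, ?cos_neg, ?sin_neg, exp_0; ring. }
      unfold P. rewrite E1.
      set (wv := (k * Cconj (Cexp (0, y)))%C).
      replace (k * (D (0, y) * Cconj (Cexp (0, y))) - Cconj k * (D (0, y) * Cexp (0, y)))%C
        with (D (0, y) * (wv - Cconj wv))%C.
      2:{ unfold wv. rewrite Cmult_conj, Cconj_conj. ring. }
      replace (Re (D (0, y) * (wv - Cconj wv))%C) with (- 2 * (Im (D (0, y)) * Im wv)) by (creal; ring).
      assert (hw : Rabs (Im wv) <= 1).
      { eapply Rle_trans; [apply Im_le_Cmod|]. unfold wv.
        rewrite Cmod_mult, Cmod_conj, Cmod_Cexp, hk. cbn. rewrite exp_0. lra. }
      assert (hD : Rabs (Im (D (0, y))) <= 2 * M).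
      { unfold D. set (q1 := polar z0 r (0, y)).
        replace (Im (F q1 - F z0)%C) with ((Im (F q1) - mu) - (Im (F z0) - mu)) by (creal; ring).
        eapply Rle_trans; [apply Rabs_triang|]. rewrite Rabs_Ropp.
        assert (Rabs (Im (F q1) - mu) <= M) by (apply hM; unfold q1; rewrite pm; apply ex; lra).
        assert (Rabs (Im (F z0) - mu) <= M) by (apply hM; exact z00).
        lra. }
      pose proof (Rle_abs (- (Im (D (0, y)) * Im wv))) as h3. rewrite Rabs_Ropp, Rabs_mult in h3.
      assert (Rabs (Im (D (0, y))) * Rabs (Im wv) <= 2 * M * 1) by (apply Rmult_le_compat; auto using Rabs_pos).
      lra.
  - rewrite RInt_const. right. cbn. unfold scal; cbn. unfold mult; cbn. ring. }
rewrite I in J.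
apply Rmult_le_reg_r with r; auto.
replace (4 * M / r * r) with (4 * M) by (field; lra).
apply Rmult_le_reg_r with (2 * PI - 0); [lra|]. fold n. nra.
Qed.

(** * Open mapping, and the inverse of a conformal map *)

Lemma hol_inv_at (F : C -> C) z : F z <> 0%C -> hol F z -> hol (fun z => (/ F z)%C) z.
Proof.
intros h0 hF.
set (G := fun z' => if excluded_middle_informative (F z' = 0%C) then RtoC 1 else F z').
assert (hl : locally z (fun z' => F z' = G z')).
{ pose proof (continuous_Cmod F z (hol_continuous _ _ hF)) as cm.
  assert (hp : 0 < Cmod (F z)) by now apply Cmod_gt_0.
  assert (L : locally z (fun z' => 0 < Cmod (F z'))).
  { apply (cm (fun y => 0 < y)). exists (mkposreal _ hp). intros y hy.
    unfold ball in hy; cbn in hy. unfold AbsRing_ball, abs, minus, plus, opp in hy; cbn in hy.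
    apply Rabs_def2 in hy. lra. }
  revert L. apply filter_imp. intros z' hz'. unfold G.
  destruct (excluded_middle_informative (F z' = 0%C)) as [E|]; auto.
  rewrite E, Cmod_0 in hz'. lra. }
apply (hol_ext_loc (fun z => / G z)%C).
- revert hl. apply filter_imp. intros z' ->. reflexivity.
- apply hol_inv.
  + intros z'. unfold G. destruct (excluded_middle_informative (F z' = 0%C)); auto.
    intros E. apply RtoC_inj in E. lra.
  + now apply (hol_ext_loc F).
Qed.

Lemma int_disc (r : box) (p : C) : in_box_int r p ->
  exists q, 0 < q /\ forall z, Cmod (z - p) <= q -> in_box_int r z.
Proof.
intros [h1 h2].
set (q := Rmin (Rmin (Re p - bl r) (br r - Re p)) (Rmin (Im p - bd r) (bu r - Im p))).
assert (hq : 0 < q /\ q <= Re p - bl r /\ q <= br r - Re p /\ q <= Im p - bd r /\ q <= bu r - Im p) by (unfold q; minmax).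
exists (q / 2). split; [lra|]. intros z hz.
pose proof (Rle_trans _ _ _ (re_le_Cmod (z - p)%C) hz) as hr.
pose proof (Rle_trans _ _ _ (Im_le_Cmod (z - p)%C) hz) as hi.
apply Rabs_le_between in hr, hi. creal. unfold in_box_int, Re, Im. lra.
Qed.

Lemma in_box_int_in r z : in_box_int r z -> in_box r z.
Proof. intros [h1 h2]; split; lra. Qed.

Lemma submean_interior (F : C -> C) (r : box) (p : C) :
  (forall z, in_box_int r z -> hol F z) -> in_box_int r p ->
  submean_at (fun z => Cmod (F z)) r p.
Proof.
intros hF hp. destruct (int_disc r p hp) as [q [hq Hq]].
exists q, (2 * PI). pose proof PI_RGT_0.
split; [lra|]. split; [lra|]. split; [apply sin_2PI|]. split.
- intros t _. apply in_box_int_in, Hq. rewrite Cmod_circ, Rabs_right; lra.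
- apply disc_submean; auto.
  + intros z hz. now apply hol_continuous, hF, Hq.
  + intros z hz. apply hF, Hq. lra.
Qed.

Lemma box_min_away (r : box) (F : C -> C) (y : C) : wf_box r ->
  (forall z, in_box r z -> continuous F z) -> (forall z, in_box r z -> F z <> y) ->
  exists m, 0 < m /\ forall z, in_box r z -> m <= Cmod (F z - y).
Proof.
intros wf cF hF.
destruct (box_max r (fun z => - Cmod (F z - y)) wf) as [p [hp Hp]].
- intros z hz. apply (continuous_Ropp (fun z => Cmod (F z - y))), continuous_Cmod.
  apply continuous_Cminus; [auto | apply continuous_const].
- exists (Cmod (F p - y)). split.
  + apply Cmod_gt_0, Cminus_neq. auto.
  + intros z hz. specialize (Hp z hz). lra.
Qed.

Lemma box_boundary (r : box) (p : C) : in_box r p ->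
  in_box_int r p \/ in_box (Box (bl r) (bl r) (bd r) (bu r)) p \/
  in_box (Box (br r) (br r) (bd r) (bu r)) p \/ in_box (Box (bl r) (br r) (bd r) (bd r)) p \/
  in_box (Box (bl r) (br r) (bu r) (bu r)) p.
Proof.
intros [h1 h2]. unfold in_box_int, in_box; cbn.
destruct (Req_dec (Re p) (bl r)), (Req_dec (Re p) (br r)), (Req_dec (Im p) (bd r)),
  (Req_dec (Im p) (bu r)); lra.
Qed.

(** If a value y near [F z0] were omitted on the box, [1 / (F - y)] would be holomorphic there and
    larger at the centre than anywhere on the boundary, against the maximum principle. *)
Lemma open_map (F : C -> C) (z0 : C) (s : R) : 0 < s ->
  let r := Box (Re z0 - s) (Re z0 + s) (Im z0 - s) (Im z0 + s) in
  (forall z, in_box r z -> hol F z) ->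
  (forall z, in_box r z -> F z = F z0 -> z = z0) ->
  exists m, 0 < m /\ forall y, Cmod (y - F z0) < m -> exists z, in_box r z /\ F z = y.
Proof.
intros hs r hF inj.
assert (cF : forall z, in_box r z -> continuous F z) by (intros; now apply hol_continuous, hF).
assert (wf : wf_box r) by (split; cbn; lra).
assert (E : forall r', wf_box r' -> (forall z, in_box r' z -> in_box r z /\ z <> z0) ->
  exists m, 0 < m /\ forall z, in_box r' z -> m <= Cmod (F z - F z0)).
{ intros r' wf' h. apply box_min_away; auto.
  - intros z hz. apply cF. now apply h.
  - intros z hz e. destruct (h z hz) as [h1 h2]. apply h2, inj; auto. }
destruct (E (Box (bl r) (bl r) (bd r) (bu r))) as [m1 [p1 q1]].
{ split; cbn; lra. }
{ intros z [h1 h2]; cbn in h1, h2. split; [split; cbn; lra|]. intros ->. lra. }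
destruct (E (Box (br r) (br r) (bd r) (bu r))) as [m2 [p2 q2]].
{ split; cbn; lra. }
{ intros z [h1 h2]; cbn in h1, h2. split; [split; cbn; lra|]. intros ->. lra. }
destruct (E (Box (bl r) (br r) (bd r) (bd r))) as [m3 [p3 q3]].
{ split; cbn; lra. }
{ intros z [h1 h2]; cbn in h1, h2. split; [split; cbn; lra|]. intros ->. lra. }
destruct (E (Box (bl r) (br r) (bu r) (bu r))) as [m4 [p4 q4]].
{ split; cbn; lra. }
{ intros z [h1 h2]; cbn in h1, h2. split; [split; cbn; lra|]. intros ->. lra. }
set (m := Rmin (Rmin m1 m2) (Rmin m3 m4)).
assert (hm : 0 < m /\ m <= m1 /\ m <= m2 /\ m <= m3 /\ m <= m4) by (unfold m; minmax).
exists (m / 2). split; [lra|]. intros y hy.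
apply NNPP. intros N.
assert (ny : forall z, in_box r z -> (F z - y)%C <> 0%C).
{ intros z hz. apply Cminus_neq. intros e. apply N. eauto. }
set (G := fun z => (/ (F z - y))%C).
assert (hG : forall z, in_box r z -> hol G z).
{ intros z hz. apply (hol_inv_at (fun z => (F z - y)%C)); auto.
  apply hol_minus; auto. apply hol_const. }
assert (K : Cmod (G z0) <= / (m / 2)).
{ apply (max_principle (fun z => Cmod (G z)) r (/ (m / 2))); auto.
  - intros z hz. now apply continuous_Cmod, hol_continuous, hG.
  - intros p hp. destruct (box_boundary r p hp) as [h | h].
    + right. apply submean_interior; auto. intros z hz. now apply hG, in_box_int_in.
    + left. unfold G. rewrite Cmod_inv by auto. apply Rinv_le_contravar; [lra|].
      assert (m <= Cmod (F p - F z0)).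
      { destruct h as [h | [h | [h | h]]];
        [specialize (q1 p h) | specialize (q2 p h) | specialize (q3 p h) | specialize (q4 p h)]; lra. }
      pose proof (Cmod_triangle_minus (F p) y (F z0)). lra.
  - split; cbn; lra. }
assert (z0in : in_box r z0) by (split; cbn; lra).
unfold G in K. rewrite Cmod_inv in K by auto.
rewrite Cmod_minus_sym in hy.
assert (0 < Cmod (F z0 - y)) by (apply Cmod_gt_0; auto).
assert (0 < Cmod (F z0 - y) * (m / 2)) by (apply Rmult_lt_0_compat; lra).
pose proof (Rinv_lt_contravar _ _ H0 hy). lra.
Qed.

Definition clamp (z : C) : C := (Re z, Rmax 0 (Im z)).
(** The map is only constrained on the closed half plane. Composing it with the projection onto that
    half plane gives a function continuous on all of [C], so that relative continuity never has to
    be carried along. *)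
Definition wbar (w : C -> C) (z : C) : C := w (clamp z).

Lemma clamp_id z : 0 <= Im z -> clamp z = z.
Proof. intros h. unfold clamp. rewrite Rmax_right by auto. now destruct z. Qed.

Lemma wbar_eq w z : 0 <= Im z -> wbar w z = w z.
Proof. intros h. unfold wbar. now rewrite clamp_id. Qed.

Lemma clamp_upper z : upper_closed (clamp z).
Proof. apply Rmax_l. Qed.

Lemma Cmod_clamp z z' : Cmod (clamp z' - clamp z) <= Cmod (z' - z).
Proof.
unfold Cmod. apply sqrt_le_1_alt.
apply Rplus_le_compat_l. rewrite <- !Rsqr_pow2. apply Rsqr_le_abs_1.
destruct z as [x y], z' as [x' y']. cbn.
unfold Rmax. destruct (Rle_dec 0 y'), (Rle_dec 0 y); unfold Rabs; repeat destruct Rcase_abs; lra.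
Qed.

Lemma continuous_wbar w : continuous_on upper_closed w -> forall z, continuous (wbar w) z.
Proof.
intros h z. apply continuous_Cmod_eps. intros e he.
specialize (h (clamp z) (clamp_upper z) (fun y => Cmod (y - w (clamp z)) < e)).
assert (L : locally (w (clamp z)) (fun y => Cmod (y - w (clamp z)) < e)).
{ apply locally_Cmod. exists e; auto. }
specialize (h L). apply locally_Cmod in h. destruct h as [d [hd Hd]].
exists d. split; auto. intros z' hz'. apply Hd; [|apply clamp_upper].
apply Rle_lt_trans with (2 := hz'). apply Cmod_clamp.
Qed.

Lemma upper_locally z : 0 < Im z -> locally z (fun z' => 0 < Im z').
Proof.
intros h. apply locally_Cmod. exists (Im z). split; auto. intros z' hz'.
pose proof (Rle_lt_trans _ _ _ (Im_le_Cmod (z' - z)%C) hz') as k.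
apply Rabs_def2 in k. creal. unfold Im in *. lra.
Qed.

Lemma hol_wbar w z : (forall z, upper z -> ex_derive (K := C_AbsRing) (V := C_NormedModule) w z) ->
  0 < Im z -> hol (wbar w) z.
Proof.
intros h hz. apply (hol_ext_loc w); [|apply ex_derive_hol, h, hz].
generalize (upper_locally z hz). apply filter_imp. intros z' hz'. rewrite wbar_eq; auto; lra.
Qed.

Lemma conformal_inverse (V : C -> Prop) (w : C -> C) : conformal_onto upper V w ->
  exists v : C -> C, (forall y, V y -> upper (v y) /\ w (v y) = y) /\
    (forall z, upper z -> v (w z) = z) /\ (forall y, V y -> continuous v y).
Proof.
intros [hd [inj surj]].
set (v := fun y => match excluded_middle_informative (V y) with
  | left h => proj1_sig (constructive_indefinite_description _ (proj1 (surj y) h))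
  | right _ => y end).
assert (hv : forall y, V y -> upper (v y) /\ w (v y) = y).
{ intros y hy. unfold v. destruct (excluded_middle_informative (V y)) as [h | h]; [|tauto].
  destruct (constructive_indefinite_description _ _) as [z hz]. exact hz. }
assert (hvw : forall z, upper z -> v (w z) = z).
{ intros z hz. assert (hV : V (w z)) by (apply surj; eauto).
  destruct (hv _ hV) as [h1 h2]. apply inj; auto. }
exists v. split; [|split]; auto.
intros y hy. destruct (hv y hy) as [h1 h2].
apply continuous_Cmod_eps. intros e he.
set (z0 := v y) in *.
set (s := Rmin (e / 5) (Im z0 / 2)).
assert (hs : 0 < s /\ s <= e / 5 /\ s <= Im z0 / 2).
{ unfold s. split; [apply Rmin_pos; unfold upper in h1; lra|]. split; [apply Rmin_l | apply Rmin_r]. }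
assert (hu : forall z, in_box (Box (Re z0 - s) (Re z0 + s) (Im z0 - s) (Im z0 + s)) z -> upper z).
{ intros z [_ hz]; cbn in hz. unfold upper in *; lra. }
destruct (open_map w z0 s ltac:(lra)) as [m [hm Hm]].
- intros z hz. apply ex_derive_hol, hd, hu, hz.
- intros z hz E. apply inj; auto.
- exists m. split; auto. intros y' hy'. rewrite <- h2 in hy'.
  destruct (Hm y' hy') as [z [hz <-]].
  rewrite hvw by auto. apply Rlt_le_trans with (2 * (e / 2)); [|lra].
  apply in_box_Cmod with (Box (Re z0 - s) (Re z0 + s) (Im z0 - s) (Im z0 + s)); auto; cbn; try lra.
  split; cbn; lra.

Qed.

(** * Crossing paths in the half plane *)

Definition is_arg (z : C) (t : R) : Prop := z <> 0%C /\ z = (RtoC (Cmod z) * Cexp (0, t))%C.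

Lemma Cexp_imag s : Cexp (0, s) = (cos s, sin s).
Proof. unfold Cexp; cbn. rewrite exp_0. f_equal; ring. Qed.

Lemma is_arg_intro z r t : 0 < r -> z = (RtoC r * Cexp (0, t))%C -> is_arg z t.
Proof.
intros hr E.
assert (Em : Cmod z = r).
{ rewrite E, Cmod_mult, Cmod_R, Cmod_Cexp. cbn. rewrite exp_0, Rabs_right; lra. }
split; [|now rewrite Em]. apply Cmod_gt_0. lra.
Qed.

Lemma is_arg_mult z w s t : is_arg z s -> is_arg w t -> is_arg (z * w) (s + t).
Proof.
intros [z0 Ez] [w0 Ew]. apply is_arg_intro with (Cmod z * Cmod w).
- apply Rmult_lt_0_compat; now apply Cmod_gt_0.
- rewrite Ez at 1. rewrite Ew at 1. rewrite RtoC_mult.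
  replace (0, s + t) with ((0, s) + (0, t))%C by (ceq; ring). rewrite Cexp_plus. ring.
Qed.

Lemma is_arg_unique z s t : is_arg z s -> is_arg z t -> Rabs (s - t) < 2 * PI -> s = t.
Proof.
intros [z0 E1] [_ E2] h.
assert (hm : 0 < Cmod z) by now apply Cmod_gt_0.
assert (E : Cexp (0, s) = Cexp (0, t)).
{ assert (E : (RtoC (Cmod z) * Cexp (0, s))%C = (RtoC (Cmod z) * Cexp (0, t))%C) by congruence.
  rewrite !Cexp_imag in *. injection E as Ea Eb. cbn in Ea, Eb.
  f_equal; nra. }
rewrite !Cexp_imag in E. injection E as Ea Eb.
assert (c1 : cos (s - t) = 1).
{ rewrite cos_minus, Ea, Eb. pose proof (sin2_cos2 t). unfold Rsqr in *; lra. }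
set (x := (s - t) / 2).
assert (sx : sin x = 0).
{ assert (E : cos (2 * x) = 1) by (unfold x; replace (2 * ((s - t) / 2)) with (s - t) by field; auto).
  rewrite cos_2a_sin in E. assert (sin x * sin x = 0) by lra. nra. }
apply Rabs_def2 in h. 
assert (hx : - PI < x < PI) by (unfold x; lra).
destruct (Rtotal_order x 0) as [l | [e | g]].
- assert (0 < sin (- x)) by (apply sin_gt_0; lra). rewrite sin_neg in H. lra.
- unfold x in e; lra.
- assert (0 < sin x) by (apply sin_gt_0; lra). lra.
Qed.

Definition ang (z : C) : R := atan (Im z / Re z).
Definition arg_up (z : C) : R := acos (Re z / Cmod z).

Lemma is_arg_ang z : 0 < Re z -> is_arg z (ang z) /\ - (PI / 2) < ang z < PI / 2.
Proof.
intros h. split; [|unfold ang; pose proof (atan_bound (Im z / Re z)); lra].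
set (u := Im z / Re z).
assert (hs : 0 < sqrt (1 + u²)) by (apply sqrt_lt_R0; pose proof (Rle_0_sqr u); lra).
apply is_arg_intro with (Re z * sqrt (1 + u²)); [now apply Rmult_lt_0_compat|].
rewrite Cexp_imag. unfold ang. fold u. rewrite cos_atan, sin_atan.
set (q := sqrt (1 + u²)) in *. clearbody q.
assert (hu : Im z = u * Re z) by (unfold u; field; lra). clearbody u.
destruct z as [x y]. ceq; [|subst y]; field; lra.
Qed.

Lemma is_arg_up (z : C) : z <> 0%C -> 0 <= Im z -> is_arg z (arg_up z) /\ 0 <= arg_up z <= PI.
Proof.
intros h0 h. split; [|apply acos_bound].
assert (hm : 0 < Cmod z) by exact (proj1 (Cmod_gt_0 z) h0).
assert (hb : -1 <= Re z / Cmod z <= 1).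
{ pose proof (re_le_Cmod z) as k. apply Rabs_le_between in k.
  split; apply Rmult_le_reg_r with (Cmod z); auto; unfold Rdiv;
  rewrite Rmult_assoc, Rinv_l; lra. }
apply is_arg_intro with (Cmod z); auto.
rewrite Cexp_imag. unfold arg_up. rewrite cos_acos, sin_acos by auto.
replace (1 - (Re z / Cmod z)²) with ((Im z / Cmod z)²).
- rewrite sqrt_Rsqr.
  + ceq; field; lra.
  + apply Rmult_le_pos; auto. left; now apply Rinv_0_lt_compat.
- pose proof (Cmod2_alt z) as E. unfold Rsqr.
  apply Rmult_eq_reg_r with (Cmod z ^ 2); [|apply pow_nonzero; lra].
  rewrite E at 2. rewrite Rmult_minus_distr_r, Rmult_1_l, E at 1.
  transitivity (Im z ^ 2).
  + rewrite <- E. field. lra.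
  + replace (Re z / Cmod z * (Re z / Cmod z) * (Re z ^ 2 + Im z ^ 2)) with (Re z ^ 2); [ring|].
    rewrite <- E. field. lra.
Qed.

Definition arg_low (z : C) : R := - arg_up (Cconj z).

Lemma is_arg_low (z : C) : z <> 0%C -> Im z <= 0 -> is_arg z (arg_low z) /\ - PI <= arg_low z <= 0.
Proof.
intros h0 h. destruct (is_arg_up (Cconj z)) as [[h1 E] h2].
- intros E. apply h0. rewrite <- (Cconj_conj z), E. ceq; ring.
- rewrite im_conj. lra.
- unfold arg_low. split; [|lra]. split; auto.
  rewrite <- (Cconj_conj z) at 1. rewrite E at 1. rewrite Cmod_conj, Cmult_conj, !Cexp_imag.
  rewrite cos_neg, sin_neg. ceq; ring.
Qed.

Lemma arg_up_pos x : 0 < x -> arg_up (RtoC x) = 0.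
Proof.
intros h. unfold arg_up. rewrite Cmod_R, Rabs_right by lra. cbn.
replace (x / x) with 1 by (field; lra). apply acos_1.
Qed.

Lemma arg_up_neg x : x < 0 -> arg_up (RtoC x) = PI.
Proof.
intros h. unfold arg_up. rewrite Cmod_R, Rabs_left by lra. cbn.
replace (x / - x) with (- (1)) by (field; lra). rewrite acos_opp, acos_1. ring.
Qed.

(** A step shorter than the distance to a changes the ratio by less than 1, so the ratio stays in
    the right half plane, where [ang] is the argument. *)
Lemma Re_ratio (a p q : C) (d : R) : d <= Cmod (p - a) -> Cmod (q - p) < d ->
  0 < Re ((q - a) / (p - a)) /\ (q - a)%C = ((q - a) / (p - a) * (p - a))%C.
Proof.
intros h1 h2. pose proof (Cmod_ge_0 (q - p)).
assert (hn : (p - a)%C <> 0%C) by (apply Cmod_gt_0; lra).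
split; [|now field].
replace ((q - a) / (p - a))%C with (1 + (q - p) / (p - a))%C by (now field).
assert (k : Cmod ((q - p) / (p - a)) < 1).
{ rewrite Cmod_div by auto. apply Rmult_lt_reg_r with (Cmod (p - a)); [lra|].
  unfold Rdiv. rewrite Rmult_assoc, Rinv_l by lra. lra. }
pose proof (Rle_lt_trans _ _ _ (re_le_Cmod _) k) as k'. apply Rabs_def2 in k'.
rewrite re_plus. rewrite re_RtoC. lra.
Qed.

(** The total change of the argument around a along a chain of points. It plays the part of the
    winding angle of a path, without any lifting. *)
Fixpoint turn (a p : C) (l : list C) : R :=
  match l with
  | nil => 0
  | cons q l => ang ((q - a) / (p - a)) + turn a q l
  end.

Fixpoint steps (K : C -> Prop) (d : R) (p : C) (l : list C) : Prop :=
  K p /\ match l with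
  | nil => True
  | cons q l => Cmod (q - p) < d /\ steps K d q l
  end.

Fixpoint final (p : C) (l : list C) : C :=
  match l with nil => p | cons q l => final q l end.

Lemma steps_head K d p l : steps K d p l -> K p.
Proof. destruct l; cbn; tauto. Qed.
Lemma steps_final K d p l : steps K d p l -> K (final p l).
Proof. revert p; induction l as [|q l IH]; cbn; [tauto|]. intros p [_ [_ h]]. auto. Qed.

(* The change of the winding angle when the centre moves telescopes along the chain. *)
Lemma turn_move K d a a' p l : (forall z, K z -> d <= Cmod (z - a) /\ d <= Cmod (z - a')) ->
  Cmod (a' - a) < d -> steps K d p l ->
  turn a' p l + ang ((p - a') / (p - a)) =
  turn a p l + ang ((final p l - a') / (final p l - a)).
Proof.
intros hK ha.
assert (mv : forall p, K p -> 0 < Re ((p - a') / (p - a)) /\ (p - a')%C = ((p - a') / (p - a) * (p - a))%C).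
{ intros z hz. destruct (hK z hz) as [h1 h2].
  assert (T := Re_ratio (- z)%C (- a)%C (- a')%C d).
  assert (e1 : (- a - - z)%C = (z - a)%C) by ring. assert (e2 : (- a' - - z)%C = (z - a')%C) by ring.
  assert (e3 : (- a' - - a)%C = (- (a' - a))%C) by ring.
  rewrite e1, e2, e3, Cmod_opp in T. auto. }
revert p; induction l as [|q l IH]; intros p; cbn; [intros _; ring|].
intros [hp [hq hl]]. specialize (IH q hl). pose proof (steps_head _ _ _ _ hl) as hKq.
enough (E : ang ((q - a') / (p - a')) + ang ((p - a') / (p - a)) =
  ang ((q - a) / (p - a)) + ang ((q - a') / (q - a))) by lra.
destruct (hK p hp) as [p1 p2].
destruct (Re_ratio a p q d p1 hq) as [r1 e1]. destruct (Re_ratio a' p q d p2 hq) as [r2 e2].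
destruct (mv p hp) as [r3 e3]. destruct (mv q hKq) as [r4 e4].
destruct (is_arg_ang _ r1) as [g1 b1]. destruct (is_arg_ang _ r2) as [g2 b2].
destruct (is_arg_ang _ r3) as [g3 b3]. destruct (is_arg_ang _ r4) as [g4 b4].
pose proof (is_arg_mult _ _ _ _ g2 g3) as m1. pose proof (is_arg_mult _ _ _ _ g1 g4) as m2.
replace ((q - a) / (p - a) * ((q - a') / (q - a)))%C with ((q - a') / (p - a') * ((p - a') / (p - a)))%C in m2.
- apply (is_arg_unique _ _ _ m1 m2). apply Rabs_def1; lra.
- destruct (hK q hKq) as [k1 k2]. pose proof (Cmod_ge_0 (q - p)).
  assert ((p - a)%C <> 0%C) by (apply Cmod_gt_0; lra).
  assert ((p - a')%C <> 0%C) by (apply Cmod_gt_0; lra).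
  assert ((q - a)%C <> 0%C) by (apply Cmod_gt_0; lra).
  field; auto.
Qed.

(** On a set where one branch A of the argument around a varies by at most PI, for instance in a
    half plane with a on its edge, the steps telescope. *)
Lemma turn_half K d a p l (A : C -> R) :
  (forall z, K z -> d <= Cmod (z - a)) ->
  (forall z, K z -> is_arg (z - a) (A (z - a)%C)) ->
  (forall z z', K z -> K z' -> Rabs (A (z - a)%C - A (z' - a)%C) <= PI) ->
  steps K d p l -> turn a p l = A (final p l - a)%C - A (p - a)%C.
Proof.
intros hK hA hB. revert p; induction l as [|q l IH]; intros p; cbn; [intros _; ring|].
intros [hp [hq hl]]. rewrite (IH q hl). pose proof (steps_head _ _ _ _ hl) as hKq.
enough (E : ang ((q - a) / (p - a)) + A (p - a)%C = A (q - a)%C) by lra.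
destruct (Re_ratio a p q d (hK p hp) hq) as [r1 e1].
destruct (is_arg_ang _ r1) as [g1 b1].
pose proof (is_arg_mult _ _ _ _ g1 (hA p hp)) as m. rewrite <- e1 in m.
apply (is_arg_unique _ _ _ m (hA q hKq)).
pose proof (hB p q hp hKq) as k. apply Rabs_le_between in k. apply Rabs_def1; lra.
Qed.

(** Connection by chains of arbitrarily small steps. Only finitely many points occur at a time,
    which is what [turn] can handle, and concatenation is immediate. *)
Definition conn (K : C -> Prop) (p q : C) : Prop :=
  forall d, 0 < d -> exists l, steps K d p l /\ final p l = q.

Lemma conn_trans K p q r : conn K p q -> conn K q r -> conn K p r.
Proof.
intros h1 h2 d hd. destruct (h1 d hd) as [l [hl e]], (h2 d hd) as [m [hm e']].
exists (l ++ m)%list. subst q. clear h1 h2. revert p hl hm e'.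
induction l as [|q l IH]; cbn; auto.
intros p [hp [hq hl]] hm e'. destruct (IH q hl hm e') as [k1 k2]. auto.
Qed.

Lemma conn_path (K : C -> Prop) (g : R -> C) :
  (forall t, 0 <= t <= 1 -> continuous g t /\ K (g t)) -> conn K (g 0) (g 1).
Proof.
intros hg d hd.
apply (box_ind (fun r => exists l, steps K d (g (bl r)) l /\ final (g (bl r)) l = g (br r)) (Box 0 1 0 0)).
- split; cbn; lra.
- intros r hr h. destruct (h true true) as [l [hl e]], (h false true) as [m [hm e']].
  cbn in hl, e, hm, e'. set (x := (bl r + br r) / 2) in *.
  exists (l ++ m)%list. generalize (g (br r)) e'. intros q e''. clear e' h.
  remember (g x) as gx. clear Heqgx. subst gx. revert hl hm e''. generalize (g (bl r)).
  induction l as [|q' l IH]; cbn; auto.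
  intros p [hp [hq hl]] hm e'. destruct (IH q' hl hm e') as [k1 k2]. auto.
- intros [x y] hz. cbn in hz. unfold in_box in hz; cbn in hz. destruct (hg x) as [c1 k1]; [lra|].
  assert (L : locally (g x) (fun y => Cmod (y - g x) < d / 2)) by (apply locally_Cmod; exists (d / 2); split; [lra | auto]).
  specialize (c1 _ L). destruct c1 as [e He].
  exists e. split; [apply cond_pos|]. intros r k hr hin _ _ _ w1 w2.
  destruct hr as [? [? [? [? [? ?]]]]]. cbn in *. destruct hin as [hi _]; cbn in hi.
  assert (E : forall s, bl r <= s <= br r -> Cmod (g s - g x) < d / 2).
  { intros s hs. apply He. unfold ball; cbn. unfold AbsRing_ball, abs, minus, plus, opp; cbn.
    apply Rabs_def1; lra. }
  exists (cons (g (br r)) nil). cbn. split; auto. repeat split; try (apply hg; lra).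
  apply Rle_lt_trans with (1 := Cmod_triangle_minus _ (g x) _).
  rewrite (Cmod_minus_sym (g x)). pose proof (E (br r) ltac:(lra)). pose proof (E (bl r) ltac:(lra)). lra.
Qed.

(** The winding angle of the chain in K2, closed up through the lower half plane, cannot change
    while the centre moves along K1 in steps shorter than the distance of the two sets. Yet it is 0
    around [top], below which the chain stays, and [- (2 * PI)] around [be], which the chain passes
    above. *)
Lemma crossing (K1 K2 : C -> Prop) (d al be ga : R) (top : C) : 0 < d ->
  (forall z z', K1 z -> K2 z' -> d <= Cmod (z' - z)) ->
  (forall z, K1 z -> 0 <= Im z) -> (forall z, K2 z -> 0 <= Im z <= Im top) ->
  al < be < ga ->
  conn K2 (RtoC al) (RtoC ga) -> conn K1 (RtoC be) top -> False.
Proof.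
intros hd hK h1 h2 hab c2 c1.
destruct (c2 d hd) as [l [hl el]]. destruct (c1 d hd) as [m [hm em]].
pose proof PI_RGT_0 as hpi.
(* The two [arg_low] terms are the angle of the return from [ga] to [al] below the centre. *)
set (n := fun a => turn a (RtoC al) l - arg_low (RtoC ga - a) + arg_low (RtoC al - a)).
assert (Kal : K2 (RtoC al)) by now apply steps_head in hl.
assert (Kga : K2 (RtoC ga)) by (rewrite <- el; now apply steps_final in hl).
assert (nz : forall z z', K1 z -> K2 z' -> (z' - z)%C <> 0%C).
{ intros z z' hz hz'. apply Cmod_gt_0. specialize (hK z z' hz hz'). lra. }
assert (low : forall a x, K1 a -> K2 (RtoC x) -> is_arg (RtoC x - a) (arg_low (RtoC x - a)) /\
   - PI <= arg_low (RtoC x - a) <= 0).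
{ intros a x ha hx. apply is_arg_low; auto. specialize (h1 a ha). creal. unfold Im in h1. lra. }
assert (mvn : forall a a', K1 a -> K1 a' -> Cmod (a' - a) < d -> n a' = n a).
{ intros a a' ha ha' hs.
  assert (B : forall x, K2 (RtoC x) -> ang ((RtoC x - a') / (RtoC x - a)) = arg_low (RtoC x - a') - arg_low (RtoC x - a)).
  { intros x hx. destruct (low a x ha hx) as [g1 b1]. destruct (low a' x ha' hx) as [g2 b2].
    assert (T := Re_ratio (- RtoC x)%C (- a)%C (- a')%C d).
    replace (- a - - RtoC x)%C with (RtoC x - a)%C in T by ring.
    replace (- a' - - RtoC x)%C with (RtoC x - a')%C in T by ring.
    replace (- a' - - a)%C with (- (a' - a))%C in T by ring. rewrite Cmod_opp in T.
    destruct (T (hK _ _ ha hx) hs) as [r e]. destruct (is_arg_ang _ r) as [g3 b3].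
    pose proof (is_arg_mult _ _ _ _ g3 g1) as g. rewrite <- e in g.
    pose proof (is_arg_unique _ _ _ g g2 ltac:(apply Rabs_def1; lra)). lra. }
  assert (T := turn_move K2 d a a' (RtoC al) l (fun z hz => conj (hK _ _ ha hz) (hK _ _ ha' hz)) hs hl).
  rewrite el in T. rewrite !B in T by auto. unfold n. lra. }
assert (nconst : forall p m, steps K1 d p m -> n (final p m) = n p).
{ intros p k; revert p. induction k as [|q k IH]; cbn; auto.
  intros p [hp [hq hk]]. rewrite (IH q hk). apply mvn; auto. now apply steps_head in hk. }
pose proof (nconst _ _ hm) as E. rewrite em in E.
assert (Kbe : K1 (RtoC be)) by now apply steps_head in hm.
assert (Ktop : K1 top) by (rewrite <- em; now apply steps_final in hm).
assert (E0 : n top = 0).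
{ unfold n. rewrite (turn_half K2 d top _ l arg_low); auto; [rewrite el; ring| |].
  - intros z hz. apply is_arg_low; auto. specialize (h2 z hz). creal. unfold Im in h2. lra.
  - intros z z' hz hz'.
    destruct (is_arg_low (z - top)) as [_ b1]; auto. { specialize (h2 z hz). creal. unfold Im in h2. lra. }
    destruct (is_arg_low (z' - top)) as [_ b2]; auto. { specialize (h2 z' hz'). creal. unfold Im in h2. lra. }
    apply Rabs_le. lra. }
assert (E1 : n (RtoC be) = - (2 * PI)).
{ unfold n. rewrite (turn_half K2 d (RtoC be) _ l arg_up); auto.
  - rewrite el. unfold arg_low. rewrite <- !RtoC_minus.
    replace (Cconj (RtoC (ga - be))) with (RtoC (ga - be)) by (ceq; ring).
    replace (Cconj (RtoC (al - be))) with (RtoC (al - be)) by (ceq; ring).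
    rewrite arg_up_pos, arg_up_neg by lra. lra.
  - intros z hz. apply is_arg_up; auto. specialize (h2 z hz). creal. unfold Im in h2. lra.
  - intros z z' hz hz'.
    destruct (is_arg_up (z - RtoC be)) as [_ b1]; auto. { specialize (h2 z hz). creal. unfold Im in h2. lra. }
    destruct (is_arg_up (z' - RtoC be)) as [_ b2]; auto. { specialize (h2 z' hz'). creal. unfold Im in h2. lra. }
    apply Rabs_le. lra. }
lra.
Qed.

(** * Boundary correspondence *)

Definition convex (V : C -> Prop) : Prop :=
  forall y y' t, V y -> V y' -> 0 <= t <= 1 -> V (y + RtoC t * (y' - y))%C.

Lemma path_bounded (g : R -> C) : (forall t, 0 <= t <= 1 -> continuous g t) ->
  exists M, forall t, 0 <= t <= 1 -> Cmod (g t) <= M.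
Proof.
intros hg.
destruct (box_max (Box 0 1 0 0) (fun z => Cmod (g (Re z)))) as [p [_ Hp]].
- split; cbn; lra.
- intros [x y] [hx _]; cbn in hx. apply (continuous_Cmod (fun z => g (Re z))).
  apply (continuous_comp (fun z : C => Re z) g); [|apply hg; cbn; lra].
  apply (continuous_Re (fun z : C => z)), continuous_id.
- exists (Cmod (g (Re p))). intros t ht. apply (Hp (t, 0)). split; cbn; lra.
Qed.

Lemma continuous_R_eps (h : C -> R) (z : C) : continuous h z ->
  forall e, 0 < e -> exists d, 0 < d /\ forall z', Cmod (z' - z) < d -> Rabs (h z' - h z) < e.
Proof.
intros hc e he. apply (proj1 (locally_Cmod z (fun z' => Rabs (h z' - h z) < e))).
apply (hc (fun y => Rabs (y - h z) < e)). exists (mkposreal _ he). intros y hy. exact hy.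
Qed.

Lemma continuous_near_vert (h : C -> R) (x e : R) : continuous h (RtoC x) -> 0 < e ->
  exists d, 0 < d /\ forall t, 0 <= t <= d -> Rabs (h (x, t) - h (RtoC x)) < e.
Proof.
intros hc he. destruct (continuous_R_eps h _ hc e he) as [d [hd Hd]].
exists (d / 2). split; [lra|]. intros t ht. apply Hd.
replace ((x, t) - RtoC x)%C with (RtoC t * Ci)%C by (ceq; ring).
rewrite Cmod_mult, Cmod_Ci, Cmod_R, Rabs_right; lra.
Qed.

Lemma conn_mono (K K' : C -> Prop) p q : (forall z, K z -> K' z) -> conn K p q -> conn K' p q.
Proof.
intros h c d hd. destruct (c d hd) as [l [hl e]]. exists l. split; auto.
clear e c. revert p hl. induction l as [|a l IH]; cbn; intros p; [intros [h1 _]; auto|].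
intros [h1 [h2 h3]]. auto.
Qed.

Lemma continuous_line (p q : C) t : continuous (fun t : R => (p + RtoC t * (q - p))%C) t.
Proof.
apply continuous_Cplus; [apply continuous_const|].
apply continuous_Cmult; [|apply continuous_const].
apply continuous_Cpair; [apply continuous_id | apply continuous_const].
Qed.

Lemma conn_segment (K : C -> Prop) (p q : C) :
  (forall t, 0 <= t <= 1 -> K (p + RtoC t * (q - p))%C) -> conn K p q.
Proof.
intros hK.
assert (T := conn_path K (fun t => (p + RtoC t * (q - p))%C)). cbn beta in T.
replace (p + RtoC 0 * (q - p))%C with p in T by ring.
replace (p + RtoC 1 * (q - p))%C with q in T by ring.
apply T. intros t ht. split; [apply continuous_line | auto].
Qed.

Section Interlace.
Variables (V : C -> Prop) (w : C -> C) (A B c0 : R).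
Hypothesis hw : conformal_onto upper V w.
Hypothesis cw : forall z, continuous (wbar w) z.
Hypothesis cV : convex V.

Definition ell (z : C) : R := A * Re z + B * Im z + c0.
Let h (z : C) : R := ell (wbar w z).

Lemma ell_continuous (F : C -> C) z : continuous F z -> continuous (fun z => ell (F z)) z.
Proof.
intros hF. apply continuous_Rplus; [|apply continuous_const].
apply continuous_Rplus; (apply continuous_Rmult; [apply continuous_const|]);
[now apply continuous_Re | now apply continuous_Im].
Qed.

(** The segment between the images stays in the convex set V and is pulled back by the inverse map.
    [ell] is affine along it, so any convex condition on [ell] that holds at both ends persists. The
    bound M keeps the chain in a compact region. *)
Lemma conn_inner (p q : C) (P : R -> Prop) : upper p -> upper q ->
  (forall x y t, P x -> P y -> 0 <= t <= 1 -> P (x + t * (y - x))) -> P (h p) -> P (h q) ->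
  exists M, conn (fun z => Cmod z <= M /\ 0 <= Im z /\ P (h z)) p q.
Proof.
intros hp hq cP Pp Pq.
destruct (conformal_inverse V w hw) as [v [v1 [v2 v3]]].
set (y := fun t : R => (w p + RtoC t * (w q - w p))%C).
destruct hw as [_ [_ surj]].
assert (Vy : forall t, 0 <= t <= 1 -> V (y t)).
{ intros t ht. apply cV; auto; apply surj; eauto. }
assert (cg : forall t, 0 <= t <= 1 -> continuous (fun t => v (y t)) t).
{ intros t ht. apply (continuous_comp y v); [apply continuous_line | apply v3, Vy, ht]. }
destruct (path_bounded _ cg) as [M HM].
exists M.
assert (E0 : v (y 0) = p).
{ rewrite <- (v2 p hp). f_equal. unfold y. ring. }
assert (E1 : v (y 1) = q).
{ rewrite <- (v2 q hq). f_equal. unfold y. ring. }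
assert (K : conn (fun z => Cmod z <= M /\ 0 <= Im z /\ P (h z)) (v (y 0)) (v (y 1))).
{ apply (conn_path _ (fun t => v (y t))). intros t ht. split; [auto|].
  destruct (v1 _ (Vy t ht)) as [k1 k2]. unfold upper in *. repeat split; auto; [lra|].
  unfold h in *. rewrite wbar_eq in Pp, Pq |- * by lra. rewrite k2.
  replace (ell (y t)) with (ell (w p) + t * (ell (w q) - ell (w p))); auto.
  unfold ell, y. creal. ring. }
now rewrite E0, E1 in K.
Qed.

(** The boundary points are joined to the open half plane by short vertical segments, because the
    inverse map is only available inside. The point [top] is taken high enough to lie above the
    other chain and to satisfy [h < c1]. *)
Lemma no_interlace (c1 c2 al be ga N0 : R) : c1 < c2 -> al < be < ga ->
  c2 < h (RtoC al) -> c2 < h (RtoC ga) -> h (RtoC be) < c1 ->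
  (forall y, N0 <= y -> h (0, y) < c1) -> False.
Proof.
intros hc hab h1 h2 h3 hN.
assert (ch : forall z, continuous h z) by (intros z; now apply ell_continuous).
destruct (continuous_near_vert h al (h (RtoC al) - c2) (ch _) ltac:(lra)) as [d1 [p1 q1]].
destruct (continuous_near_vert h ga (h (RtoC ga) - c2) (ch _) ltac:(lra)) as [d2 [p2 q2]].
destruct (continuous_near_vert h be (c1 - h (RtoC be)) (ch _) ltac:(lra)) as [d3 [p3 q3]].
set (s := Rmin d1 (Rmin d2 d3)).
assert (hs : 0 < s /\ s <= d1 /\ s <= d2 /\ s <= d3) by (unfold s; minmax).
assert (r1 : forall t, 0 <= t <= s -> c2 <= h (al, t)).
{ intros t ht. specialize (q1 t ltac:(lra)). apply Rabs_def2 in q1. lra. }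
assert (r2 : forall t, 0 <= t <= s -> c2 <= h (ga, t)).
{ intros t ht. specialize (q2 t ltac:(lra)). apply Rabs_def2 in q2. lra. }
assert (r3 : forall t, 0 <= t <= s -> h (be, t) <= c1).
{ intros t ht. specialize (q3 t ltac:(lra)). apply Rabs_def2 in q3. lra. }
destruct (conn_inner (al, s) (ga, s) (fun x => c2 <= x)) as [M hM]; unfold upper; cbn; try lra.
{ intros x y t hx hy ht. nra. }
{ apply r1; lra. }
{ apply r2; lra. }
set (L := Rmax M (Rmax (Rabs al + s) (Rabs ga + s))).
assert (hL : M <= L /\ Rabs al + s <= L /\ Rabs ga + s <= L) by (unfold L; minmax).
pose proof (Rabs_pos al) as hal.
set (K2 := fun z => Cmod z <= L /\ 0 <= Im z /\ c2 <= h z).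
set (top := (0, Rmax N0 L) : C).
assert (htop : N0 <= Rmax N0 L /\ L <= Rmax N0 L) by (split; [apply Rmax_l | apply Rmax_r]).
destruct (conn_inner (be, s) top (fun x => x <= c1)) as [M' hM']; unfold upper; cbn; try lra.
{ intros x y t hx hy ht. nra. }
{ apply r3; lra. }
{ left. apply hN. lra. }
set (K1 := fun z => 0 <= Im z /\ h z <= c1).
(* Uniform continuity of h near K2 turns the gap between c1 and c2 into a positive distance between
   the two sets, as [crossing] requires. *)
destruct (box_local_global (Box (- L) L 0 L) (fun z e => forall z', Cmod (z' - z) < e -> Rabs (h z' - h z) < c2 - c1))
  as [e [he He]].
{ split; cbn; lra. }
{ intros z u t hut H z' hz'. apply H. lra. }
{ intros z _. destruct (continuous_R_eps h z (ch z) ((c2 - c1) / 2) ltac:(lra)) as [d [hd Hd]].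
  exists (d / 2), (d / 2). repeat split; try lra. intros z' _ hz' z'' hz''.
  assert (k1 : Cmod (z' - z) < d) by lra.
  assert (k2 : Cmod (z'' - z) < d) by (apply Rle_lt_trans with (1 := Cmod_triangle_minus _ z' _); lra).
  pose proof (Hd _ k1) as k3. pose proof (Hd _ k2) as k4. apply Rabs_def2 in k3, k4. apply Rabs_def1; lra. }
assert (vert : forall x, Rabs x + s <= L -> (forall t, 0 <= t <= s -> c2 <= h (x, t)) ->
   forall t, 0 <= t <= s -> K2 (x, t)).
{ intros x hx H t ht. repeat split; cbn; try lra; auto.
  apply Rle_trans with (1 := Cmod_le_abs _). cbn. rewrite (Rabs_right t); lra. }
apply (crossing K1 K2 e al be ga top he); auto.
- intros z z' [k1 k2] [k3 [k4 k5]]. apply Rnot_lt_le. intros k6.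
  rewrite Cmod_minus_sym in k6.
  assert (hb : in_box (Box (- L) L 0 L) z').
  { pose proof (Rle_trans _ _ _ (re_le_Cmod z') k3) as u1. pose proof (Rle_trans _ _ _ (Im_le_Cmod z') k3) as u2.
    apply Rabs_le_between in u1, u2. split; cbn; lra. }
  specialize (He z' hb z k6). apply Rabs_def2 in He. lra.
- intros z [k _]; auto.
- intros z [k1 [k2 _]]. split; auto. pose proof (Rle_trans _ _ _ (Im_le_Cmod z) k1) as u2.
  apply Rabs_le_between in u2. cbn. lra.
- apply conn_trans with (al, s); [|apply conn_trans with (ga, s)].
  + apply conn_segment. intros t ht.
    replace (RtoC al + RtoC t * ((al, s) - RtoC al))%C with (al, t * s) by (ceq; ring).
    apply vert; auto; [lra|nra].
  + apply conn_mono with (2 := hM). intros z [k1 [k2 k3]]. repeat split; auto; lra.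
  + apply conn_segment. intros t ht.
    replace ((ga, s) + RtoC t * (RtoC ga - (ga, s)))%C with (ga, (1 - t) * s) by (ceq; ring).
    apply vert; auto; [lra|nra].
- apply conn_trans with (be, s).
  + apply conn_segment. intros t ht.
    replace (RtoC be + RtoC t * ((be, s) - RtoC be))%C with (be, t * s) by (ceq; ring).
    split; cbn; [nra|]. apply r3. nra.
  + apply conn_mono with (2 := hM'). intros z [k1 [k2 k3]]. split; auto.
Qed.
End Interlace.

(** * The quadrilateral and its Riemann map *)

Definition prev (i : idx) : idx :=
  match i with i1 => i4 | i2 => i1 | i3 => i2 | i4 => i3 end.

Definition lin (a b : idx -> R) (eps : R) (j : idx) (z : C) : R :=
  Im z - eps * (a j * Re z + b j).

(* The boundary arc of the half plane that is mapped into the line L_j. *)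
Definition arc (z4 : R) (j : idx) (t : R) : Prop :=
  match j with i1 => z4 < t < 1 | i2 => 1 < t | i3 => t < 0 | i4 => 0 < t < z4 end.

Definition abs_sum (q : idx -> R) : R := Rabs (q i1) + Rabs (q i2) + Rabs (q i3) + Rabs (q i4).

(** The interface between the Riemann map and the estimates. [disc_Im] is the source of all
    smallness; [disc_arc] and [disc_range] place every boundary arc on its edge. *)
Record disc (a b p : idx -> R) (eps : R) (W : C -> C) (z4 : R) : Prop := {
  disc_cont : forall z, continuous W z;
  disc_hol : forall z, 0 < Im z -> hol W z;
  disc_v1 : W (RtoC 1) = (p i1, eps * (a i1 * p i1 + b i1));
  disc_v3 : W (RtoC 0) = (p i3, eps * (a i3 * p i3 + b i3));
  disc_v4 : W (RtoC z4) = (p i4, eps * (a i4 * p i4 + b i4));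
  disc_v2 : forall e, 0 < e -> exists M, forall z, 0 <= Im z -> M < Cmod z ->
    Cmod (W z - (p i2, eps * (a i2 * p i2 + b i2))%R) < e;
  disc_z4 : 0 < z4 < 1;
  disc_Re : forall z, Rabs (Re (W z)) <= abs_sum p;
  disc_Im : forall z, Rabs (Im (W z)) <= eps * abs_sum (fun i => a i * p i + b i);
  disc_arc : forall j t, arc z4 j t -> lin a b eps j (W (RtoC t)) = 0;
  disc_range : forall j t, arc z4 j t ->
    0 <= (p j - p (prev j)) * (Re (W (RtoC t)) - p (prev j)) /\
    0 <= (p j - p (prev j)) * (p j - Re (W (RtoC t)))
}.

Arguments disc_cont {a b p eps W z4} _.
Arguments disc_hol {a b p eps W z4} _.
Arguments disc_v1 {a b p eps W z4} _.
Arguments disc_v3 {a b p eps W z4} _.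
Arguments disc_v4 {a b p eps W z4} _.
Arguments disc_v2 {a b p eps W z4} _.
Arguments disc_z4 {a b p eps W z4} _.
Arguments disc_Re {a b p eps W z4} _.
Arguments disc_Im {a b p eps W z4} _.
Arguments disc_arc {a b p eps W z4} _.
Arguments disc_range {a b p eps W z4} _.

Lemma hull_convex x : convex (hull x).
Proof.
intros y y' t [u [u0 [u1 uE]]] [v [v0 [v1 vE]]] ht.
exists (fun i => (1 - t) * u i + t * v i). split; [|split].
- intros i. specialize (u0 i). specialize (v0 i). nra.
- transitivity ((1 - t) * (u i1 + u i2 + u i3 + u i4) + t * (v i1 + v i2 + v i3 + v i4)); [ring|].
  rewrite u1, v1. ring.
- rewrite uE, vE, !RtoC_plus, !RtoC_mult, RtoC_minus. ring.
Qed.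

Lemma quad_interior_convex x : convex (quad_interior x).
Proof.
intros y y' t hy hy' ht. unfold quad_interior in *.
apply locally_Cmod in hy, hy'. apply locally_Cmod.
destruct hy as [d [hd Hd]], hy' as [d' [hd' Hd']].
exists (Rmin d d'). split; [now apply Rmin_pos|]. intros z hz.
set (u := (z - (y + RtoC t * (y' - y)))%C) in *.
replace z with ((y + u) + RtoC t * ((y' + u) - (y + u)))%C by (unfold u; ring).
apply hull_convex; auto.
- apply Hd. replace (y + u - y)%C with u by ring. pose proof (Rmin_l d d'). lra.
- apply Hd'. replace (y' + u - y')%C with u by ring. pose proof (Rmin_r d d'). lra.
Qed.

Lemma quad_interior_hull x z : quad_interior x z -> hull x z.
Proof. apply locally_singleton. Qed.

Lemma closure_ge_0 (h : C -> R) : (forall z, continuous h z) -> (forall z, 0 < Im z -> 0 <= h z) ->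
  forall z, 0 <= Im z -> 0 <= h z.
Proof.
intros ch hp z hz. apply Rnot_lt_le. intros N.
destruct (continuous_R_eps h z (ch z) (- h z) ltac:(lra)) as [d [hd Hd]].
assert (k : Cmod (z + RtoC (d / 2) * Ci - z) < d).
{ replace (z + RtoC (d / 2) * Ci - z)%C with (RtoC (d / 2) * Ci)%C by ring.
  rewrite Cmod_mult, Cmod_Ci, Cmod_R, Rabs_right; lra. }
specialize (Hd _ k). apply Rabs_def2 in Hd.
assert (0 <= h (z + RtoC (d / 2) * Ci)%C); [|lra].
apply hp. creal. unfold Im in hz. lra.
Qed.

Section Quad.
Variables (a b p : idx -> R) (eps : R) (w : C -> C) (z4 : R).
Let y i := a i * p i + b i.
Let x (i : idx) : C := (p i, eps * y i).
Hypothesis eps0 : 0 < eps.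
Hypothesis meet : forall i, a i * p i + b i = a (next i) * p i + b (next i).
(** The strict left turn at the vertex [x i], divided by eps; see [orient_vertices]. *)
Hypothesis cvx : forall i, 0 < (p (next i) - p i) * (p i - p (prev i)) * (a (next i) - a i).
Hypothesis hsc : is_schwarz_christoffel x w z4.
Let W := wbar w.
Let e j := p j - p (prev j).

(** The product [e j * lin a b eps j z] equals [orient (x (prev j)) (x j) z], so the factor [e j]
    makes the inner side positive whichever way the edge runs. *)
Lemma lin_hull_vertex j i : 0 <= e j * lin a b eps j (x i).
Proof.
pose proof (cvx i1) as c1. pose proof (cvx i2) as c2. pose proof (cvx i3) as c3. pose proof (cvx i4) as c4.
pose proof (meet i1) as m1. pose proof (meet i2) as m2. pose proof (meet i3) as m3. pose proof (meet i4) as m4.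
unfold e, lin, x, y. destruct j, i; cbn [next prev Re Im fst snd] in *; 
match goal with |- 0 <= ?u * (eps * ?v - eps * ?w) =>
  replace (u * (eps * v - eps * w)) with (eps * (u * (v - w))) by ring end;
apply Rmult_le_pos; try lra; nra.
Qed.

Lemma hull_facts z : hull x z -> (forall j, 0 <= e j * lin a b eps j z) /\
  Rabs (Re z) <= abs_sum p /\ Rabs (Im z) <= eps * abs_sum y.
Proof.
intros [t [t0 [t1 ->]]].
assert (t2 : forall i, 0 <= t i <= 1).
{ intros i. pose proof (t0 i1). pose proof (t0 i2). pose proof (t0 i3). pose proof (t0 i4).
  destruct i; lra. }
assert (bd : forall i u, Rabs (t i * u) <= Rabs u).
{ intros i u. rewrite Rabs_mult, (Rabs_right (t i)) by (apply Rle_ge, t2).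
  pose proof (Rabs_pos u). pose proof (t2 i). nra. }
split; [|split].
- intros j.
  replace (e j * lin a b eps j _) with (t i1 * (e j * lin a b eps j (x i1)) + t i2 * (e j * lin a b eps j (x i2)) +
    t i3 * (e j * lin a b eps j (x i3)) + t i4 * (e j * lin a b eps j (x i4))).
  + repeat apply Rplus_le_le_0_compat; apply Rmult_le_pos; auto; apply lin_hull_vertex.
  + unfold lin. rewrite !re_plus, !im_plus, !re_scal_l, !im_scal_l.
    transitivity (e j * (t i1 * Im (x i1) + t i2 * Im (x i2) + t i3 * Im (x i3) + t i4 * Im (x i4) -
      eps * (a j * (t i1 * Re (x i1) + t i2 * Re (x i2) + t i3 * Re (x i3) + t i4 * Re (x i4)) + (t i1 + t i2 + t i3 + t i4) * b j))).
    * ring.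
    * rewrite t1. ring.
- rewrite !re_plus, !re_scal_l. unfold x, abs_sum. cbn [Re fst].
  pose proof (bd i1 (p i1)). pose proof (bd i2 (p i2)). pose proof (bd i3 (p i3)). pose proof (bd i4 (p i4)).
  pose proof (Rabs_triang (t i1 * p i1 + t i2 * p i2 + t i3 * p i3) (t i4 * p i4)).
  pose proof (Rabs_triang (t i1 * p i1 + t i2 * p i2) (t i3 * p i3)).
  pose proof (Rabs_triang (t i1 * p i1) (t i2 * p i2)). lra.
- rewrite !im_plus, !im_scal_l. unfold x, abs_sum. cbn [Im snd].
  replace (t i1 * (eps * y i1) + t i2 * (eps * y i2) + t i3 * (eps * y i3) + t i4 * (eps * y i4))
    with (eps * (t i1 * y i1 + t i2 * y i2 + t i3 * y i3 + t i4 * y i4)) by ring.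
  rewrite Rabs_mult, (Rabs_right eps) by lra. apply Rmult_le_compat_l; [lra|].
  pose proof (bd i1 (y i1)). pose proof (bd i2 (y i2)). pose proof (bd i3 (y i3)). pose proof (bd i4 (y i4)).
  pose proof (Rabs_triang (t i1 * y i1 + t i2 * y i2 + t i3 * y i3) (t i4 * y i4)).
  pose proof (Rabs_triang (t i1 * y i1 + t i2 * y i2) (t i3 * y i3)).
  pose proof (Rabs_triang (t i1 * y i1) (t i2 * y i2)). lra.
Qed.

Lemma cont_W z : continuous W z.
Proof. apply continuous_wbar. apply hsc. Qed.

Lemma lin_as_ell (k : R) j z : k * lin a b eps j z = ell (- k * eps * a j) k (- k * eps * b j) z.
Proof. unfold lin, ell. ring. Qed.

Lemma cont_lin k j z : continuous (fun z => k * lin a b eps j (W z)) z.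
Proof.
apply (continuous_ext (fun z => ell (- k * eps * a j) k (- k * eps * b j) (W z))).
- intros; now rewrite lin_as_ell.
- apply ell_continuous, cont_W.
Qed.

Lemma W_clamp (P : C -> Prop) : (forall z, 0 <= Im z -> P (W z)) -> forall z, P (W z).
Proof.
intros h z. replace (W z) with (W (clamp z)).
- apply h, clamp_upper.
- unfold W, wbar. now rewrite (clamp_id (clamp z)) by apply clamp_upper.
Qed.

Lemma W_hull z : 0 < Im z -> hull x (W z).
Proof.
intros hz. apply quad_interior_hull. unfold W. rewrite wbar_eq by lra.
apply hsc. exists z. auto.
Qed.

Lemma W_lin j z : 0 <= e j * lin a b eps j (W z).
Proof.
apply (W_clamp (fun v => 0 <= e j * lin a b eps j v)). clear z.
apply closure_ge_0; [intros; apply cont_lin|].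
intros z hz. now apply hull_facts, W_hull.
Qed.

Lemma W_Re z : Rabs (Re (W z)) <= abs_sum p.
Proof.
apply (W_clamp (fun v => Rabs (Re v) <= abs_sum p)). clear z. intros z hz.
apply Rge_le, Rminus_ge, Rle_ge. revert z hz. apply closure_ge_0.
- intros z. apply continuous_Rminus; [apply continuous_const|].
  apply (continuous_Rfun Rabs); [apply continuous_Rabs|]. apply continuous_Re, cont_W.
- intros z hz. destruct (hull_facts _ (W_hull z hz)) as [_ [h _]]. lra.
Qed.

Lemma W_Im z : Rabs (Im (W z)) <= eps * abs_sum y.
Proof.
apply (W_clamp (fun v => Rabs (Im v) <= eps * abs_sum y)). clear z. intros z hz.
apply Rge_le, Rminus_ge, Rle_ge. revert z hz. apply closure_ge_0.
- intros z. apply continuous_Rminus; [apply continuous_const|].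
  apply (continuous_Rfun Rabs); [apply continuous_Rabs|]. apply continuous_Im, cont_W.
- intros z hz. destruct (hull_facts _ (W_hull z hz)) as [_ [_ h]]. lra.
Qed.

Lemma W_vertex t : W (RtoC t) = w (RtoC t).
Proof. apply wbar_eq. cbn. lra. Qed.

Lemma W_infty d : 0 < d -> exists M, forall z, 0 <= Im z -> M < Cmod z -> Cmod (W z - x i2) < d.
Proof.
intros hd. destruct hsc as [_ [_ [_ [h _]]]].
assert (L : locally (x i2) (fun v => Cmod (v - x i2) < d)) by (apply locally_Cmod; exists d; auto).
destruct (h _ L) as [M HM]. exists M. intros z hz hM. unfold W. rewrite wbar_eq by auto. apply HM; auto.
Qed.

Lemma ell_infty A B c0 d : 0 < d -> exists N, forall t, N <= t ->
  Rabs (ell A B c0 (W (0, t)) - ell A B c0 (x i2)) < d.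
Proof.
intros hd.
set (K := Rabs A + Rabs B + 1).
assert (hK : 0 < K) by (unfold K; pose proof (Rabs_pos A); pose proof (Rabs_pos B); lra).
destruct (W_infty (d / K)) as [M HM]; [now apply Rdiv_lt_0_compat|].
exists (Rmax 0 M + 1). intros t ht.
pose proof (Rmax_l 0 M). pose proof (Rmax_r 0 M).
assert (h : Cmod (W (0, t) - x i2) < d / K).
{ apply HM; cbn; [lra|]. pose proof (Im_le_Cmod (0, t)) as k. cbn in k.
  rewrite Rabs_right in k by lra. lra. }
set (u := (W (0, t) - x i2)%C) in *.
replace (ell A B c0 (W (0, t)) - ell A B c0 (x i2)) with (A * Re u + B * Im u)
  by (unfold ell, u; creal; ring).
apply Rle_lt_trans with (1 := Rabs_triang _ _). rewrite !Rabs_mult.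
pose proof (re_le_Cmod u) as k1. pose proof (Im_le_Cmod u) as k2.
assert (Rabs A * Rabs (Re u) <= Rabs A * Cmod u) by (apply Rmult_le_compat_l; auto using Rabs_pos).
assert (Rabs B * Rabs (Im u) <= Rabs B * Cmod u) by (apply Rmult_le_compat_l; auto using Rabs_pos).
apply Rle_lt_trans with ((Rabs A + Rabs B) * Cmod u); [lra|].
apply Rle_lt_trans with (K * Cmod u).
- apply Rmult_le_compat_r; [apply Cmod_ge_0 | unfold K; lra].
- apply Rlt_le_trans with (K * (d / K)); [now apply Rmult_lt_compat_l|]. right. field. lra.
Qed.

Lemma no_interlace_lin (k : R) j (c al be ga : R) : al < be < ga ->
  let h z := k * lin a b eps j z in
  c < h (W (RtoC al)) -> c < h (W (RtoC ga)) -> h (W (RtoC be)) < c -> h (x i2) < c -> False.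
Proof.
intros hab h h1 h2 h3 h4.
(* The four strict inequalities leave a margin m around the threshold c, which provides the two
   separate thresholds of [no_interlace]. *)
set (m := Rmin (Rmin (h (W (RtoC al)) - c) (h (W (RtoC ga)) - c)) (Rmin (c - h (W (RtoC be))) (c - h (x i2)))).
assert (hm : 0 < m /\ m <= h (W (RtoC al)) - c /\ m <= h (W (RtoC ga)) - c /\ m <= c - h (W (RtoC be)) /\ m <= c - h (x i2)) by (unfold m; minmax).
destruct (ell_infty (- k * eps * a j) k (- k * eps * b j) (m / 2) ltac:(lra)) as [N HN].
apply (no_interlace (quad_interior x) w (- k * eps * a j) k (- k * eps * b j) (proj1 hsc) cont_W
  (quad_interior_convex x) (c - m / 4) (c + m / 4) al be ga N); auto; try lra;
  fold W; rewrite <- ?(lin_as_ell k j); fold (h (W (RtoC al))) (h (W (RtoC be))) (h (W (RtoC ga))); try lra.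
intros t ht. specialize (HN t ht).
rewrite <- (lin_as_ell k j (W (0, t))), <- (lin_as_ell k j (x i2)) in HN.
rewrite <- (lin_as_ell k j (W (0, t))).
apply Rabs_def2 in HN. unfold h in *. lra.
Qed.

Lemma lin_vertex_0 j : lin a b eps j (x j) = 0 /\ lin a b eps j (x (prev j)) = 0.
Proof.
unfold lin, x, y. split; cbn [Re Im fst snd]; [ring|].
pose proof (meet (prev j)) as m. replace (next (prev j)) with j in m by now destruct j.
rewrite m. ring.
Qed.

Lemma lin_vertex_pos j : 0 < e j * lin a b eps j (x (next j)) /\
  0 < e j * lin a b eps j (x (next (next j))).
Proof.
pose proof (cvx i1) as c1. pose proof (cvx i2) as c2. pose proof (cvx i3) as c3. pose proof (cvx i4) as c4.
pose proof (meet i1) as m1. pose proof (meet i2) as m2. pose proof (meet i3) as m3. pose proof (meet i4) as m4.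
unfold e, lin, x, y. destruct j; cbn [next prev Re Im fst snd] in *; split;
match goal with |- 0 < ?u * (eps * ?v - eps * ?w) =>
  replace (u * (eps * v - eps * w)) with (eps * (u * (v - w))) by ring end;
apply Rmult_lt_0_compat; try lra; nra.
Qed.

Lemma edge_neq_0 j : e j <> 0.
Proof.
intros E. pose proof (cvx (prev j)) as c. replace (next (prev j)) with j in c by now destruct j.
unfold e in E. rewrite E in c. lra.
Qed.

(** Otherwise [e j * lin j] is positive at the point t and at a vertex off the edge, and zero at the
    two ends of the edge. With infinity counted as the parameter of [x i2], these pairs interlace on
    the boundary. *)
Lemma W_arc j t : arc z4 j t -> lin a b eps j (W (RtoC t)) = 0.
Proof.
intros ht.
destruct hsc as [_ [_ [v1 [_ [v3 [hz4 v4]]]]]].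
rewrite <- W_vertex in v1, v3, v4.
apply NNPP. intros N.
assert (hp : 0 < e j * lin a b eps j (W (RtoC t))).
{ destruct (Rle_lt_or_eq_dec _ _ (W_lin j (RtoC t))) as [h | h]; auto.
  exfalso. symmetry in h. apply Rmult_integral in h. destruct h as [h | h]; auto.
  now apply (edge_neq_0 j). }
destruct (lin_vertex_0 j) as [l0 l1]. destruct (lin_vertex_pos j) as [l2 l3].
set (v := e j * lin a b eps j (W (RtoC t))) in *.
assert (opp : forall z, - e j * lin a b eps j z = - (e j * lin a b eps j z)) by (intros; ring).
(* [no_interlace_lin] puts infinity on the lower side. For the arcs i2 and i3 infinity is an end of
   the arc, where the value is 0; for i1 and i4 it is a vertex off the edge, where the value is
   positive, hence the change of sign. *)
destruct j; cbn [next prev arc] in *.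
- set (u := e i1 * lin a b eps i1 (x i2)) in *.
  set (m := Rmin u v). assert (hm : 0 < m) by now apply Rmin_pos.
  pose proof (Rmin_l u v). pose proof (Rmin_r u v). fold m in H, H0.
  apply (no_interlace_lin (- e i1) i1 (- m / 2) z4 t 1 ht);
  rewrite opp, ?v1, ?v4, ?l0, ?l1; fold u v; lra.
- set (u := e i2 * lin a b eps i2 (x i3)) in *.
  set (m := Rmin u v). assert (hm : 0 < m) by now apply Rmin_pos.
  pose proof (Rmin_l u v). pose proof (Rmin_r u v). fold m in H, H0.
  apply (no_interlace_lin (e i2) i2 (m / 2) 0 1 t);
  rewrite ?v1, ?v3, ?l0, ?l1; fold u v; lra.
- set (u := e i3 * lin a b eps i3 (x i1)) in *.
  set (m := Rmin u v). assert (hm : 0 < m) by now apply Rmin_pos.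
  pose proof (Rmin_l u v). pose proof (Rmin_r u v). fold m in H, H0.
  apply (no_interlace_lin (e i3) i3 (m / 2) t 0 1);
  rewrite ?v1, ?v3, ?l0, ?l1; fold u v; lra.
- set (u := e i4 * lin a b eps i4 (x i2)) in *.
  set (m := Rmin u v). assert (hm : 0 < m) by now apply Rmin_pos.
  pose proof (Rmin_l u v). pose proof (Rmin_r u v). fold m in H, H0.
  apply (no_interlace_lin (- e i4) i4 (- m / 2) 0 t z4 ht);
  rewrite opp, ?v3, ?v4, ?l0, ?l1; fold u v; lra.
Qed.

Lemma pos_mult_l (u v : R) : 0 < u -> 0 <= u * v -> 0 <= v.
Proof. intros hu h. apply Rmult_le_reg_l with u; auto. lra. Qed.

(** On the line of the edge j the half plane conditions of the two neighbouring edges become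
    inequalities for the abscissa alone; the left turns at the two ends fix their signs. *)
Lemma W_range j t : arc z4 j t ->
    0 <= (p j - p (prev j)) * (Re (W (RtoC t)) - p (prev j)) /\
    0 <= (p j - p (prev j)) * (p j - Re (W (RtoC t))).
Proof.
intros ht. pose proof (W_arc j t ht) as E.
pose proof (W_lin (prev j) (RtoC t)) as h1. pose proof (W_lin (next j) (RtoC t)) as h2.
set (u := W (RtoC t)) in *. clearbody u.
pose proof (cvx (prev j)) as c1. pose proof (cvx j) as c2.
pose proof (meet (prev j)) as m1. pose proof (meet j) as m2.
replace (next (prev j)) with j in * by now destruct j.
unfold e in h1, h2. replace (prev (next j)) with j in * by now destruct j.
unfold lin in *.
assert (E1 : Im u = eps * (a j * Re u + b j)) by lra. rewrite E1 in h1, h2.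
set (ej := p j - p (prev j)) in *. set (s := Re u) in *.
set (f := p (prev j) - p (prev (prev j))) in *. set (g := p (next j) - p j) in *.
split.
- assert (K : f * (eps * (a j * s + b j) - eps * (a (prev j) * s + b (prev j))) =
    eps * (f * (a j - a (prev j)) * (s - p (prev j)))).
  { replace (b (prev j)) with (a j * p (prev j) + b j - a (prev j) * p (prev j)) by lra. ring. }
  rewrite K in h1. apply pos_mult_l in h1; auto.
  apply pos_mult_l with (f ^ 2 * (a j - a (prev j)) ^ 2).
  + apply Rmult_lt_0_compat; apply pow2_gt_0; intros e0; rewrite e0 in c1; lra.
  + replace (f ^ 2 * (a j - a (prev j)) ^ 2 * (ej * (s - p (prev j)))) with
      ((ej * f * (a j - a (prev j))) * (f * (a j - a (prev j)) * (s - p (prev j)))) by ring.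
    apply Rmult_le_pos; lra.
- assert (K : g * (eps * (a j * s + b j) - eps * (a (next j) * s + b (next j))) =
    eps * (g * (a (next j) - a j) * (p j - s))).
  { replace (b (next j)) with (a j * p j + b j - a (next j) * p j) by lra. ring. }
  rewrite K in h2. apply pos_mult_l in h2; auto.
  apply pos_mult_l with (g ^ 2 * (a (next j) - a j) ^ 2).
  + apply Rmult_lt_0_compat; apply pow2_gt_0; intros e0; rewrite e0 in c2; lra.
  + replace (g ^ 2 * (a (next j) - a j) ^ 2 * (ej * (p j - s))) with
      ((g * ej * (a (next j) - a j)) * (g * (a (next j) - a j) * (p j - s))) by ring.
    apply Rmult_le_pos; lra.
Qed.

Lemma riemann_disc : disc a b p eps W z4.
Proof.
pose proof hsc as [hc [_ [v1 [_ [v3 [hz4 v4]]]]]].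
rewrite <- W_vertex in v1, v3, v4.
split; auto using cont_W, W_Re, W_Im, W_arc, W_range.
- intros z hz. apply hol_wbar; auto. apply hc.
- intros d hd. apply W_infty, hd.
Qed.
End Quad.

(** * Oscillation away from the vertices *)

Lemma submean_Re (H : C -> C) (r : box) (p : C) :
  (forall z, in_box_int r z -> hol H z) -> in_box_int r p ->
  submean_at (fun z => Re (H z)) r p.
Proof.
intros hH hp. destruct (int_disc r p hp) as [q [hq Hq]].
exists q, (2 * PI). pose proof PI_RGT_0.
split; [lra|]. split; [lra|]. split; [apply sin_2PI|].
assert (D : forall s t, 0 <= s <= 1 -> in_box_int r (circ p (q * s) t)).
{ intros s t hs. apply Hq. rewrite Cmod_circ, Rabs_mult, !Rabs_right by lra. nra. }
split.
- intros t _. rewrite <- (Rmult_1_r q). apply in_box_int_in, D. lra.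
- right. symmetry. apply sector_mean; [lra| | |].
  + intros s t hs _. apply hol_continuous, hH, D, hs.
  + intros s t hs _. apply hH, D. lra.
  + intros s hs. now rewrite circ_2PI.
Qed.

(* The barrier (X^2 - Y^2) / r^2 + 2 Y / r is nonnegative on the bottom side of the
   rectangle |X| <= r, 0 <= Y <= r, at least 1 on the others, and small near X = Y = 0. *)
Lemma boundary_growth (F : C -> C) (x r M mu s : R) : 0 < r -> s = 1 \/ s = - (1) ->
  (forall z, continuous F z) -> (forall z, 0 < Im z -> hol F z) ->
  (forall z, Rabs (Im (F z) - mu) <= M) ->
  (forall t, x - r <= t <= x + r -> Im (F (RtoC t)) = mu) ->
  forall y, 0 <= y <= r -> s * (Im (F (x, y)) - mu) <= 2 * M * y / r.
Proof.
intros hr hs cF hF hM h0 y hy.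
assert (hM0 : 0 <= M) by (apply Rle_trans with (2 := hM 0%C), Rabs_pos).
assert (hsM : forall z, s * (Im (F z) - mu) <= M).
{ intros z. specialize (hM z). apply Rabs_le_between in hM. destruct hs as [-> | ->]; lra. }
set (H := fun z : C => (RtoC s * (- (Ci * F z)) + RtoC (- (s * mu)) -
  RtoC M * (RtoC (/ r ^ 2) * ((z - RtoC x) * (z - RtoC x)) + RtoC (2 / r) * (- (Ci * (z - RtoC x)))))%C).
assert (EH : forall X Y, Re (H (X, Y)) = s * (Im (F (X, Y)) - mu) -
  M * (((X - x) ^ 2 - Y ^ 2) / r ^ 2 + 2 * Y / r)).
{ intros X Y. unfold H. destruct (F (X, Y)) as [u v]. creal. field. lra. }
assert (hx : forall z, hol (fun z => (z - RtoC x)%C) z).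
{ intros z. apply hol_minus; [apply hol_id | apply hol_const]. }
assert (hh : forall z, hol F z -> hol H z).
{ intros z hz. unfold H. apply hol_minus; [apply hol_plus; [|apply hol_const]|].
  - apply hol_scal, hol_opp, hol_scal, hz.
  - apply hol_scal, hol_plus; [apply hol_scal, hol_mult; auto | apply hol_scal, hol_opp, hol_scal; auto]. }
assert (K : Re (H (x, y)) <= 0).
{ apply (max_principle (fun z => Re (H z)) (Box (x - r) (x + r) 0 r)).
  - split; cbn; lra.
  - intros z _. apply continuous_Re. unfold H.
    apply continuous_Cminus; [apply continuous_Cplus; [|apply continuous_const]|].
    + apply continuous_scal_C, continuous_Copp, continuous_scal_C, cF.
    + apply continuous_scal_C, continuous_Cplus.
      * apply continuous_scal_C, continuous_Cmult; apply hol_continuous, hx.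
      * apply continuous_scal_C, continuous_Copp, continuous_scal_C, hol_continuous, hx.
  - intros [X Y] hp. destruct (box_boundary _ _ hp) as [hi | hb].
    + right. apply submean_Re; auto. intros z [_ hz]; cbn in hz. apply hh, hF; lra.
    + left. rewrite EH. pose proof (hsM (X, Y)) as hsm.
      destruct hp as [hX hY]; cbn in hX, hY.
      assert (hr2 : 0 < r ^ 2) by (apply pow_lt; auto).
      assert (side : 1 <= ((X - x) ^ 2 - Y ^ 2) / r ^ 2 + 2 * Y / r -> 
        s * (Im (F (X, Y)) - mu) - M * (((X - x) ^ 2 - Y ^ 2) / r ^ 2 + 2 * Y / r) <= 0).
      { intros k. assert (M * 1 <= M * (((X - x) ^ 2 - Y ^ 2) / r ^ 2 + 2 * Y / r)) by (apply Rmult_le_compat_l; auto). lra. }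
      assert (lat : (X - x) ^ 2 = r ^ 2 -> 1 <= ((X - x) ^ 2 - Y ^ 2) / r ^ 2 + 2 * Y / r).
      { intros ->. apply Rmult_le_reg_r with (r ^ 2); auto.
        replace (((r ^ 2 - Y ^ 2) / r ^ 2 + 2 * Y / r) * r ^ 2) with (r ^ 2 - Y ^ 2 + 2 * Y * r) by (field; lra).
        nra. }
      unfold in_box in hb; cbn in hb. destruct hb as [hb | [hb | [hb | hb]]].
      * apply side, lat. replace (X - x) with (- r) by lra. ring.
      * apply side, lat. replace (X - x) with r by lra. ring.
      * assert (Y = 0) by lra. subst Y. change (F (X, 0)) with (F (RtoC X)). rewrite (h0 X) by lra.
        assert (0 <= M * ((X - x) ^ 2 / r ^ 2)).
        { apply Rmult_le_pos; auto. apply Rmult_le_pos; [apply pow2_ge_0|]. left; now apply Rinv_0_lt_compat. }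
        replace (M * (((X - x) ^ 2 - 0 ^ 2) / r ^ 2 + 2 * 0 / r)) with (M * ((X - x) ^ 2 / r ^ 2)) by (field; lra).
        replace (s * (mu - mu)) with 0 by ring. lra.
      * assert (Y = r) by lra. subst Y. apply side.
        replace (((X - x) ^ 2 - r ^ 2) / r ^ 2 + 2 * r / r) with ((X - x) ^ 2 / r ^ 2 + 1) by (field; lra).
        assert (0 <= (X - x) ^ 2 / r ^ 2); [|lra].
        apply Rmult_le_pos; [apply pow2_ge_0|]. left; now apply Rinv_0_lt_compat.
  - split; cbn; lra. }
rewrite EH in K. replace (x - x) with 0 in K by ring.
assert (0 <= M * (y ^ 2 / r ^ 2)).
{ apply Rmult_le_pos; auto. apply Rmult_le_pos; [apply pow2_ge_0|]. left. apply Rinv_0_lt_compat, pow_lt; auto. }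
replace (M * ((0 ^ 2 - y ^ 2) / r ^ 2 + 2 * y / r)) with (2 * M * y / r - M * (y ^ 2 / r ^ 2)) in K by (field; lra).
lra.
Qed.

Lemma boundary_growth_abs (F : C -> C) (x r M mu : R) : 0 < r ->
  (forall z, continuous F z) -> (forall z, 0 < Im z -> hol F z) ->
  (forall z, Rabs (Im (F z) - mu) <= M) ->
  (forall t, x - r <= t <= x + r -> Im (F (RtoC t)) = mu) ->
  forall y, 0 <= y -> Rabs (Im (F (x, y)) - mu) <= 2 * M * y / r.
Proof.
intros hr cF hF hM h0 y hy.
destruct (Rle_dec y r) as [h | h].
- pose proof (boundary_growth F x r M mu 1 hr (or_introl eq_refl) cF hF hM h0 y (conj hy h)).
  pose proof (boundary_growth F x r M mu _ hr (or_intror eq_refl) cF hF hM h0 y (conj hy h)).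
  apply Rabs_le. lra.
- apply Rle_trans with (1 := hM _).
  assert (hM0 : 0 <= M) by (apply Rle_trans with (2 := hM 0%C), Rabs_pos).
  apply Rmult_le_reg_r with r; auto. replace (2 * M * y / r * r) with (2 * M * y) by (field; lra). nra.
Qed.

(* The lines through the images of the boundary intervals avoiding the vertices. *)
Definition lined (W : C -> C) (vs : R -> Prop) (M : R) : Prop :=
  forall x0 x1, x0 <= x1 -> (forall v, vs v -> v < x0 \/ x1 < v) ->
  exists k mu, (forall z, Rabs (Im ((1 - RtoC k * Ci) * W z)%C - mu) <= M) /\
    forall t, x0 <= t <= x1 -> Im ((1 - RtoC k * Ci) * W (RtoC t))%C = mu.

Lemma slope_Cmod k : 1 <= Cmod (1 - RtoC k * Ci).
Proof.
eapply Rle_trans; [|apply re_le_Cmod].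
replace (Re (1 - RtoC k * Ci)%C) with 1 by (creal; ring). rewrite Rabs_R1. lra.
Qed.

Lemma Cmod_minus_self (z : C) : Cmod (z - z) = 0.
Proof. replace (z - z)%C with (RtoC 0) by ring. apply Cmod_0. Qed.

(** At height at least r / 2 the gradient bound on a disc of radius r / 4 is enough. At a smaller
    height y only a disc of radius y / 2 is available, but on it the rotated function deviates from
    the boundary value by O(M y / r), so that y cancels. *)
Lemma derivative_bound (W : C -> C) (vs : R -> Prop) (M r : R) (z : C) : 0 < r ->
  (forall z, continuous W z) -> (forall z, 0 < Im z -> hol W z) ->
  (forall z, Rabs (Im (W z)) <= M) -> lined W vs M ->
  0 < Im z -> (forall v, vs v -> r <= Cmod (z - RtoC v)) ->
  exists l, cder W z l /\ Cmod l <= 100 * M / r.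
Proof.
intros hr cW hW hM hL hz hv.
destruct (hW z hz) as [l hl]. exists l. split; auto.
assert (hM0 : 0 <= M) by (apply Rle_trans with (2 := hM 0%C), Rabs_pos).
assert (imd : forall z' q, Cmod (z' - z) <= q -> Im z - q <= Im z' <= Im z + q /\ Re z - q <= Re z' <= Re z + q).
{ intros z' q h. pose proof (Rle_trans _ _ _ (re_le_Cmod _) h) as k1. pose proof (Rle_trans _ _ _ (Im_le_Cmod _) h) as k2.
  apply Rabs_le_between in k1, k2. creal. unfold Re, Im. lra. }
destruct (Rle_dec (r / 2) (Im z)) as [h | h].
- apply Rle_trans with (4 * M / (r / 4)).
  + apply (gradient_bound W z l (r / 4) M 0); auto; [lra| |].
    * intros z' hz'. apply hW. pose proof (imd z' (r / 4) ltac:(lra)). lra.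
    * intros z' _. rewrite Rminus_0_r. auto.
  + replace (4 * M / (r / 4)) with (16 * M / r) by (field; lra).
    apply Rmult_le_compat_r; [left; now apply Rinv_0_lt_compat | lra].
- set (x := Re z) in *. set (y := Im z) in *.
  destruct (hL (x - r / 2) (x + r / 2)) as [k [mu [k1 k2]]]; [lra| |].
  { intros v hvv. specialize (hv v hvv).
    pose proof (Rle_trans _ _ _ hv (Cmod_le_abs _)) as k.
    replace (Re (z - RtoC v)%C) with (x - v) in k by (unfold x; creal; ring).
    replace (Im (z - RtoC v)%C) with y in k by (unfold y; creal; ring).
    rewrite (Rabs_right y) in k by lra. unfold Rabs in k. destruct Rcase_abs; lra. }
  set (c := (1 - RtoC k * Ci)%C) in *.
  set (F := fun z => (c * W z)%C).
  assert (cF : forall z, continuous F z) by (intros; now apply continuous_scal_C).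
  assert (hF : forall z, 0 < Im z -> hol F z) by (intros; now apply hol_scal, hW).
  assert (hFl : cder F z (c * l)%C).
  { eapply cder_eq; [apply cder_mult; [apply cder_const | exact hl]|]. cbn beta. ring. }
  (* On the disc the height is at most 3 y / 2, and 8 times 3 / 2 is 12; the final constant is then
     4 times 12 times 2, rounded up to 100. *)
  assert (G : forall z', Cmod (z' - z) <= y / 2 -> Rabs (Im (F z') - mu) <= 12 * M * y / r).
  { intros z' hz'. destruct (imd z' _ hz') as [i1 i2]. fold x y in i1, i2.
    apply Rle_trans with (2 * M * Im z' / (r / 4)).
    - destruct z' as [x' y']. apply boundary_growth_abs; auto; try lra; cbn in *; try lra.
      intros t ht. apply k2. lra.
    - replace (2 * M * Im z' / (r / 4)) with (8 * M * Im z' / r) by (field; lra).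
      apply Rmult_le_compat_r; [left; now apply Rinv_0_lt_compat|]. nra. }
  assert (K : Cmod (c * l) <= 4 * (12 * M * y / r) / (y / 2)).
  { apply (gradient_bound F z (c * l)%C (y / 2) _ mu); auto; [lra|].
    intros z' hz'. apply hF. destruct (imd z' (y / 2)) as [i1 _]; [lra|]. fold y in i1. lra. }
  replace (4 * (12 * M * y / r) / (y / 2)) with (96 * M / r) in K by (field; lra).
  rewrite Cmod_mult in K. pose proof (slope_Cmod k) as hc. fold c in hc.
  assert (96 * M / r <= 100 * M / r) by (apply Rmult_le_compat_r; [left; now apply Rinv_0_lt_compat | lra]).
  pose proof (Cmod_ge_0 l). nra.
Qed.

(** The mean value theorem is applied to the component of G in the direction of [G q - G p],
    normalised so that its increment is the square of the modulus. *)
Lemma segment_bound (G : C -> C) (p q : C) (B : R) : 0 <= B ->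
  (forall t, 0 <= t <= 1 -> continuous G (p + RtoC t * (q - p))%C) ->
  (forall t, 0 < t < 1 -> exists l, cder G (p + RtoC t * (q - p))%C l /\ Cmod l <= B) ->
  Cmod (G q - G p) <= B * Cmod (q - p).
Proof.
intros hB cG hG.
set (k := Cconj (G q - G p)).
set (f := fun t : R => Re (k * G (p + RtoC t * (q - p)))%C).
assert (df : forall t, 0 < t < 1 -> exists L, is_derive f t L /\ L <= Cmod k * (B * Cmod (q - p))).
{ intros t ht. destruct (hG t ht) as [l [hl hlB]].
  exists (Re (k * (l * (q - p)))%C). split.
  - apply is_derive_Reals. intros e he.
    set (D := Cmod k * Cmod (q - p) + 1).
    assert (hD : 0 < D) by (unfold D; pose proof (Rmult_le_pos _ _ (Cmod_ge_0 k) (Cmod_ge_0 (q - p))); lra).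
    destruct (proj1 (cder_eps _ _ _) hl (e / D)) as [d [hd Hd]]; [now apply Rdiv_lt_0_compat|].
    assert (hdd : 0 < d / (Cmod (q - p) + 1)) by (pose proof (Cmod_ge_0 (q - p)); apply Rdiv_lt_0_compat; lra).
    exists (mkposreal _ hdd). intros h hn hh. cbn in hh.
    set (z := (p + RtoC t * (q - p))%C) in *.
    set (z' := (p + RtoC (t + h) * (q - p))%C).
    assert (E : (z' - z)%C = (RtoC h * (q - p))%C) by (unfold z, z'; rewrite RtoC_plus; ring).
    assert (hz : Cmod (z' - z) < d).
    { rewrite E, Cmod_mult, Cmod_R. pose proof (Cmod_ge_0 (q - p)).
      apply Rle_lt_trans with (Rabs h * (Cmod (q - p) + 1)).
      - apply Rmult_le_compat_l; [apply Rabs_pos | lra].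
      - apply Rlt_le_trans with (d / (Cmod (q - p) + 1) * (Cmod (q - p) + 1)).
        + apply Rmult_lt_compat_r; lra.
        + right. field. lra. }
    specialize (Hd z' hz). rewrite E in Hd.
    replace ((f (t + h) - f t) / h - Re (k * (l * (q - p)))%C) with
      (/ h * Re (k * (G z' - G z - l * (RtoC h * (q - p))))%C).
    2:{ unfold f. fold z z'. generalize (G z') (G z) (q - p)%C. intros g1 g2 g3.
        creal. field. auto. }
    rewrite Rabs_mult, Rabs_inv.
    pose proof (re_le_Cmod (k * (G z' - G z - l * (RtoC h * (q - p))))%C) as k1.
    rewrite Cmod_mult in k1.
    assert (hh0 : 0 < Rabs h) by now apply Rabs_pos_lt.
    apply Rle_lt_trans with (/ Rabs h * (Cmod k * (e / D * (Rabs h * Cmod (q - p))))).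
    + apply Rmult_le_compat_l; [left; now apply Rinv_0_lt_compat|].
      apply Rle_trans with (1 := k1). apply Rmult_le_compat_l; [apply Cmod_ge_0|].
      rewrite <- (Cmod_R h), <- Cmod_mult. exact Hd.
    + replace (/ Rabs h * (Cmod k * (e / D * (Rabs h * Cmod (q - p))))) with (e * ((Cmod k * Cmod (q - p)) / D))
        by (field; lra).
      rewrite <- (Rmult_1_r e) at 2. apply Rmult_lt_compat_l; auto.
      apply Rmult_lt_reg_r with D; auto. unfold Rdiv. rewrite Rmult_assoc, Rinv_l by lra. unfold D. lra.
  - eapply Rle_trans; [apply Re_le_Cmod|]. rewrite !Cmod_mult.
    apply Rmult_le_compat_l; [apply Cmod_ge_0|]. apply Rmult_le_compat_r; [apply Cmod_ge_0 | auto]. }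
assert (cf : forall t, 0 <= t <= 1 -> continuous f t).
{ intros t ht. apply continuous_Re, continuous_scal_C.
  apply (continuous_comp (fun t : R => (p + RtoC t * (q - p))%C) G); [apply continuous_line | auto]. }
assert (E : f 1 - f 0 = Cmod (G q - G p) * Cmod (G q - G p)).
{ unfold f. replace (p + RtoC 1 * (q - p))%C with q by ring. replace (p + RtoC 0 * (q - p))%C with p by ring.
  replace (Re (k * G q)%C - Re (k * G p)%C) with (Re ((G q - G p) * k)%C) by (creal; ring).
  unfold k. rewrite <- Cmod2_conj. cbn. ring. }
destruct (classic (G q = G p)) as [e | n].
{ rewrite e, Cmod_minus_self. apply Rmult_le_pos; [auto | apply Cmod_ge_0]. }
assert (hp : 0 < Cmod (G q - G p)) by (apply Cmod_gt_0; now apply Cminus_neq).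
(* The intermediate point may be an end of the interval, where f need not be differentiable. The
   value 0 assigned there would give [f 1 = f 0], which [hpp] excludes. *)
destruct (MVT_gen f 0 1 (fun t => if Rlt_dec 0 t then if Rlt_dec t 1 then Derive f t else 0 else 0))
  as [c [hc Hc]].
- intros t. rewrite Rmin_left, Rmax_right by lra. intros ht.
  destruct (Rlt_dec 0 t), (Rlt_dec t 1); try lra.
  destruct (df t ht) as [L [hL _]]. apply Derive_correct. now exists L.
- intros t. rewrite Rmin_left, Rmax_right by lra. intros ht.
  now apply continuity_pt_filterlim, cf.
- rewrite E in Hc. pose proof (Rmult_lt_0_compat _ _ hp hp) as hpp.
  destruct (Rlt_dec 0 c); [|lra]. destruct (Rlt_dec c 1); [|lra].
  destruct (df c) as [L [hL1 hL2]]; [lra|].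
  rewrite (is_derive_unique _ _ _ hL1) in Hc.
  unfold k in hL2. rewrite Cmod_conj in hL2. nra.
Qed.

Lemma Cexp_polar (z : C) : z <> 0%C -> 0 <= Im z -> z = Cexp (ln (Cmod z), arg_up z).
Proof.
intros h0 hi. destruct (is_arg_up z h0 hi) as [[_ E] _]. rewrite E at 1.
unfold Cexp at 2. cbn. rewrite exp_ln by now apply Cmod_gt_0.
rewrite Cexp_imag. ceq; ring.
Qed.

Lemma D_main_spec d z : D_main d z -> 0 < d ->
  0 <= Im z /\ d <= Cmod z /\ Cmod z <= / d /\ d <= Cmod (z - RtoC 1).
Proof.
intros [h1 h2] hd. unfold upper_closed in h1.
assert (k0 : d <= Cmod z).
{ apply Rnot_lt_le. intros N. apply h2. left. split; auto. now replace (z - RtoC 0)%C with z by ring. }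
assert (k1 : d <= Cmod (z - RtoC 1)).
{ apply Rnot_lt_le. intros N. apply h2. right; left. split; auto. }
repeat split; auto.
apply Rnot_lt_le. intros N. apply h2. right; right. split; auto. split.
- intros e. rewrite e, Cmod_0 in k0. lra.
- rewrite <- (Rinv_inv d). apply Rinv_lt_contravar; auto.
  apply Rmult_lt_0_compat; [now apply Rinv_0_lt_compat | lra].
Qed.

(** The point z is joined to i along its circle around 0 and then along the imaginary axis. In the
    coordinate log z the path has length at most [PI + Rabs (ln d)]. It stays at distance d / 2 from
    all vertices, so the derivative is at most 100 M / (d / 2), and the change of coordinate costs
    at most 1 / d. *)
Lemma oscillation (W : C -> C) (vs : R -> Prop) (M d : R) : 0 < d <= 1 / 2 ->
  (forall z, continuous W z) -> (forall z, 0 < Im z -> hol W z) ->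
  (forall z, Rabs (Im (W z)) <= M) -> lined W vs M ->
  (forall v, vs v -> Rabs v <= d / 2 \/ v = 1 \/ 2 / d <= v) ->
  forall z, D_main d z -> Cmod (W z - W Ci) <= 200 * M / d ^ 2 * (PI + Rabs (ln d)).
Proof.
intros hd cW hW hM hL hv z hz.
assert (hM0 : 0 <= M) by (apply Rle_trans with (2 := hM 0%C), Rabs_pos).
pose proof PI_RGT_0 as hpi.
destruct (D_main_spec d z hz ltac:(lra)) as [z1 [z2 [z3 z4]]].
assert (z0 : z <> 0%C) by (apply Cmod_gt_0; lra).
pose proof (Cexp_polar z z0 z1) as Ez.
destruct (is_arg_up z z0 z1) as [_ ht].
set (t := arg_up z) in *. set (s := ln (Cmod z)) in *.
assert (hs : ln d <= s <= - ln d).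
{ unfold s. rewrite <- ln_Rinv by lra. split; apply ln_le; lra. }
assert (es : exp s = Cmod z) by (apply exp_ln; lra).
set (G := fun z => W (Cexp z)).
assert (cG : forall z, continuous G z) by (intros; now apply (continuous_comp Cexp W); [apply hol_continuous, hol_Cexp|]).
set (B := 200 * M / d ^ 2).
assert (hd2 : 0 < d ^ 2) by (apply pow_lt; lra).
assert (hB : 0 <= B) by (apply Rmult_le_pos; [lra | left; now apply Rinv_0_lt_compat]).
assert (key : forall x y, d <= exp x <= / d -> 0 < sin y -> d <= Cmod (Cexp (x, y) - RtoC 1) ->
  exists l, cder G (x, y) l /\ Cmod l <= B).
{ intros x y hx hy h1.
  assert (hm : Cmod (Cexp (x, y)) = exp x) by (rewrite Cmod_Cexp; reflexivity).
  destruct (derivative_bound W vs M (d / 2) (Cexp (x, y))) as [l [hl Hl]]; auto; [lra| | |].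
  - cbn. apply Rmult_lt_0_compat; auto. apply exp_pos.
  - intros v hvv. destruct (hv v hvv) as [k | [-> | k]]; [|lra|].
    + pose proof (Cmod_triangle_minus (Cexp (x, y)) (RtoC v) 0) as T.
      replace (Cexp (x, y) - 0)%C with (Cexp (x, y)) in T by ring.
      replace (RtoC v - 0)%C with (RtoC v) in T by ring. rewrite Cmod_R, hm in T. lra.
    + pose proof (Cmod_triangle_minus (RtoC v) (Cexp (x, y)) 0) as T.
      replace (Cexp (x, y) - 0)%C with (Cexp (x, y)) in T by ring.
      replace (RtoC v - 0)%C with (RtoC v) in T by ring. rewrite Cmod_R, hm in T.
      rewrite Cmod_minus_sym in T. pose proof (Rle_abs v).
      assert (1 <= / d) by (rewrite <- Rinv_1; apply Rinv_le_contravar; lra).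
      unfold Rdiv in k. lra.
  - exists (l * Cexp (x, y))%C. split.
    + apply (cder_comp W Cexp); auto. apply cder_Cexp.
    + rewrite Cmod_mult, hm.
      apply Rle_trans with (100 * M / (d / 2) * / d).
      * apply Rmult_le_compat; auto; [apply Cmod_ge_0 | left; apply exp_pos | lra].
      * right. unfold B. field. lra. }
assert (h1 : forall x y, cos y <= 0 -> 1 <= Cmod (Cexp (x, y) - RtoC 1)).
{ intros x y hy. eapply Rle_trans; [|apply re_le_Cmod]. cbn.
  pose proof (exp_pos x). rewrite Rabs_left1; nra. }
destruct (ex_intro (fun q => q = PI / 2) _ eq_refl) as [q hq].
assert (S1 : Cmod (G (s, q) - G (s, t)) <= B * PI).
{ apply Rle_trans with (B * Cmod ((s, q) - (s, t))).
  - apply segment_bound; auto. intros u hu.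
    replace ((s, t) + RtoC u * ((s, q) - (s, t)))%C with ((s, t + u * (q - t)) : C) by (ceq; ring).
    set (y := t + u * (q - t)).
    assert (hy : t <= q /\ t <= y <= q /\ 0 < y \/ q < t /\ q <= y < t).
    { unfold y. destruct (Rle_dec t (q)); [left | right]; repeat split; nra. }
    apply key; [rewrite es; lra| |].
    + apply sin_gt_0; lra.
    + destruct hy as [hy | hy].
      (* Turning towards the imaginary axis from the right decreases the cosine, hence increases the
         distance to 1. *)
      * apply Rle_trans with (1 := z4). rewrite Ez at 1.
        assert (hcos : cos y <= cos t) by (apply cos_decr_1; lra).
        unfold Cmod. apply sqrt_le_1_alt. cbn [fst snd Cexp Cminus Cplus Copp RtoC].
        unfold Cexp, Cminus, Cplus, Copp, RtoC, Re, Im. cbn [fst snd].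
        pose proof (sin2_cos2 y) as q1. pose proof (sin2_cos2 t) as q2. unfold Rsqr in q1, q2.
        pose proof (exp_pos s) as hes. set (E := exp s) in *.
        replace ((E * cos t + - (1)) ^ 2 + (E * sin t + - 0) ^ 2) with (E * E * (sin t * sin t + cos t * cos t) - 2 * E * cos t + 1) by ring.
        replace ((E * cos y + - (1)) ^ 2 + (E * sin y + - 0) ^ 2) with (E * E * (sin y * sin y + cos y * cos y) - 2 * E * cos y + 1) by ring.
        rewrite q1, q2. nra.
      * apply Rle_trans with 1; [lra|]. apply h1. apply cos_le_0; lra.
  - apply Rmult_le_compat_l; auto.
    replace ((s, q) - (s, t))%C with (RtoC (q - t) * Ci)%C by (ceq; ring).
    rewrite Cmod_mult, Cmod_Ci, Cmod_R. assert (Rabs (q - t) <= PI); [apply Rabs_le; lra | lra]. }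
assert (S2 : Cmod (G (0, q) - G (s, q)) <= B * Rabs (ln d)).
{ assert (ln d < 0) by (rewrite <- ln_1; apply ln_increasing; lra).
  apply Rle_trans with (B * Cmod ((0, q) - (s, q))).
  - apply segment_bound; auto. intros u hu.
    replace ((s, q) + RtoC u * ((0, q) - (s, q)))%C with (((1 - u) * s, q) : C) by (ceq; ring).
    apply key.
    + rewrite <- (exp_ln d) at 1 by lra. rewrite <- (exp_ln d) at 2 by lra. rewrite <- exp_Ropp.
      assert (ln d < (1 - u) * s < - ln d) by nra.
      split; left; apply exp_increasing; lra.
    + rewrite hq, sin_PI2; lra.
    + apply Rle_trans with 1; [lra|]. apply h1. rewrite hq, cos_PI2; lra.
  - apply Rmult_le_compat_l; auto.
    replace ((0, q) - (s, q))%C with (RtoC (- s))%C by (ceq; ring).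
    rewrite Cmod_R, Rabs_Ropp, (Rabs_left (ln d)) by auto. apply Rabs_le; lra. }
replace (W z) with (G (s, t)) by (unfold G; now rewrite <- Ez).
replace (W Ci) with (G (0, q)).
2:{ unfold G. f_equal. rewrite Cexp_imag, hq, cos_PI2, sin_PI2. reflexivity. }
rewrite Cmod_minus_sym.
eapply Rle_trans; [apply (Cmod_triangle_minus _ (G (s, q)))|]. lra.
Qed.

(** * Maximum principle on strips *)

Lemma strip_max (D : C -> C) (l0 l1 : C) (T1 T2 B : R) : T1 <= T2 ->
  l0 <> 0%C -> l1 <> 0%C ->
  (forall z, continuous D z) ->
  (forall z, 0 < Im z < 1 -> hol D z) ->
  (forall t, T1 <= t <= T2 -> Im (l0 * D (t, 0)) = 0) ->
  (forall t, T1 <= t <= T2 -> Im (l1 * D (t, 1)) = 0) ->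
  (forall s, 0 <= s <= 1 -> Cmod (D (T1, s)) <= B) ->
  (forall s, 0 <= s <= 1 -> Cmod (D (T2, s)) <= B) ->
  forall t s, T1 <= t <= T2 -> 0 <= s <= 1 -> Cmod (D (t, s)) <= B.
Proof.
intros hT n0 n1 cD hD I0 I1 B1 B2 t0 s0 ht0 hs0.
apply (max_principle (fun z => Cmod (D z)) (Box T1 T2 0 1)).
- split; cbn; lra.
- intros z _. now apply continuous_Cmod.
- intros [x y] hp. destruct (box_boundary _ _ hp) as [hi | hb].
  { right. apply submean_interior; auto. intros z [_ hz]; cbn in hz. now apply hD. }
  destruct hp as [hx hy]; cbn in hx, hy.
  destruct (Req_dec x T1) as [-> | x1]; [left; auto|].
  destruct (Req_dec x T2) as [-> | x2]; [left; auto|].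
  set (q := Rmin (1 / 2) (Rmin (x - T1) (T2 - x))).
  assert (hq : 0 < q /\ q <= 1 / 2 /\ q <= x - T1 /\ q <= T2 - x) by (unfold q; minmax).
  right. pose proof PI_RGT_0.
  assert (tr : forall t, -1 <= cos t <= 1) by (intros; apply COS_bound).
  assert (y0 : y = 0 \/ y = 1) by (unfold in_box in hb; cbn in hb; lra).
  destruct y0 as [-> | ->].
  + exists q, PI. repeat split; try lra; try apply sin_PI.
    * rewrite circ_re. cbn. specialize (tr t). cbn; nra.
    * rewrite circ_re. cbn. specialize (tr t). nra.
    * rewrite circ_im. cbn. assert (0 <= sin t) by (apply sin_ge_0; lra). nra.
    * rewrite circ_im. cbn. assert (sin t <= 1) by apply SIN_bound. nra.
    * apply half_submean with l0; auto; try lra.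
      -- intros u t hu ht. apply hD. rewrite circ_im. cbn.
         assert (0 < sin t) by (apply sin_gt_0; lra). assert (sin t <= 1) by apply SIN_bound.
         assert (0 < q * u) by (apply Rmult_lt_0_compat; lra). nra.
      -- intros u hu. rewrite (Rabs_right q) in hu by lra. apply Rabs_le_between in hu.
         replace ((x, 0) + RtoC u)%C with ((x + u, 0) : C) by (ceq; ring). apply I0. lra.
  (* On the upper side the half disc inside the strip is the lower one, hence the negative
     radius. *)
  + exists (- q), PI. repeat split; try lra; try apply sin_PI.
    * rewrite circ_re. cbn. specialize (tr t). nra.
    * rewrite circ_re. cbn. specialize (tr t). nra.
    * rewrite circ_im. cbn. assert (sin t <= 1) by apply SIN_bound. nra.
    * rewrite circ_im. cbn. assert (0 <= sin t) by (apply sin_ge_0; lra). nra.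
    * apply half_submean with l1; auto; try lra.
      -- intros u t hu ht. apply hD. rewrite circ_im. cbn.
         assert (0 < sin t) by (apply sin_gt_0; lra). assert (sin t <= 1) by apply SIN_bound.
         assert (0 < q * u) by (apply Rmult_lt_0_compat; lra). nra.
      -- intros u hu. rewrite Rabs_Ropp, (Rabs_right q) in hu by lra. apply Rabs_le_between in hu.
         replace ((x, 1) + RtoC u)%C with ((x + u, 1) : C) by (ceq; ring). apply I1. lra.
- split; cbn; lra.
Qed.

(** The strip is cut off so far to the left that D is below e there; [strip_max] then gives the
    bound B + e. *)
Lemma half_strip_max (D : C -> C) (l0 l1 : C) (B : R) : 
  l0 <> 0%C -> l1 <> 0%C ->
  (forall z, continuous D z) ->
  (forall z, 0 < Im z < 1 -> hol D z) ->
  (forall t, t <= 0 -> Im (l0 * D (t, 0)) = 0) ->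
  (forall t, t <= 0 -> Im (l1 * D (t, 1)) = 0) ->
  (forall s, 0 <= s <= 1 -> Cmod (D (0, s)) <= B) ->
  (forall e, 0 < e -> exists T, forall t s, t <= T -> 0 <= s <= 1 -> Cmod (D (t, s)) <= e) ->
  forall t s, t <= 0 -> 0 <= s <= 1 -> Cmod (D (t, s)) <= B.
Proof.
intros n0 n1 cD hD I0 I1 B1 BL t s ht hs.
assert (hB : 0 <= B) by (apply Rle_trans with (2 := B1 0 ltac:(lra)), Cmod_ge_0).
apply le_epsilon. intros e he. destruct (BL e he) as [T HT].
set (T' := Rmin t T).
assert (hT' : T' <= t /\ T' <= T) by (split; [apply Rmin_l | apply Rmin_r]).
apply (strip_max D l0 l1 T' 0); auto; try lra.
- intros u hu. apply I0; lra.
- intros u hu. apply I1; lra.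
- intros u hu. specialize (HT T' u ltac:(lra) hu). lra.
- intros u hu. specialize (B1 u hu). lra.
Qed.

(** Up to a positive factor this is exp(-i atan k): multiplication by it makes lines of slope k
    horizontal. *)
Definition slope (k : R) : C := (1, - k).

Lemma slope_neq_0 k : slope k <> 0%C.
Proof. intros E. injection E. lra. Qed.

(** [Cconj (slope k')] has the direction of the lines of slope k', and the rotation carries that
    direction to slope k. *)
Lemma slope_turn (k k' : R) (r : R) :
  Im (slope k * (RtoC r * Cconj (slope k') * Cexp (0, (atan k - atan k')%R)))%C = 0.
Proof.
rewrite Cexp_imag, cos_minus, sin_minus, !cos_atan, !sin_atan. unfold slope. creal.
assert (0 < sqrt (1 + k²)) by (apply sqrt_lt_R0; pose proof (Rle_0_sqr k); lra).
assert (0 < sqrt (1 + k'²)) by (apply sqrt_lt_R0; pose proof (Rle_0_sqr k'); lra).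
field. lra.
Qed.

Lemma Im_slope_lin a b eps j (z z0 : C) :
  lin a b eps j z = 0 -> lin a b eps j z0 = 0 -> Im (slope (eps * a j) * (z - z0))%C = 0.
Proof.
unfold lin, slope. intros h h0. destruct z as [x y], z0 as [x0 y0]. creal. lra.
Qed.

Lemma Cexp_real_scale (om t s : R) : Cexp (RtoC om * (t, s))%C = (RtoC (exp (om * t)%R) * Cexp (0, (om * s)%R))%C.
Proof.
rewrite Cexp_imag. unfold Cexp.
replace (Re (RtoC om * (t, s))%C) with (om * t) by (creal; ring).
replace (Im (RtoC om * (t, s))%C) with (om * s) by (creal; ring).
ceq; ring.
Qed.

(* The comparison map of a strip: it sends the sides sigma = 0 and sigma = 1 into the lines
   of slopes k0 and k1 through x0. *)
Definition wedge (x0 : C) (c k0 k1 : R) (z : C) : C :=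
  (x0 + RtoC c * Cconj (slope k0) * Cexp (RtoC (atan k1 - atan k0)%R * z))%C.

Lemma hol_wedge x0 c k0 k1 z : hol (wedge x0 c k0 k1) z.
Proof.
apply hol_plus; [apply hol_const|]. apply hol_scal.
apply (hol_comp Cexp); [apply hol_Cexp | apply hol_scal, hol_id].
Qed.

Lemma wedge_bottom x0 c k0 k1 t : Im (slope k0 * (wedge x0 c k0 k1 (t, 0) - x0))%C = 0.
Proof.
unfold wedge. rewrite Cexp_real_scale, Rmult_0_r, Cexp_imag, cos_0, sin_0.
set (r := exp _). unfold slope. creal. ring.
Qed.

Lemma wedge_top x0 c k0 k1 t : Im (slope k1 * (wedge x0 c k0 k1 (t, 1) - x0))%C = 0.
Proof.
unfold wedge. rewrite Cexp_real_scale, Rmult_1_r.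
set (r := exp _). eapply eq_trans; [|exact (slope_turn k1 k0 (c * r))]. f_equal. rewrite RtoC_mult. ring.
Qed.

Lemma slope_diff k0 (u v x0 : C) : Im (slope k0 * (u - x0))%C = 0 -> Im (slope k0 * (v - x0))%C = 0 ->
  Im (slope k0 * (u - v))%C = 0.
Proof.
intros h1 h2. replace (slope k0 * (u - v))%C with (slope k0 * (u - x0) - slope k0 * (v - x0))%C by ring.
unfold Cminus at 1. rewrite im_plus, im_opp. lra.
Qed.

(** * Strip-like ends *)

Section Ends.
Variables (a b p : idx -> R) (eps : R) (W : C -> C) (z4 d : R).
Hypothesis hdisc : disc a b p eps W z4.
Hypothesis meet : forall i, a i * p i + b i = a (next i) * p i + b (next i).
Hypothesis hd : 0 < d <= 1 / 2.
Hypothesis hz : 0 < z4 <= 1 / 4.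
Let x (i : idx) : C := (p i, eps * (a i * p i + b i)).
Let E (i : idx) (z : C) : C := phi_end i z4 d z.

Lemma end_coords i t s : E i (t, s) =
  match i with
  | i1 => (1 + d * exp (PI * t) * cos (PI * s), d * exp (PI * t) * sin (PI * s))
  | i2 => (- (/ d * exp (- (PI * t)) * cos (PI * s)), / d * exp (- (PI * t)) * sin (PI * s))
  | i3 => (z4 * (d * exp (PI * t) * cos (PI * s)), z4 * (d * exp (PI * t) * sin (PI * s)))
  | i4 => (z4 * (1 + d * exp (PI * t) * cos (PI * s)), z4 * (d * exp (PI * t) * sin (PI * s)))
  end.
Proof.
assert (h0 : RtoC z4 <> 0%C) by (intros e; apply RtoC_inj in e; lra).
assert (X : Cexp (RtoC PI * (t, s))%C = (exp (PI * t) * cos (PI * s), exp (PI * t) * sin (PI * s))).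
{ rewrite Cexp_real_scale, Cexp_imag. ceq; ring. }
assert (Y : Cexp (- (RtoC PI * (t, s)))%C = (exp (- (PI * t)) * cos (PI * s), - (exp (- (PI * t)) * sin (PI * s)))).
{ replace (- (RtoC PI * (t, s)))%C with (RtoC (- PI) * (t, s))%C by (ceq; ring).
  rewrite Cexp_real_scale, Cexp_imag.
  replace (- PI * s) with (- (PI * s)) by ring. rewrite cos_neg, sin_neg.
  replace (- PI * t) with (- (PI * t)) by ring. ceq; ring. }
unfold E. destruct i; cbn [phi_end].
- unfold phi. rewrite X. ceq; ring.
- unfold phi_infty. rewrite Y. ceq; ring.
- unfold psi_inv, phi, psi. rewrite X. replace (RtoC 0 / RtoC z4)%C with (RtoC 0) by (field; auto). ceq; ring.
- unfold psi_inv, phi, psi. rewrite X. replace (RtoC z4 / RtoC z4)%C with (RtoC 1) by (field; auto). ceq; ring.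
Qed.

Lemma hol_end i z : hol (E i) z.
Proof.
assert (e1 : hol (fun z => Cexp (RtoC PI * z)) z).
{ apply (hol_comp Cexp); [apply hol_Cexp | apply hol_scal, hol_id]. }
assert (e2 : hol (fun z => Cexp (- (RtoC PI * z))) z).
{ apply (hol_comp Cexp); [apply hol_Cexp | apply hol_opp, hol_scal, hol_id]. }
destruct i; unfold E; cbn [phi_end]; unfold psi_inv, phi, phi_infty.
- apply hol_plus; [apply hol_const | apply hol_scal, e1].
- apply hol_opp, hol_scal, e2.
- apply hol_scal, hol_plus; [apply hol_const | apply hol_scal, e1].
- apply hol_scal, hol_plus; [apply hol_const | apply hol_scal, e1].
Qed.

Lemma exp_le_1 t : t <= 0 -> 0 < exp (PI * t) <= 1.
Proof.
intros ht. split; [apply exp_pos|]. rewrite <- exp_0. pose proof PI_RGT_0.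
destruct (Rle_lt_or_eq_dec (PI * t) 0) as [h | ->]; [nra | left; now apply exp_increasing | lra].
Qed.

Lemma end_upper i t s : 0 < s < 1 -> 0 < Im (E i (t, s)).
Proof.
intros hs. pose proof PI_RGT_0. rewrite end_coords.
assert (0 < sin (PI * s)) by (apply sin_gt_0; nra).
pose proof (exp_pos (PI * t)). pose proof (exp_pos (- (PI * t))).
assert (0 < / d) by (apply Rinv_0_lt_compat; lra).
destruct i; cbn; repeat apply Rmult_lt_0_compat; lra.
Qed.

Lemma end_upper_closed i t s : 0 <= s <= 1 -> 0 <= Im (E i (t, s)).
Proof.
intros hs. pose proof PI_RGT_0. rewrite end_coords.
assert (0 <= sin (PI * s)) by (apply sin_ge_0; nra).
pose proof (exp_pos (PI * t)). pose proof (exp_pos (- (PI * t))).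
assert (0 < / d) by (apply Rinv_0_lt_compat; lra).
destruct i; cbn; repeat apply Rmult_le_pos; lra.
Qed.

Lemma two_le_inv_d : 2 <= / d.
Proof. rewrite <- (Rinv_inv 2). apply Rinv_le_contravar; lra. Qed.

Lemma end_bottom i t : t <= 0 -> exists u, E i (t, 0) = RtoC u /\ arc z4 (next i) u.
Proof.
intros ht. rewrite end_coords, Rmult_0_r, cos_0, sin_0. pose proof (exp_le_1 t ht) as he. pose proof two_le_inv_d.
assert (h : 0 < d * exp (PI * t) <= 1 / 2) by nra.
pose proof (exp_pos (- (PI * t))).
destruct i; cbn [next arc].
- exists (1 + d * exp (PI * t)). split; [ceq; ring | lra].
- exists (- (/ d * exp (- (PI * t)))). split; [ceq; ring | nra].
- exists (z4 * (d * exp (PI * t))). split; [ceq; ring | nra].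
- exists (z4 * (1 + d * exp (PI * t))). split; [ceq; ring | nra].
Qed.

Lemma end_top i t : t <= 0 -> exists u, E i (t, 1) = RtoC u /\ arc z4 i u.
Proof.
intros ht. rewrite end_coords, Rmult_1_r, cos_PI, sin_PI. pose proof (exp_le_1 t ht) as he. pose proof two_le_inv_d.
assert (h : 0 < d * exp (PI * t) <= 1 / 2) by nra.
assert (1 <= exp (- (PI * t))) by (rewrite exp_Ropp, <- Rinv_1; apply Rinv_le_contravar; lra).
destruct i; cbn [next arc].
- exists (1 - d * exp (PI * t)). split; [ceq; ring | lra].
- exists (/ d * exp (- (PI * t))). split; [ceq; ring | nra].
- exists (- (z4 * (d * exp (PI * t)))). split; [ceq; ring | nra].
- exists (z4 * (1 - d * exp (PI * t))). split; [ceq; ring | nra].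
Qed.

Lemma Cmod_pair_scale r s : Cmod (r * cos s, r * sin s) = Rabs r.
Proof.
replace (r * cos s, r * sin s) with (RtoC r * Cexp (0, s))%C by (rewrite Cexp_imag; ceq; ring).
rewrite Cmod_mult, Cmod_R, Cmod_Cexp. cbn. rewrite exp_0. ring.
Qed.

Lemma Cmod_end i t s :
  match i with
  | i1 => Cmod (E i (t, s) - RtoC 1) = d * exp (PI * t)
  | i2 => Cmod (E i (t, s)) = / d * exp (- (PI * t))
  | i3 => Cmod (E i (t, s) - RtoC 0) = z4 * d * exp (PI * t)
  | i4 => Cmod (E i (t, s) - RtoC z4) = z4 * d * exp (PI * t)
  end.
Proof.
pose proof (exp_pos (PI * t)). pose proof (exp_pos (- (PI * t))). pose proof two_le_inv_d.
pose proof (end_coords i t s) as h. destruct i; rewrite h.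
- replace (_ - _)%C with (d * exp (PI * t) * cos (PI * s), d * exp (PI * t) * sin (PI * s)) by (ceq; ring).
  rewrite Cmod_pair_scale. apply Rabs_right. left. apply Rmult_lt_0_compat; lra.
- replace (- (/ d * exp (- (PI * t)) * cos (PI * s)), / d * exp (- (PI * t)) * sin (PI * s))
    with (- (/ d * exp (- (PI * t)) * cos (- (PI * s)), / d * exp (- (PI * t)) * sin (- (PI * s)))%R)%C
    by (rewrite cos_neg, sin_neg; ceq; ring).
  rewrite Cmod_opp, Cmod_pair_scale. apply Rabs_right. left. apply Rmult_lt_0_compat; lra.
- replace (_ - _)%C with (z4 * d * exp (PI * t) * cos (PI * s), z4 * d * exp (PI * t) * sin (PI * s)) by (ceq; ring).
  rewrite Cmod_pair_scale. apply Rabs_right. left. repeat apply Rmult_lt_0_compat; lra.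
- replace (_ - _)%C with (z4 * d * exp (PI * t) * cos (PI * s), z4 * d * exp (PI * t) * sin (PI * s)) by (ceq; ring).
  rewrite Cmod_pair_scale. apply Rabs_right. left. repeat apply Rmult_lt_0_compat; lra.
Qed.

Lemma exp_small e : 0 < e -> exists T, T <= 0 /\ forall t, t <= T -> exp (PI * t) < e.
Proof.
intros he. pose proof PI_RGT_0.
exists (Rmin 0 ((ln e - 1) / PI)). split; [apply Rmin_l|].
intros t ht. pose proof (Rmin_r 0 ((ln e - 1) / PI)).
rewrite <- (exp_ln e) at 1 by auto. apply exp_increasing.
assert (PI * t <= PI * ((ln e - 1) / PI)) by (apply Rmult_le_compat_l; lra).
replace (PI * ((ln e - 1) / PI)) with (ln e - 1) in H1 by (field; lra). lra.
Qed.

Lemma vertex_limit i e : 0 < e ->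
  exists T, forall t s, t <= T -> 0 <= s <= 1 -> Cmod (W (E i (t, s)) - x i) <= e.
Proof.
intros he.
assert (fin : forall v, (W (RtoC v) = x i) -> 
  (forall t s, t <= 0 -> Cmod (E i (t, s) - RtoC v) <= exp (PI * t)) ->
  exists T, forall t s, t <= T -> 0 <= s <= 1 -> Cmod (W (E i (t, s)) - x i) <= e).
{ intros v hv hE.
  destruct (proj1 (continuous_Cmod_eps W (RtoC v)) (disc_cont hdisc _) e he) as [q [hq Hq]].
  destruct (exp_small q hq) as [T [hT HT]]. exists T. intros t s ht hs.
  rewrite <- hv. left. apply Hq. specialize (HT t ht). specialize (hE t s ltac:(lra)). lra. }
assert (pe : forall t, 0 < exp (PI * t)) by (intros; apply exp_pos).
assert (zd : 0 < z4 * d <= 1) by nra.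
destruct i eqn:Ei.
- apply (fin 1); [apply (disc_v1 hdisc)|].
  intros t s _. rewrite (Cmod_end i1). specialize (pe t). nra.
- destruct (disc_v2 hdisc e he) as [M HM].
  set (M' := Rmax 1 M). assert (hM' : 1 <= M' /\ M <= M') by (split; [apply Rmax_l | apply Rmax_r]).
  destruct (exp_small (/ M')) as [T [hT HT]]; [apply Rinv_0_lt_compat; lra|].
  exists T. intros t s ht hs. left. apply HM; [now apply end_upper_closed|].
  rewrite (Cmod_end i2). specialize (HT t ht). rewrite exp_Ropp.
  assert (M' < / exp (PI * t)).
  { rewrite <- (Rinv_inv M'). apply Rinv_lt_contravar; auto.
    apply Rmult_lt_0_compat; [auto | apply Rinv_0_lt_compat; lra]. }
  pose proof two_le_inv_d. nra.
- apply (fin 0); [apply (disc_v3 hdisc)|].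
  intros t s _. rewrite (Cmod_end i3). specialize (pe t). nra.
- apply (fin z4); [apply (disc_v4 hdisc)|].
  intros t s _. rewrite (Cmod_end i4). specialize (pe t). nra.
Qed.

Lemma lin_vertex i : lin a b eps i (x i) = 0 /\ lin a b eps (next i) (x i) = 0.
Proof. unfold lin, x. cbn. split; [ring|]. rewrite (meet i). ring. Qed.

(** The comparison map has to tend to the vertex at the left end of the strip. If the angle is
    positive every c will do; at a vertex of index zero it is negative, and only the constant map
    with c = 0 remains. *)
Lemma end_bound i c B : c = 0 \/ 0 < atan (eps * a i) - atan (eps * a (next i)) ->
  let W0 := wedge (x i) c (eps * a (next i)) (eps * a i) in
  (forall s, 0 <= s <= 1 -> Cmod (W (E i (0, s)) - W0 (0, s)) <= B) ->
  forall t s, t <= 0 -> 0 <= s <= 1 -> Cmod (W (E i (t, s)) - W0 (t, s)) <= B.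
Proof.
intros hc W0 hB.
apply (half_strip_max (fun z => W (E i z) - W0 z)%C (slope (eps * a (next i))) (slope (eps * a i)));
  auto using slope_neq_0.
- intros z. apply continuous_Cminus; [|apply hol_continuous, hol_wedge].
  apply (continuous_comp (E i) W); [apply hol_continuous, hol_end | apply (disc_cont hdisc)].
- intros [t s] hs. cbn in hs. apply hol_minus; [|apply hol_wedge].
  apply (hol_comp W (E i)); [|apply hol_end]. apply (disc_hol hdisc). now apply end_upper.
- intros t ht. apply slope_diff with (x i); [|apply wedge_bottom].
  apply Im_slope_lin with b; [|apply lin_vertex].
  destruct (end_bottom i t ht) as [u [-> hu]]. now apply (disc_arc hdisc).
- intros t ht. apply slope_diff with (x i); [|apply wedge_top].
  apply Im_slope_lin with b; [|apply lin_vertex].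
  destruct (end_top i t ht) as [u [-> hu]]. now apply (disc_arc hdisc).
- intros e he. destruct (vertex_limit i (e / 2)) as [T HT]; [lra|].
  set (om := atan (eps * a i) - atan (eps * a (next i))) in *.
  set (A := Cmod (RtoC c * Cconj (slope (eps * a (next i))))).
  assert (hA : 0 <= A) by apply Cmod_ge_0.
  assert (LW : exists T', forall t s, t <= T' -> Cmod (W0 (t, s) - x i) <= e / 2).
  { assert (EW : forall t s, Cmod (W0 (t, s) - x i) = A * exp (om * t)).
    { intros t s. unfold W0, wedge. fold om.
      replace (x i + RtoC c * Cconj (slope (eps * a (next i))) * Cexp (RtoC om * (t, s)) - x i)%C
        with (RtoC c * Cconj (slope (eps * a (next i))) * Cexp (RtoC om * (t, s)))%C by ring.
      rewrite Cmod_mult. fold A. rewrite Cmod_Cexp. f_equal. f_equal. creal. ring. }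
    destruct hc as [-> | hom].
    - exists 0. intros t s _. rewrite EW. unfold A. rewrite Cmod_mult, Cmod_0. lra.
    - set (q := e / (2 * (A + 1))). assert (hq : 0 < q) by (apply Rdiv_lt_0_compat; lra).
      exists (ln q / om). intros t s ht. rewrite EW.
      assert (exp (om * t) <= q).
      { rewrite <- (exp_ln q) by auto.
        assert (om * t <= ln q).
        { replace (ln q) with (om * (ln q / om)) by (field; lra). apply Rmult_le_compat_l; lra. }
        destruct H as [H | ->]; [left; now apply exp_increasing | lra]. }
      apply Rle_trans with ((A + 1) * q).
      + apply Rmult_le_compat; try lra. left; apply exp_pos.
      + right. unfold q. field. lra. }
  destruct LW as [T' HT']. exists (Rmin T T'). intros t s ht hs.
  pose proof (Rmin_l T T'). pose proof (Rmin_r T T').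
  apply Rle_trans with (1 := Cmod_triangle_minus _ (x i) _).
  rewrite (Cmod_minus_sym (x i)).
  specialize (HT t s ltac:(lra) hs). specialize (HT' t s ltac:(lra)). lra.
Qed.
End Ends.

(** * The internal strip *)

(** In its applications x comes from a line of slope O(eps) and y from a rotation by O(eps), so both
    are near 1; z carries the real exponential. *)
Lemma product_close (x y z X : C) (s t : R) : 0 <= s <= 1 -> 0 <= t ->
  Cmod (x - 1) <= s -> Cmod (y - 1) <= s -> Cmod (z - X) <= t ->
  Cmod (x * y * z - X) <= 4 * t + 3 * Cmod X * s.
Proof.
intros hs ht hx hy hz.
replace (x * y * z - X)%C with ((x * y) * (z - X) + (((x - 1) * y) + (y - 1)) * X)%C by ring.
assert (hy2 : Cmod y <= 2).
{ replace y with ((y - 1) + 1)%C by ring. eapply Rle_trans; [apply Cmod_triangle|]. rewrite Cmod_1. lra. }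
assert (hx2 : Cmod x <= 2).
{ replace x with ((x - 1) + 1)%C by ring. eapply Rle_trans; [apply Cmod_triangle|]. rewrite Cmod_1. lra. }
pose proof (Cmod_ge_0 x). pose proof (Cmod_ge_0 y). pose proof (Cmod_ge_0 X). pose proof (Cmod_ge_0 (z - X)).
pose proof (Cmod_ge_0 (x - 1)).
eapply Rle_trans; [apply Cmod_triangle|]. rewrite !Cmod_mult.
apply Rplus_le_compat.
- apply Rmult_le_compat; auto; [apply Rmult_le_pos; auto|].
  replace 4 with (2 * 2) by ring. apply Rmult_le_compat; auto.
- replace (3 * Cmod X * s) with (3 * s * Cmod X) by ring. apply Rmult_le_compat_r; auto.
  eapply Rle_trans; [apply Cmod_triangle|]. rewrite Cmod_mult. nra.
Qed.

Lemma Re_minus (u v : C) : Re (u - v) = Re u - Re v.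
Proof. reflexivity. Qed.

Lemma RInt_mean_close (f : R -> R) (X t : R) : ex_RInt f 0 1 ->
  (forall s, 0 <= s <= 1 -> Rabs (f s - X) <= t) -> Rabs (RInt f 0 1 - X) <= t.
Proof.
intros ef hf. pose proof (RInt_near_const f 0 1 X t ltac:(lra) ef hf) as h.
replace (X * (1 - 0)) with X in h by ring. lra.
Qed.

Lemma slope_close k : Cmod (slope k - 1) = Rabs k /\ Cmod (Cconj (slope k) - 1) = Rabs k.
Proof.
split.
- replace (slope k - 1)%C with (RtoC (- k) * Ci)%C by (unfold slope; ceq; ring).
  rewrite Cmod_mult, Cmod_Ci, Cmod_R, Rabs_Ropp. ring.
- replace (Cconj (slope k) - 1)%C with (RtoC k * Ci)%C by (unfold slope; ceq; ring).
  rewrite Cmod_mult, Cmod_Ci, Cmod_R. ring.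
Qed.

Section Internal.
Variables (a b p : idx -> R) (eps : R) (W : C -> C) (z4 t0 t1 : R).
Hypothesis hdisc : disc a b p eps W z4.
Hypothesis ht : 0 < t0 < t1.
Hypothesis ht1 : t1 < - (1 / PI) * ln z4.
Let E (z : C) : C := phi_int z.
Let g (z : C) : C := W (E z).

Lemma phi_int_coords t s : E (t, s) = (exp (- PI * t) * cos (PI * (1 - s)), exp (- PI * t) * sin (PI * (1 - s))).
Proof. reflexivity. Qed.

Lemma hol_phi_int z : hol E z.
Proof.
apply (hol_ext (fun z => Cexp (RtoC (- PI) * z + (0, PI)))%C).
- intros [t s]. unfold E, phi_int. f_equal. ceq; ring.
- apply (hol_comp Cexp); [apply hol_Cexp|]. apply hol_plus; [apply hol_scal, hol_id | apply hol_const].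
Qed.

Lemma internal_cont z : continuous g z.
Proof.
apply (continuous_comp E W); [apply hol_continuous, hol_phi_int | apply (disc_cont hdisc)].
Qed.

Lemma internal_hol z : 0 < Im z < 1 -> hol g z.
Proof.
destruct z as [t s]; cbn. intros hs.
apply (hol_comp W E); [|apply hol_phi_int]. apply (disc_hol hdisc). rewrite phi_int_coords. cbn.
pose proof PI_RGT_0. apply Rmult_lt_0_compat; [apply exp_pos|]. apply sin_gt_0; nra.
Qed.

Lemma internal_bottom t : lin a b eps i3 (g (t, 0)) = 0.
Proof.
unfold g. rewrite phi_int_coords. replace (PI * (1 - 0)) with PI by ring. rewrite cos_PI, sin_PI.
replace (exp (- PI * t) * -1, exp (- PI * t) * 0) with (RtoC (- exp (- PI * t))) by (ceq; ring).
apply (disc_arc hdisc). cbn. pose proof (exp_pos (- PI * t)). lra.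
Qed.

Lemma internal_top t : t0 <= t <= t1 -> lin a b eps i1 (g (t, 1)) = 0.
Proof.
intros h. unfold g. rewrite phi_int_coords. replace (PI * (1 - 1)) with 0 by ring. rewrite cos_0, sin_0.
replace (exp (- PI * t) * 1, exp (- PI * t) * 0) with (RtoC (exp (- PI * t))) by (ceq; ring).
apply (disc_arc hdisc). cbn. pose proof PI_RGT_0. pose proof (disc_z4 hdisc).
split.
- rewrite <- (exp_ln z4) at 1 by lra. apply exp_increasing.
  replace (ln z4) with (- PI * (- (1 / PI) * ln z4)) by (field; lra). nra.
- rewrite <- exp_0. apply exp_increasing. nra.
Qed.

(** The point q is common to the lines L_1 and L_3. Undoing the rotation and the exponential of the
    comparison map gives a function P that is real on both sides, so its mean m is the same at both
    ends of the strip. The constant c is chosen from m and therefore fits both ends. *)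
Lemma internal_wedge (qx s K P0 P1 : R) :
  let k1 := eps * a i1 in let k3 := eps * a i3 in
  let q := (qx, eps * (a i1 * qx + b i1)) : C in
  let om := atan k1 - atan k3 in
  a i1 * qx + b i1 = a i3 * qx + b i3 ->
  0 <= s <= 1 -> 0 <= K ->
  Rabs k3 <= s -> Rabs (eps * (a i1 * qx + b i1)) <= s ->
  Rabs (/ (1 + k3 ^ 2) - 1) <= s ->
  (forall u, Rabs u <= Rabs om -> Cmod (Cexp (0, u) - 1) <= s) ->
  Rabs (P0 - qx) <= K -> Rabs (P1 - qx) <= K ->
  (forall u, 0 <= u <= 1 -> Cmod (g (t0, u) - RtoC P0) <= s) ->
  (forall u, 0 <= u <= 1 -> Cmod (g (t1, u) - RtoC P1) <= s) ->
  exists c, 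
    Rabs (c * exp (om * t0) - (P0 - qx)) <= 200 * (1 + K) * s /\
    Rabs (c * exp (om * t1) - (P1 - qx)) <= 200 * (1 + K) * s /\
    forall t u, t0 <= t <= t1 -> 0 <= u <= 1 ->
      Cmod (g (t, u) - wedge q c k3 k1 (t, u)) <= 200 * (1 + K) * s.
Proof.
intros k1 k3 q om hq hs hK hk3 hqy hinv hrot hP0 hP1 hg0 hg1.
assert (lq1 : lin a b eps i1 q = 0) by (unfold lin, q; cbn; ring).
assert (lq3 : lin a b eps i3 q = 0) by (unfold lin, q; cbn; rewrite hq; ring).
set (P := fun z => (slope k3 * (g z - q) * Cexp (RtoC (- om) * z))%C).
assert (cP : forall z, continuous P z).
{ intros z. apply continuous_Cmult.
  - apply continuous_scal_C, continuous_Cminus; [apply internal_cont | apply continuous_const].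
  - apply hol_continuous, (hol_comp Cexp); [apply hol_Cexp | apply hol_scal, hol_id]. }
assert (hP : forall z, 0 < Im z < 1 -> hol P z).
{ intros z hz. apply hol_mult.
  - apply hol_scal, hol_minus; [now apply internal_hol | apply hol_const].
  - apply (hol_comp Cexp); [apply hol_Cexp | apply hol_scal, hol_id]. }
assert (Pb : forall t, Im (P (t, 0)) = 0).
{ intros t. unfold P. rewrite Cexp_real_scale, Rmult_0_r.
  replace (Cexp (0, 0)) with (RtoC 1) by (symmetry; apply Cexp_0).
  pose proof (Im_slope_lin a b eps i3 (g (t, 0)) q (internal_bottom t) lq3) as h. fold k3 in h.
  replace (slope k3 * (g (t, 0) - q) * (RtoC (exp (- om * t)) * 1))%C with
    (RtoC (exp (- om * t)) * (slope k3 * (g (t, 0) - q)))%C by ring.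
  rewrite im_scal_l, h. ring. }
assert (Pt : forall t, t0 <= t <= t1 -> Im (P (t, 1)) = 0).
{ intros t htt. unfold P. rewrite Cexp_real_scale, Rmult_1_r.
  pose proof (Im_slope_lin a b eps i1 (g (t, 1)) q (internal_top t htt) lq1) as h. fold k1 in h.
  set (u := (g (t, 1) - q)%C) in *.
  set (r := Re (slope k1 * u)%C / (1 + k1 ^ 2)).
  assert (hk : 0 < 1 + k1 ^ 2) by (pose proof (pow2_ge_0 k1); lra).
  assert (Eu : u = (RtoC r * Cconj (slope k1))%C).
  { assert (E1 : (slope k1 * u)%C = RtoC (Re (slope k1 * u)%C)) by (apply Ceq_intro; [reflexivity | exact h]).
    replace (Re (slope k1 * u)%C) with (r * (1 + k1 ^ 2)) in E1 by (unfold r; field; lra).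
    assert (E2 : (Cconj (slope k1) * (slope k1 * u))%C = (RtoC (1 + k1 ^ 2) * u)%C) by (unfold slope; ceq; ring).
    rewrite E1 in E2.
    assert (hn : RtoC (1 + k1 ^ 2) <> 0%C) by (intros e; apply RtoC_inj in e; lra).
    replace u with (/ RtoC (1 + k1 ^ 2) * (RtoC (1 + k1 ^ 2) * u))%C by (field; auto).
    rewrite <- E2, RtoC_mult. field. auto. }
  rewrite Eu.
  eapply eq_trans; [|exact (slope_turn k3 k1 (r * exp (- om * t)))]. f_equal.
  replace (- om) with (atan k3 - atan k1) by (unfold om; ring). rewrite RtoC_mult. ring. }
set (m := RInt (fun u => Re (P (t0, u))) 0 1).
assert (Em : RInt (fun u => Re (P (t1, u))) 0 1 = m).
{ apply (strip_mean P t0 t1 0 1); try lra; auto.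
  - intros z [_ hz]; cbn in hz. apply hP; lra.
  - intros t htt. now rewrite Pb, Pt. }
assert (eP : forall t, ex_RInt (fun u => Re (P (t, u))) 0 1).
{ intros t. apply ex_RInt_cont; [lra|]. intros u _.
  apply (continuous_Re (fun u => P (t, u))), continuous_vert, cP. }
(* For the comparison map itself P is the constant [c * (1 + k3 ^ 2)], since [slope k3] meets its
   conjugate. *)
set (c := m * / (1 + k3 ^ 2)).
(* Three nested uses of [product_close] multiply the leading error [2 * s] by 4 each time, giving 8,
   32 and 128; the outer constant 200 leaves room for the rest. *)
assert (edge : forall T X, Rabs (X - qx) <= K ->
  (forall u, 0 <= u <= 1 -> Cmod (g (T, u) - RtoC X) <= s) ->
  RInt (fun u => Re (P (T, u))) 0 1 = m ->
  Rabs (c * exp (om * T) - (X - qx)) <= 32 * s + 15 * K * s /\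
  (forall u, 0 <= u <= 1 -> Cmod (g (T, u) - wedge q c k3 k1 (T, u)) <= 200 * (1 + K) * s)).
{ intros T X hX hgT hm.
  assert (rot : forall u, 0 <= u <= 1 -> Rabs (- om * u) <= Rabs om /\ Rabs (om * u) <= Rabs om).
  { intros u hu. rewrite !Rabs_mult, Rabs_Ropp, (Rabs_right u) by lra. pose proof (Rabs_pos om). split; nra. }
  assert (mX : Cmod (RtoC (X - qx)) <= K) by (now rewrite Cmod_R).
  assert (A1 : Rabs (m * exp (om * T) - (X - qx)) <= 8 * s + 3 * K * s).
  { rewrite <- hm, Rmult_comm.
    replace (exp (om * T) * RInt (fun u => Re (P (T, u))) 0 1) with
      (RInt (fun u => exp (om * T) * Re (P (T, u))) 0 1).
    2:{ apply (RInt_scal (V := R_CompleteNormedModule)), eP. }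
    apply RInt_mean_close; [apply (ex_RInt_scal (V := R_NormedModule)), eP|].
    intros u hu.
    replace (exp (om * T) * Re (P (T, u)) - (X - qx)) with
      (Re (slope k3 * Cexp (0, (- om * u)%R) * (g (T, u) - q) - RtoC (X - qx))%C).
    2:{ unfold P. rewrite Cexp_real_scale.
        replace (exp (om * T) * Re (slope k3 * (g (T, u) - q) * (exp (- om * T)%R * Cexp (0, (- om * u)%R)))%C) with
          (exp (om * T) * exp (- om * T) * Re (slope k3 * Cexp (0, (- om * u)%R) * (g (T, u) - q))%C).
        - rewrite <- exp_plus. replace (om * T + - om * T) with 0 by ring. rewrite exp_0.
          rewrite (Re_minus _ (RtoC (X - qx))), re_RtoC. ring.
        - generalize (slope k3) (g (T, u) - q)%C (Cexp (0, (- om * u)%R)) (exp (- om * T)) (exp (om * T)).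
          intros z1 z2 z3 r1 r2. creal. ring. }
    eapply Rle_trans; [apply re_le_Cmod|].
    eapply Rle_trans; [apply (product_close _ _ _ _ s (2 * s)); auto; try lra|].
    - rewrite (proj1 (slope_close k3)). exact hk3.
    - apply hrot. now apply rot.
    - replace (g (T, u) - q - RtoC (X - qx))%C with
        ((g (T, u) - RtoC X) + RtoC (- (eps * (a i1 * qx + b i1))) * Ci)%C by (unfold q; ceq; ring).
      eapply Rle_trans; [apply Cmod_triangle|]. rewrite Cmod_mult, Cmod_Ci, Cmod_R, Rabs_Ropp.
      specialize (hgT u hu). lra.
    - nra. }
  assert (A2 : Rabs (c * exp (om * T) - (X - qx)) <= 32 * s + 15 * K * s).
  { rewrite <- Cmod_R.
    replace (RtoC (c * exp (om * T) - (X - qx))) with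
      (RtoC (/ (1 + k3 ^ 2)) * 1 * RtoC (m * exp (om * T)) - RtoC (X - qx))%C.
    2:{ unfold c. ceq; ring. }
    eapply Rle_trans; [apply (product_close _ _ _ _ s (8 * s + 3 * K * s)); auto; try nra|].
    - rewrite <- RtoC_minus, Cmod_R. exact hinv.
    - rewrite Cmod_minus_self. lra.
    - rewrite <- RtoC_minus, Cmod_R. exact A1.
    - nra. }
  split; auto.
  intros u hu.
  assert (A3 : Cmod (wedge q c k3 k1 (T, u) - q - RtoC (X - qx)) <= 128 * s + 63 * K * s).
  { unfold wedge. fold om. rewrite Cexp_real_scale.
    replace (q + RtoC c * Cconj (slope k3) * (RtoC (exp (om * T)) * Cexp (0, (om * u)%R)) - q - RtoC (X - qx))%C
      with (Cconj (slope k3) * Cexp (0, (om * u)%R) * RtoC (c * exp (om * T)) - RtoC (X - qx))%C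
      by (rewrite (RtoC_mult c); ring).
    eapply Rle_trans; [apply (product_close _ _ _ _ s (32 * s + 15 * K * s)); auto; try nra|].
    - rewrite (proj2 (slope_close k3)). exact hk3.
    - apply hrot. now apply rot.
    - rewrite <- RtoC_minus, Cmod_R. exact A2.
    - nra. }
  replace (g (T, u) - wedge q c k3 k1 (T, u))%C with
    ((g (T, u) - RtoC X) + (RtoC (- (eps * (a i1 * qx + b i1))) * Ci + - (wedge q c k3 k1 (T, u) - q - RtoC (X - qx))))%C
    by (unfold q; ceq; ring).
  eapply Rle_trans; [apply Cmod_triangle|].
  eapply Rle_trans; [apply Rplus_le_compat_l, Cmod_triangle|].
  rewrite Cmod_opp, Cmod_mult, Cmod_Ci, Cmod_R, Rabs_Ropp. specialize (hgT u hu).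
  assert (0 <= K * s) by (apply Rmult_le_pos; lra). lra. }
destruct (edge t0 P0 hP0 hg0 eq_refl) as [e0 f0].
destruct (edge t1 P1 hP1 hg1 Em) as [e1 f1].
assert (0 <= K * s) by (apply Rmult_le_pos; lra).
exists c. repeat split; try lra.
apply (strip_max (fun z => g z - wedge q c k3 k1 z)%C (slope k3) (slope k1) t0 t1); auto using slope_neq_0; try lra.
- intros z. apply continuous_Cminus; [apply internal_cont | apply hol_continuous, hol_wedge].
- intros z hz. apply hol_minus; [now apply internal_hol | apply hol_wedge].
- intros t htt. apply slope_diff with q; [|apply wedge_bottom].
  apply Im_slope_lin with b; auto. apply internal_bottom.
- intros t htt. apply slope_diff with q; [|apply wedge_top].
  apply Im_slope_lin with b; auto. now apply internal_top.
Qed.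

(** Parallel lines have no common point to rotate about, and the comparison map becomes affine.
    After the rotation [Im g] is constant on each side; the two constants differ by
    [eps * (b i1 - b i3)], which is what the linear term removes. *)
Lemma internal_parallel (s P0 P1 : R) : a i1 = a i3 ->
  let P (z : C) := (slope (eps * a i3) * g z - RtoC (eps * b i3) * Ci - RtoC (eps * (b i1 - b i3)) * z)%C in
  (forall u, 0 <= u <= 1 -> Cmod (P (t0, u) - RtoC (P0 - eps * (b i1 - b i3) * t0)) <= s) ->
  (forall u, 0 <= u <= 1 -> Cmod (P (t1, u) - RtoC (P1 - eps * (b i1 - b i3) * t1)) <= s) ->
  forall t u, t0 <= t <= t1 -> 0 <= u <= 1 ->
    Cmod (P (t, u) - RtoC (P0 - eps * (b i1 - b i3) * t0)) <= 3 * s.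
Proof.
intros ha P h0 h1.
assert (cP : forall z, continuous P z).
{ intros z. apply continuous_Cminus; [apply continuous_Cminus; [|apply continuous_const]|].
  - apply continuous_scal_C, internal_cont.
  - apply continuous_scal_C, continuous_id. }
assert (hP : forall z, 0 < Im z < 1 -> hol P z).
{ intros z hz. apply hol_minus; [apply hol_minus; [|apply hol_const]|].
  - now apply hol_scal, internal_hol.
  - apply hol_scal, hol_id. }
assert (Pb : forall t, Im (P (t, 0)) = 0).
{ intros t. pose proof (internal_bottom t) as h. unfold lin in h. unfold P. destruct (g (t, 0)) as [x y].
  unfold slope. creal. lra. }
assert (Pt : forall t, t0 <= t <= t1 -> Im (P (t, 1)) = 0).
{ intros t htt. pose proof (internal_top t htt) as h. unfold lin in h. unfold P. destruct (g (t, 1)) as [x y].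
  unfold slope. creal. rewrite ha in h. lra. }
set (m := RInt (fun u => Re (P (t0, u))) 0 1).
assert (Em : RInt (fun u => Re (P (t1, u))) 0 1 = m).
{ apply (strip_mean P t0 t1 0 1); try lra; auto.
  - intros z [_ hz]; cbn in hz. apply hP; lra.
  - intros t htt. now rewrite Pb, Pt. }
assert (edge : forall T X, (forall u, 0 <= u <= 1 -> Cmod (P (T, u) - RtoC X) <= s) ->
  RInt (fun u => Re (P (T, u))) 0 1 = m ->
  Rabs (m - X) <= s /\ forall u, 0 <= u <= 1 -> Cmod (P (T, u) - RtoC m) <= 2 * s).
{ intros T X hX hm.
  assert (A : Rabs (m - X) <= s).
  { rewrite <- hm. apply RInt_mean_close.
    - apply ex_RInt_cont; [lra|]. intros u _.
      apply (continuous_Re (fun u => P (T, u))), continuous_vert, cP.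
    - intros u hu. eapply Rle_trans; [|exact (hX u hu)].
      eapply Rle_trans; [|apply re_le_Cmod]. right. f_equal. }
  split; auto. intros u hu.
  apply Rle_trans with (1 := Cmod_triangle_minus _ (RtoC X) _).
  rewrite <- RtoC_minus, Cmod_R, Rabs_minus_sym. specialize (hX u hu). lra. }
destruct (edge t0 _ h0 eq_refl) as [e0 f0]. destruct (edge t1 _ h1 Em) as [e1 f1].
intros t u htt hu.
apply Rle_trans with (1 := Cmod_triangle_minus _ (RtoC m) _).
rewrite <- RtoC_minus, Cmod_R.
enough (Cmod (P (t, u) - RtoC m) <= 2 * s) by lra.
revert t u htt hu.
apply (strip_max (fun z => P z - RtoC m)%C 1 1 t0 t1); auto; try lra.
- intros e. apply RtoC_inj in e. lra.
- intros e. apply RtoC_inj in e. lra.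
- intros z. apply continuous_Cminus; [apply cP | apply continuous_const].
- intros z hz. apply hol_minus; [now apply hP | apply hol_const].
- intros t htt. rewrite Cmult_1_l. unfold Cminus. rewrite im_plus, im_opp, Pb. cbn. ring.
- intros t htt. rewrite Cmult_1_l. unfold Cminus. rewrite im_plus, im_opp, Pt by auto. cbn. ring.
Qed.
End Internal.

(** * Gradient trees of quadratic functions *)

Lemma quadratic_derive g a b x : is_quadratic g a b -> is_derive g x (a * x + b).
Proof.
intros [c hc]. apply (is_derive_ext (fun x => a / 2 * x ^ 2 + b * x + c)).
- intros t. symmetry. apply hc.
- auto_derive; auto. field.
Qed.

Lemma fdiff_Derive f a b i j x : (forall i, is_quadratic (f i) (a i) (b i)) ->
  Derive (fdiff f i j) x = (a i - a j) * x + (b i - b j).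
Proof.
intros hq. apply is_derive_unique. unfold fdiff.
replace ((a i - a j) * x + (b i - b j)) with (minus (a i * x + b i) (a j * x + b j))
  by (unfold minus, plus, opp; cbn; ring).
apply (is_derive_minus (V := R_NormedModule)); apply quadratic_derive, hq.
Qed.

Lemma fdiff_Derive2 f a b i j x : (forall i, is_quadratic (f i) (a i) (b i)) ->
  Derive_n (fdiff f i j) 2 x = a i - a j.
Proof.
intros hq. cbn. rewrite (Derive_ext _ (fun x => (a i - a j) * x + (b i - b j))).
- apply is_derive_unique. auto_derive; auto. ring.
- intros t. now apply fdiff_Derive.
Qed.

Lemma derive_in_eps D I t l : is_derive_in D I t l -> forall e, 0 < e -> exists d, 0 < d /\
  forall y, D y -> Rabs (y - t) < d -> Rabs (I y - I t - l * (y - t)) <= e * Rabs (y - t).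
Proof.
intros [_ h] e he.
assert (hl : is_filter_lim (within D (locally t)) t).
{ intros P hP. unfold within. revert hP. apply filter_imp. auto. }
destruct (h t hl (mkposreal _ he)) as [d Hd].
exists d. split; [apply cond_pos|]. intros y hy hd. specialize (Hd y hd hy).
unfold norm, minus, plus, opp, scal in Hd; cbn in Hd. unfold mult, abs in Hd; cbn in Hd.
replace (I y - I t - l * (y - t)) with (I y + - I t + - ((y + - t) * l)) by ring. exact Hd.
Qed.

(** Stops a function at the ends of [[u, v]]. The solution is differentiable only relative to its
    domain; the stopped function is continuous on all of R, and the mean value theorem applies to
    it. *)
Definition clip (u v t : R) : R := Rmax u (Rmin v t).

Lemma clip_id u v t : u <= t <= v -> clip u v t = t.
Proof. intros h. unfold clip. rewrite Rmin_right, Rmax_right; lra. Qed.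
Lemma clip_in u v t : u <= v -> u <= clip u v t <= v.
Proof. intros h. unfold clip, Rmax, Rmin. repeat destruct Rle_dec; lra. Qed.
Lemma clip_lip u v s t : u <= v -> Rabs (clip u v s - clip u v t) <= Rabs (s - t).
Proof. intros h. unfold clip, Rmax, Rmin, Rabs. repeat destruct Rle_dec; repeat destruct Rcase_abs; lra. Qed.

Section Flow.
Variables (D : R -> Prop) (I : R -> R) (al be u v : R).
Hypothesis huv : u < v.
Hypothesis hD : forall t, u <= t <= v -> D t.
Hypothesis hI : forall t, D t -> is_derive_in D I t (- (al * I t + be)).
Let J t := I (clip u v t).

Lemma clip_cont t : continuous J t.
Proof.
apply continuity_pt_filterlim. intros e he.
set (c := clip u v t).
assert (hc : u <= c <= v) by (apply clip_in; lra).
destruct (derive_in_eps _ _ _ _ (hI c (hD c hc)) 1 ltac:(lra)) as [d [hd Hd]].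
set (L := Rabs (- (al * I c + be)) + 1).
assert (hL : 0 < L) by (unfold L; pose proof (Rabs_pos (- (al * I c + be))); lra).
exists (Rmin d (e / L)). split; [apply Rmin_pos; auto; now apply Rdiv_lt_0_compat|].
intros s [_ hs]. cbn in hs |- *. unfold Rdist in *. unfold J. fold c.
pose proof (Rmin_l d (e / L)). pose proof (Rmin_r d (e / L)).
pose proof (clip_lip u v s t ltac:(lra)) as k. fold c in k.
assert (hin : u <= clip u v s <= v) by (apply clip_in; lra).
specialize (Hd _ (hD _ hin) ltac:(lra)).
set (y := clip u v s) in *. set (l := - (al * I c + be)) in *.
replace (I y - I c) with ((I y - I c - l * (y - c)) + l * (y - c)) by ring.
apply Rle_lt_trans with (1 := Rabs_triang _ _). rewrite (Rabs_mult l).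
apply Rle_lt_trans with (L * Rabs (y - c)); [unfold L; lra|].
apply Rlt_le_trans with (L * (e / L)); [apply Rmult_lt_compat_l; lra|]. right. field. lra.
Qed.

Lemma clip_derive t : u < t < v -> is_derive J t (- (al * J t + be)).
Proof.
intros ht. apply is_derive_Reals. intros e he.
destruct (derive_in_eps _ _ _ _ (hI t (hD t ltac:(lra))) (e / 2) ltac:(lra)) as [d [hd Hd]].
set (m := Rmin d (Rmin (t - u) (v - t))).
assert (hm : 0 < m /\ m <= d /\ m <= t - u /\ m <= v - t) by (unfold m; minmax).
exists (mkposreal m (proj1 hm)). intros h hn hh. cbn in hh.
pose proof hh as hh'. apply Rabs_def2 in hh'.
unfold J. rewrite !clip_id by lra.
assert (hy : D (t + h)) by (apply hD; lra).
specialize (Hd (t + h) hy). replace (t + h - t) with h in Hd by ring. specialize (Hd ltac:(lra)).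
set (l := - (al * I t + be)) in *.
replace ((I (t + h) - I t) / h - l) with ((I (t + h) - I t - l * h) * / h) by (field; auto).
rewrite Rabs_mult, Rabs_inv. pose proof (Rabs_pos_lt h hn).
apply Rle_lt_trans with (e / 2 * Rabs h * / Rabs h).
- apply Rmult_le_compat_r; auto. left; now apply Rinv_0_lt_compat.
- rewrite Rmult_assoc, Rinv_r by lra. lra.
Qed.

(** [(al * I + be) * exp (al * t)] has derivative zero along the flow. *)
Lemma flow_exp : al <> 0 -> (al * I v + be) * exp (al * v) = (al * I u + be) * exp (al * u).
Proof.
intros ha.
destruct (MVT_gen (fun t => (al * J t + be) * exp (al * t)) u v (fun _ => 0)) as [c [_ Hc]].
- intros t. rewrite Rmin_left, Rmax_right by lra. intros ht.
  pose proof (clip_derive t ht) as d1.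
  replace 0 with ((al * (- (al * J t + be)) * exp (al * t) + (al * J t + be) * (al * exp (al * t)))) by ring.
  auto_derive.
  + now exists (- (al * J t + be)).
  + change (Derive (fun x => J x) t) with (Derive J t). rewrite (is_derive_unique _ _ _ d1). ring.
- intros t _. apply continuity_pt_filterlim, (continuous_Rmult (fun t => al * J t + be) (fun t => exp (al * t))).
  + apply continuous_Rplus; [|apply continuous_const].
    apply continuous_Rmult; [apply continuous_const | apply clip_cont].
  + apply (continuous_Rfun exp (fun t => al * t)); [intros; apply continuous_exp|].
    apply continuous_Rmult; [apply continuous_const | apply continuous_id].
- unfold J in Hc. rewrite !clip_id in Hc by lra. lra.
Qed.

Lemma flow_lin : al = 0 -> I v + be * v = I u + be * u.
Proof.
intros ha.
destruct (MVT_gen (fun t => J t + be * t) u v (fun _ => 0)) as [c [_ Hc]].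
- intros t. rewrite Rmin_left, Rmax_right by lra. intros ht.
  pose proof (clip_derive t ht) as d1. rewrite ha in d1.
  auto_derive.
  + now exists (- (0 * J t + be)).
  + change (Derive (fun x => J x) t) with (Derive J t). rewrite (is_derive_unique _ _ _ d1). ring.
- intros t _. apply continuity_pt_filterlim, (continuous_Rplus J (fun t => be * t)); [apply clip_cont|].
  apply continuous_Rmult; [apply continuous_const | apply continuous_id].
- unfold J in Hc. rewrite !clip_id in Hc by lra. lra.
Qed.

(** A solution of a scalar linear equation is monotone in the direction of its initial velocity.
    This rules out trees of shape c. *)
Lemma flow_direction : 0 <= (I v - I u) * (- (al * I u + be)).
Proof.
destruct (Req_dec al 0) as [e | n].
- pose proof (flow_lin e) as h. rewrite e. replace (I v - I u) with (- be * (v - u)) by lra.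
  replace (- be * (v - u) * - (0 * I u + be)) with (be * be * (v - u)) by ring.
  apply Rmult_le_pos; [apply Rle_0_sqr | lra].
- pose proof (flow_exp n) as h.
  set (Y := al * I u + be) in *.
  assert (E : al * (I v - I u) = Y * (exp (al * (u - v)) - 1)).
  { replace (al * (I v - I u)) with ((al * I v + be) - Y) by (unfold Y; ring).
    apply Rmult_eq_reg_r with (exp (al * v)); [|apply Rgt_not_eq, exp_pos].
    rewrite Rmult_minus_distr_r, h.
    replace (al * (u - v)) with (al * u + - (al * v)) by ring. rewrite exp_plus, exp_Ropp.
    field. apply Rgt_not_eq, exp_pos. }
  assert (S : 0 <= al * (1 - exp (al * (u - v)))).
  { destruct (Rlt_dec 0 al).
    - apply Rmult_le_pos; [lra|]. assert (exp (al * (u - v)) < 1); [|lra].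
      rewrite <- exp_0. apply exp_increasing. nra.
    - assert (1 < exp (al * (u - v))); [|nra].
      rewrite <- exp_0. apply exp_increasing. nra. }
  apply pos_mult_l with (al ^ 2); [apply pow2_gt_0; auto|].
  replace (al ^ 2 * ((I v - I u) * - Y)) with (al * (al * (I v - I u)) * - Y) by ring.
  rewrite E. replace (al * (Y * (exp (al * (u - v)) - 1)) * - Y) with (Y * Y * (al * (1 - exp (al * (u - v))))) by ring.
  apply Rmult_le_pos; [apply Rle_0_sqr | auto].
Qed.
End Flow.

Section External.
Variables (I : R -> R) (al be q : R).
Hypothesis ha : al <> 0.
Hypothesis hq : al * q + be = 0.
Hypothesis hI : forall t, t <= 0 -> is_derive_in (fun t => t <= 0) I t (- (al * I t + be)).
Hypothesis hlim : is_lim I m_infty q.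

Lemma external_exp t : t <= 0 -> I t = q + (I 0 - q) * exp (- al * t).
Proof.
intros ht. destruct (Rle_lt_or_eq_dec t 0 ht) as [h | ->].
2:{ rewrite Rmult_0_r, exp_0. ring. }
pose proof (flow_exp (fun t => t <= 0) I al be t 0 h ltac:(intros; lra) hI ha) as E.
rewrite Rmult_0_r, exp_0 in E.
replace be with (- al * q) in E by lra.
apply Rmult_eq_reg_l with (al * exp (al * t)).
2:{ apply Rmult_integral_contrapositive. split; auto. apply Rgt_not_eq, exp_pos. }
replace (- al * t) with (- (al * t)) by ring. rewrite exp_Ropp.
pose proof (exp_pos (al * t)).
replace (al * exp (al * t) * (q + (I 0 - q) * / exp (al * t))) with
  (al * exp (al * t) * q + al * (I 0 - q)) by (field; lra). lra.
Qed.

(** At a critical point of index zero the flow is attracting, so backwards in time every other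
    solution moves away from q and cannot have it as limit. *)
Lemma external_stable_const : 0 < al -> forall t, t <= 0 -> I t = q.
Proof.
intros hal.
assert (E0 : I 0 = q).
{ apply NNPP. intros N.
  assert (hp : 0 < Rabs (I 0 - q)) by (apply Rabs_pos_lt; lra).
  apply is_lim_spec in hlim. destruct (hlim (mkposreal _ hp)) as [M HM]. cbn in HM.
  set (t := Rmin (M - 1) 0). assert (ht : t <= M - 1 /\ t <= 0) by (split; [apply Rmin_l | apply Rmin_r]).
  specialize (HM t ltac:(lra)). rewrite (external_exp t (proj2 ht)) in HM.
  replace (q + (I 0 - q) * exp (- al * t) - q) with ((I 0 - q) * exp (- al * t)) in HM by ring.
  rewrite Rabs_mult, (Rabs_right (exp _)) in HM by (left; apply exp_pos).
  assert (1 <= exp (- al * t)).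
  { rewrite <- exp_0. destruct (Rle_lt_or_eq_dec 0 (- al * t)) as [h | <-]; [nra | left; now apply exp_increasing | lra]. }
  nra. }
intros t ht. rewrite external_exp by auto. rewrite E0. ring.
Qed.
End External.

Lemma exp_diff_le (u v : R) : v <= u -> 0 <= exp u - exp v <= exp u * (u - v).
Proof.
intros h. split.
- destruct h as [h | ->]; [pose proof (exp_increasing _ _ h); lra | lra].
- pose proof (exp_ineq1_le (v - u)) as k. pose proof (exp_pos u).
  replace (exp v) with (exp u * exp (v - u)) by (rewrite <- exp_plus; f_equal; ring). nra.
Qed.

(** Uniform on a whole half line: the decay of exp absorbs the factor [Rabs x] in the difference of
    the exponents. It is used with r the quotient of eps (u - v) by the true angle. *)
Lemma exp_ratio_close (L e : R) : 0 < e -> exists d, 0 < d /\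
  forall x r, x <= L -> Rabs (r - 1) <= d -> Rabs (exp (r * x) - exp x) <= e.
Proof.
intros he.
set (L' := Rmax L 0). assert (hL : L <= L' /\ 0 <= L') by (split; [apply Rmax_l | apply Rmax_r]).
(* A bound for [exp w * Rabs x]: for x <= 0 one has w <= x / 2, and exp(x / 2) times the modulus of
   x is at most 2; for 0 < x <= L' one has w <= 2 L'. *)
set (K := 2 + L' * exp (2 * L')).
assert (hK : 2 <= K) by (unfold K; pose proof (exp_pos (2 * L')); nra).
exists (Rmin (1 / 2) (e / K)).
assert (hek : 0 < e / K) by (apply Rdiv_lt_0_compat; lra).
split; [apply Rmin_pos; lra|].
intros x r hx hr.
pose proof (Rle_trans _ _ _ hr (Rmin_l _ _)) as r1. pose proof (Rle_trans _ _ _ hr (Rmin_r _ _)) as r2.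
pose proof (Rabs_pos (r - 1)) as rp.
apply Rabs_le_between in r1.
set (w := Rmax (r * x) x).
assert (A : Rabs (exp (r * x) - exp x) <= exp w * (Rabs (r - 1) * Rabs x)).
{ rewrite <- Rabs_mult. replace ((r - 1) * x) with (r * x - x) by ring.
  unfold w, Rmax. destruct (Rle_dec (r * x) x) as [h | h].
  - rewrite Rabs_minus_sym, (Rabs_minus_sym (r * x)). pose proof (exp_diff_le _ _ h). rewrite !Rabs_right; lra.
  - pose proof (exp_diff_le (r * x) x ltac:(lra)). rewrite !Rabs_right; lra. }
assert (B : exp w * Rabs x <= K).
{ destruct (Rle_dec x 0) as [h | h].
  - assert (hw : w <= x / 2) by (unfold w; apply Rmax_lub; nra).
    assert (exp w <= exp (x / 2)) by (destruct hw as [hw | ->]; [left; now apply exp_increasing | lra]).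
    rewrite Rabs_left1 by auto.
    pose proof (exp_ineq1_le (- (x / 2))) as k. pose proof (exp_pos (x / 2)).
    assert (E : exp (x / 2) * exp (- (x / 2)) = 1) by (rewrite <- exp_plus, Rplus_opp_r; apply exp_0).
    assert (exp (x / 2) * - x <= 2) by nra. nra.
  - assert (hw : w <= 2 * L') by (unfold w; apply Rmax_lub; nra).
    assert (exp w <= exp (2 * L')) by (destruct hw as [hw | ->]; [left; now apply exp_increasing | lra]).
    rewrite Rabs_right by lra. pose proof (exp_pos w). unfold K. nra. }
apply Rle_trans with (1 := A).
replace (exp w * (Rabs (r - 1) * Rabs x)) with (Rabs (r - 1) * (exp w * Rabs x)) by ring.
apply Rle_trans with (e / K * K).
- apply Rmult_le_compat; auto. apply Rmult_le_pos; [left; apply exp_pos | apply Rabs_pos].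
- right. field. lra.
Qed.

(** * Configuration of the critical points *)

Section Signs.
Variables (a b p : idx -> R) (k k' : idx).
Hypothesis meet : forall i, a i * p i + b i = a (next i) * p i + b (next i).
Hypothesis cvx : forall i, 0 < (p (next i) - p i) * (p i - p (prev i)) * (a (next i) - a i).
Hypothesis hk : k = i1 \/ k = i2.
Hypothesis hk' : k' = i3 \/ k' = i4.
Hypothesis ak : a k < a (next k).
Hypothesis ak' : a k' < a (next k').
Hypothesis cross : 0 < (p i3 - p i1) * (p i4 - p i2).

Lemma pos_mult_sign (u v : R) : 0 < u * v -> 0 < u /\ 0 < v \/ u < 0 /\ v < 0.
Proof. intros h. destruct (Rtotal_order u 0) as [l | [e | g]]; [right | subst; lra | left]; split; auto; nra. Qed.

(** By convexity the index has a geometric meaning: it is zero exactly when the two edges at the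
    vertex run in the same horizontal direction. *)
Lemma edge_signs i : 
  0 < (p (next i) - p i) * (p i - p (prev i)) /\ a i < a (next i) \/
  (p (next i) - p i) * (p i - p (prev i)) < 0 /\ a (next i) < a i.
Proof. destruct (pos_mult_sign _ _ (cvx i)); [left | right]; lra. Qed.

Lemma flat_edges i : a i < a (next i) -> 0 < (p (next i) - p i) * (p i - p (prev i)).
Proof. intros h. destruct (edge_signs i); lra. Qed.

Lemma neg_mult_sign (u v : R) : u * v < 0 -> 0 < u /\ v < 0 \/ u < 0 /\ 0 < v.
Proof. intros h. destruct (pos_mult_sign u (- v)); [nra | left | right]; lra. Qed.

Ltac signs :=
  pose proof (edge_signs i1) as s1; pose proof (edge_signs i2) as s2;
  pose proof (edge_signs i3) as s3; pose proof (edge_signs i4) as s4;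
  pose proof (meet i1) as m1; pose proof (meet i2) as m2;
  pose proof (meet i3) as m3; pose proof (meet i4) as m4;
  destruct hk as [-> | ->], hk' as [-> | ->]; cbn [next prev] in *;
  destruct s1 as [[s1 d1] | [s1 d1]], s2 as [[s2 d2] | [s2 d2]],
    s3 as [[s3 d3] | [s3 d3]], s4 as [[s4 d4] | [s4 d4]]; try lra;
  repeat match goal with
  | H : 0 < _ * _ |- _ => apply pos_mult_sign in H
  | H : _ * _ < 0 |- _ => apply neg_mult_sign in H
  end.

Lemma other_index : (forall i, i = i1 \/ i = i2 -> i <> k -> a (next i) < a i) /\
  (forall i, i = i3 \/ i = i4 -> i <> k' -> a (next i) < a i).
Proof.
signs; split; intros i [-> | ->] ni; cbn; try lra; try (exfalso; apply ni; reflexivity);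
exfalso; lra.
Qed.

(** Once the directions of the edges are fixed by the indices, the crossing condition decides the
    order of the abscissas. The sign o tells on which side p_3 and p_4 lie; the gap g later forces
    z4 to 0 and separates the two flat vertices. *)
Lemma sides_gap : exists o g, (o = 1 \/ o = - (1)) /\ 0 < g /\
  forall i j, i = i1 \/ i = i2 -> j = i3 \/ j = i4 -> g <= o * (p j - p i).
Proof.
assert (H : (0 < p i3 - p i1 /\ 0 < p i4 - p i2 /\ 0 < p i4 - p i1 /\ 0 < p i3 - p i2) \/
  (p i3 - p i1 < 0 /\ p i4 - p i2 < 0 /\ p i4 - p i1 < 0 /\ p i3 - p i2 < 0)).
{ signs; lra. }
set (m := Rmin (Rmin (Rabs (p i3 - p i1)) (Rabs (p i4 - p i2))) (Rmin (Rabs (p i4 - p i1)) (Rabs (p i3 - p i2)))).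
assert (hm : m <= Rabs (p i3 - p i1) /\ m <= Rabs (p i4 - p i2) /\ m <= Rabs (p i4 - p i1) /\ m <= Rabs (p i3 - p i2)) by (unfold m; minmax).
assert (m0 : 0 < m) by (unfold m; repeat apply Rmin_pos; apply Rabs_pos_lt; lra).
destruct H as [H | H]; [exists 1, m | exists (- (1)), m]; (split; [auto | split; [auto|]]);
clearbody m; intros i j [-> | ->] [-> | ->];
[rewrite !Rabs_right in hm by lra | rewrite !Rabs_right in hm by lra | rewrite !Rabs_right in hm by lra |
 rewrite !Rabs_right in hm by lra | rewrite !Rabs_left in hm by lra | rewrite !Rabs_left in hm by lra |
 rewrite !Rabs_left in hm by lra | rewrite !Rabs_left in hm by lra]; lra.
Qed.

(* A tree of shape c would have to flow against the direction of -(f_4 - f_2)'. *)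
Lemma no_shape_c_flow : 
  (k = i1 -> k' = i3 -> (p i1 - p i3) * (- ((a i4 - a i2) * p i3 + (b i4 - b i2))) < 0) /\
  (k = i2 -> k' = i4 -> (p i4 - p i2) * (- ((a i4 - a i2) * p i2 + (b i4 - b i2))) < 0).
Proof.
destruct sides_gap as [o [g [ho [hg H]]]].
destruct other_index as [o1 o2].
pose proof (H i1 i3 (or_introl eq_refl) (or_introl eq_refl)).
pose proof (H i2 i3 (or_intror eq_refl) (or_introl eq_refl)).
pose proof (H i2 i4 (or_intror eq_refl) (or_intror eq_refl)).
pose proof (meet i2) as m2. pose proof (meet i3) as m3. cbn in m2, m3.
split; intros ek ek'; subst k k'.
- assert (h : a i3 < a i2) by (apply (o1 i2); auto; discriminate).
  replace (- ((a i4 - a i2) * p i3 + (b i4 - b i2))) with ((a i2 - a i3) * (p i3 - p i2)) by lra.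
  replace ((p i1 - p i3) * ((a i2 - a i3) * (p i3 - p i2))) with (- ((a i2 - a i3) * ((p i3 - p i1) * (p i3 - p i2)))) by ring.
  assert (0 < (p i3 - p i1) * (p i3 - p i2)) by (destruct ho as [-> | ->]; nra).
  assert (0 < (a i2 - a i3) * ((p i3 - p i1) * (p i3 - p i2))) by (apply Rmult_lt_0_compat; lra). lra.
- assert (h : a i4 < a i3) by (apply (o2 i3); auto; discriminate).
  replace (- ((a i4 - a i2) * p i2 + (b i4 - b i2))) with (- ((a i3 - a i4) * (p i3 - p i2))) by lra.
  replace ((p i4 - p i2) * - ((a i3 - a i4) * (p i3 - p i2))) with (- ((a i3 - a i4) * ((p i4 - p i2) * (p i3 - p i2)))) by ring.
  assert (0 < (p i4 - p i2) * (p i3 - p i2)) by (destruct ho as [-> | ->]; nra).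
  assert (0 < (a i3 - a i4) * ((p i4 - p i2) * (p i3 - p i2))) by (apply Rmult_lt_0_compat; lra). lra.
Qed.

End Signs.

(** * Uniform estimates *)

(** Multiplied by eps, it bounds [Im W] and every [lin a b eps j] along the map. *)
Definition lin_const (a b p : idx -> R) : R :=
  abs_sum (fun i => a i * p i + b i) + abs_sum a * abs_sum p + abs_sum b.

Lemma abs_le_abs_sum q i : Rabs (q i) <= abs_sum q.
Proof.
unfold abs_sum. pose proof (Rabs_pos (q i1)). pose proof (Rabs_pos (q i2)).
pose proof (Rabs_pos (q i3)). pose proof (Rabs_pos (q i4)). destruct i; lra.
Qed.

Lemma abs_sum_ge_0 q : 0 <= abs_sum q.
Proof. apply Rle_trans with (1 := Rabs_pos (q i1)), abs_le_abs_sum. Qed.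

Lemma lin_const_ge_0 a b p : 0 <= lin_const a b p.
Proof.
unfold lin_const. pose proof (abs_sum_ge_0 (fun i => a i * p i + b i)). pose proof (abs_sum_ge_0 a).
pose proof (abs_sum_ge_0 b). pose proof (abs_sum_ge_0 p). pose proof (Rmult_le_pos _ _ H0 H2). lra.
Qed.

Definition vertex (z4 v : R) : Prop := v = 0 \/ v = z4 \/ v = 1.

Definition osc_const (a b p : idx -> R) (d : R) : R :=
  200 * lin_const a b p / d ^ 2 * (PI + Rabs (ln d)).

Lemma osc_const_ge_0 a b p d : 0 < d -> 0 <= osc_const a b p d.
Proof.
intros hd. unfold osc_const. pose proof (lin_const_ge_0 a b p). pose proof PI_RGT_0. pose proof (Rabs_pos (ln d)).
apply Rmult_le_pos; [|lra]. apply Rmult_le_pos; [lra|]. left. apply Rinv_0_lt_compat, pow_lt, hd.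
Qed.

Lemma D_main_intro d z : 0 < d -> 0 <= Im z -> d <= Cmod z <= / d -> d <= Cmod (z - RtoC 1) ->
  D_main d z.
Proof.
intros hd h1 h2 h3. split; auto. intros [[_ h] | [[_ h] | [_ [_ h]]]].
- replace (z - RtoC 0)%C with z in h by ring. lra.
- lra.
- assert (/ / d <= / Cmod z) by (apply Rinv_le_contravar; lra). rewrite Rinv_inv in H. lra.
Qed.

Lemma D_main_real d t : 0 < d <= 1 / 2 -> t = 2 \/ t = 1 / 2 \/ t = - (1) -> D_main d (RtoC t).
Proof.
intros hd ht.
assert (2 <= / d) by (rewrite <- (Rinv_inv 2); apply Rinv_le_contravar; lra).
apply D_main_intro; [lra | cbn; lra | |]; rewrite <- ?RtoC_minus, !Cmod_R;
destruct ht as [-> | [-> | ->]]; unfold Rabs; destruct Rcase_abs; lra.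
Qed.

Section Estimates.
Variables (a b p : idx -> R) (eps : R) (W : C -> C) (z4 : R).
Hypothesis eps0 : 0 < eps.
Hypothesis hdisc : disc a b p eps W z4.
Let K := lin_const a b p.

Lemma Im_W_le z : Rabs (Im (W z)) <= eps * K.
Proof.
apply Rle_trans with (1 := disc_Im hdisc z). apply Rmult_le_compat_l; [lra|].
unfold K, lin_const. pose proof (abs_sum_ge_0 a). pose proof (abs_sum_ge_0 b). pose proof (abs_sum_ge_0 p).
pose proof (Rmult_le_pos _ _ H H1). lra.
Qed.

Lemma disc_lined : lined W (vertex z4) (eps * K).
Proof.
intros x0 x1 h01 hv. pose proof (disc_z4 hdisc) as hz.
assert (ha : exists j, forall t, x0 <= t <= x1 -> arc z4 j t).
{ destruct (hv 0) as [v0 | v0]; [now left| |].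
  - destruct (hv z4) as [v4 | v4]; [right; now left| |].
    + destruct (hv 1) as [v1 | v1]; [right; now right| |].
      * exists i2. cbn. intros; lra.
      * exists i1. cbn. intros; lra.
    + exists i4. cbn. intros; lra.
  - exists i3. cbn. intros; lra. }
destruct ha as [j hj]. exists (eps * a j), (eps * b j).
assert (E : forall u, Im ((1 - RtoC (eps * a j) * Ci) * u)%C - eps * b j = lin a b eps j u).
{ intros u. unfold lin. destruct u as [u v]. creal. ring. }
split.
- intros z. rewrite E. unfold lin.
  pose proof (disc_Re hdisc z) as h1. pose proof (disc_Im hdisc z) as h2.
  set (u := Re (W z)) in *. set (v := Im (W z)) in *.
  unfold Rminus. eapply Rle_trans; [apply Rabs_triang|]. rewrite Rabs_Ropp, Rabs_mult, (Rabs_right eps) by lra.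
  pose proof (Rabs_triang (a j * u) (b j)) as h3. rewrite Rabs_mult in h3.
  pose proof (abs_le_abs_sum a j). pose proof (abs_le_abs_sum b j).
  assert (Rabs (a j) * Rabs u <= abs_sum a * abs_sum p) by (apply Rmult_le_compat; auto using Rabs_pos).
  unfold K, lin_const. rewrite 2!Rmult_plus_distr_l. 
  assert (eps * Rabs (a j * u + b j) <= eps * (abs_sum a * abs_sum p + abs_sum b)) by (apply Rmult_le_compat_l; lra).
  rewrite Rmult_plus_distr_l in H2. lra.
- intros t ht. apply Rminus_diag_uniq. rewrite E. apply (disc_arc hdisc). auto.
Qed.

(** The two scales at once: in the coordinate z / m the vertices are 0, z4, 1 for m = 1 and 0, 1, 1
    / z4 for m = z4. Either way the additional vertex is close to 0 or far away. *)
Lemma scaled_oscillation d m : 0 < d <= 1 / 2 -> z4 <= d / 2 -> m = 1 \/ m = z4 ->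
  forall z, D_main d z -> 
    Cmod (W (RtoC m * z) - W (RtoC m * Ci)) <= eps * osc_const a b p d.
Proof.
intros hd hz hm z hD. pose proof (disc_z4 hdisc) as z4p.
assert (m0 : 0 < m) by (destruct hm; lra).
replace (eps * osc_const a b p d) with (200 * (eps * K) / d ^ 2 * (PI + Rabs (ln d)))
  by (unfold osc_const, K; field; lra).
apply (oscillation (fun z => W (RtoC m * z)%C) (fun v => vertex z4 (m * v))); auto.
- intros u. apply (continuous_comp (fun z => (RtoC m * z)%C) W).
  + apply hol_continuous, hol_scal, hol_id.
  + apply (disc_cont hdisc).
- intros u hu. apply (hol_comp W); [|apply hol_scal, hol_id].
  apply (disc_hol hdisc). rewrite im_scal_l. now apply Rmult_lt_0_compat.
- intros u. apply Im_W_le.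
- intros x0 x1 h01 hv.
  destruct (disc_lined (m * x0) (m * x1)) as [s [mu [h1 h2]]].
  + apply Rmult_le_compat_l; lra.
  + intros v hvv. destruct (hv (v / m)) as [h | h].
    * replace (m * (v / m)) with v by (field; lra). exact hvv.
    * left. replace v with (m * (v / m)) by (field; lra). now apply Rmult_lt_compat_l.
    * right. replace v with (m * (v / m)) by (field; lra). now apply Rmult_lt_compat_l.
  + exists s, mu. split; [intros u; apply h1|].
    intros t ht. rewrite <- RtoC_mult. apply h2. split; apply Rmult_le_compat_l; lra.
- intros v [hv | [hv | hv]].
  + left. apply Rmult_integral in hv. destruct hv as [hv | ->]; [lra|]. rewrite Rabs_R0. lra.
  + destruct hm as [-> | ->].
    * left. rewrite Rmult_1_l in hv. subst v. rewrite Rabs_right; lra.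
    * right; left. apply Rmult_eq_reg_l with z4; lra.
  + destruct hm as [-> | ->]; [right; left; lra|]. right; right.
    apply Rmult_le_reg_l with z4; [lra|]. rewrite hv.
    apply Rmult_le_reg_r with d; [lra|]. replace (z4 * (2 / d) * d) with (2 * z4) by (field; lra). lra.
Qed.

(* Both edges at a flat vertex are traversed in the same horizontal direction, so that the
   vertex is squeezed between the values on the two adjacent arcs. *)
Lemma flat_value i t t' e : 0 < (p (next i) - p i) * (p i - p (prev i)) ->
  arc z4 i t -> arc z4 (next i) t' -> Cmod (W (RtoC t) - W (RtoC t')) <= e ->
  Rabs (Re (W (RtoC t)) - p i) <= e.
Proof.
intros hf h1 h2 he.
destruct (disc_range hdisc i t h1) as [_ r1].
destruct (disc_range hdisc (next i) t' h2) as [r2 _].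
replace (prev (next i)) with i in r2 by now destruct i.
pose proof (Rle_trans _ _ _ (re_le_Cmod _) he) as h. rewrite Re_minus in h.
apply Rabs_le_between in h.
set (u := Re (W (RtoC t))) in *. set (v := Re (W (RtoC t'))) in *.
set (e1 := p (next i) - p i) in *. set (e2 := p i - p (prev i)) in *.
destruct (pos_mult_sign _ _ hf) as [[g1 g2] | [g1 g2]]; apply Rabs_le; nra.
Qed.

(** The test points t and t' lie on the two arcs adjacent to the flat vertex i. The map oscillates
    by at most twice the bound of [scaled_oscillation]; this is spent once in locating the vertex
    and once for z, and K accounts for the imaginary part. *)
Lemma main_region d m i t t' : 0 < d <= 1 / 2 -> z4 <= d / 2 -> m = 1 \/ m = z4 ->
  0 < (p (next i) - p i) * (p i - p (prev i)) ->
  D_main d (RtoC t) -> D_main d (RtoC t') -> arc z4 i (m * t) -> arc z4 (next i) (m * t') ->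
  forall z, D_main d z ->
    Cmod (W (RtoC m * z) - RtoC (p i)) <= eps * (4 * osc_const a b p d + K).
Proof.
intros hd hz hm hf d1 d2 h1 h2 z hD.
set (B := eps * osc_const a b p d).
assert (two : forall u v, D_main d u -> D_main d v -> Cmod (W (RtoC m * u) - W (RtoC m * v)) <= 2 * B).
{ intros u v hu hv. pose proof (scaled_oscillation d m hd hz hm u hu) as k1.
  pose proof (scaled_oscillation d m hd hz hm v hv) as k2. fold B in k1, k2.
  apply Rle_trans with (1 := Cmod_triangle_minus _ (W (RtoC m * Ci)) _).
  rewrite (Cmod_minus_sym (W (RtoC m * Ci))). lra. }
pose proof (two _ _ d1 d2) as k. rewrite <- !RtoC_mult in k.
pose proof (flat_value i _ _ _ hf h1 h2 k) as k1.
pose proof (two _ _ hD d1) as k2. rewrite <- RtoC_mult in k2.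
apply Rle_trans with (1 := Cmod_triangle_minus _ (W (RtoC (m * t))) _).
pose proof (Cmod_le_abs (W (RtoC (m * t)) - RtoC (p i))) as k3.
rewrite Re_minus, re_RtoC in k3.
replace (Im (W (RtoC (m * t)) - RtoC (p i))%C) with (Im (W (RtoC (m * t)))) in k3 by (creal; ring).
pose proof (Im_W_le (RtoC (m * t))) as k4.
replace (eps * (4 * osc_const a b p d + K)) with (4 * B + eps * K) by (unfold B; ring). lra.
Qed.

(** If z4 were at least c, the half circle of radius 1 - c / 2 about 1 would join the arc from 0 to
    z4 with the arc from 1 to infinity at distance at least c / 2 from all vertices. Its image would
    have length O(eps), while the edges x3 x4 and x1 x2 are at horizontal distance at least g. *)
Lemma z4_small c o g : 0 < c <= 1 / 2 -> o = 1 \/ o = - (1) ->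
  (forall i j, i = i1 \/ i = i2 -> j = i3 \/ j = i4 -> g <= o * (p j - p i)) ->
  p i1 <> p i2 -> p i3 <> p i4 ->
  eps * (200 * K / c * PI) < g -> z4 < c.
Proof.
intros hc ho hg n12 n34 hlt. apply Rnot_le_lt. intros hz.
pose proof (disc_z4 hdisc) as z4p. pose proof PI_RGT_0 as hpi.
assert (hK : 0 <= K) by apply lin_const_ge_0.
set (r := 1 - c / 2).
set (G := fun z => W (polar (RtoC 1) r z)).
assert (B : Cmod (G (0, PI) - G (0, 0)) <= 100 * (eps * K) / (c / 2) * r * Cmod ((0, PI) - (0, 0))).
{ apply segment_bound.
  - apply Rmult_le_pos; [|unfold r; lra]. apply Rmult_le_pos; [|left; apply Rinv_0_lt_compat; lra].
    pose proof (Rmult_le_pos eps K ltac:(lra) hK). lra.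
  - intros t _. apply continuous_polar_fun, (disc_cont hdisc).
  - intros t ht.
    replace ((0, 0) + RtoC t * ((0, PI) - (0, 0)))%C with ((0, t * PI) : C) by (ceq; ring).
    set (u := t * PI). assert (hu : 0 < u < PI) by (unfold u; nra).
    assert (Ep : polar (RtoC 1) r (0, u) = circ (RtoC 1) r u) by (rewrite polar_circ, exp_0; f_equal; ring).
    assert (hs : 0 < sin u) by (apply sin_gt_0; lra).
    destruct (derivative_bound W (vertex z4) (eps * K) (c / 2) (circ (RtoC 1) r u)) as [l [hl Hl]].
    + lra.
    + apply (disc_cont hdisc).
    + apply (disc_hol hdisc).
    + apply Im_W_le.
    + apply disc_lined.
    + rewrite circ_im. cbn. unfold r. nra.
    + assert (hr1 : Cmod (circ (RtoC 1) r u - RtoC 1) = r) by (rewrite Cmod_circ, Rabs_right; unfold r; lra).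
      assert (far : forall v, Rabs (1 - v) <= 1 - c \/ v = 0 -> c / 2 <= Cmod (circ (RtoC 1) r u - RtoC v)).
      { intros v hv. 
        assert (T := Cmod_triangle_minus (circ (RtoC 1) r u) (RtoC v) (RtoC 1)).
        assert (T' := Cmod_triangle_minus (RtoC 1) (circ (RtoC 1) r u) (RtoC v)).
        rewrite (Cmod_minus_sym (RtoC 1) (circ (RtoC 1) r u)), hr1, <- RtoC_minus, Cmod_R in T'.
        rewrite hr1, <- RtoC_minus, Cmod_R in T.
        rewrite Rabs_minus_sym in T. assert (er : r = 1 - c / 2) by reflexivity.
        destruct hv as [hv | ->]; [lra|]. rewrite Rminus_0_r, Rabs_R1 in T'. lra. }
      intros v [-> | [-> | ->]]; apply far.
      * now right.
      * left. rewrite Rabs_right; lra.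
      * left. rewrite Rminus_diag, Rabs_R0. lra.
    + exists (l * (RtoC r * Cexp (0, u)))%C. split.
      * apply (cder_comp W (polar (RtoC 1) r)); [now rewrite Ep|].
        eapply cder_eq; [apply cder_plus; [apply cder_const | apply cder_mult; [apply cder_const | apply cder_Cexp]]|].
        cbn beta. ring.
      * rewrite !Cmod_mult, Cmod_R, Cmod_Cexp. cbn. rewrite exp_0, (Rabs_right r) by (unfold r; lra).
        rewrite Rmult_1_r. apply Rmult_le_compat_r; [unfold r; lra | exact Hl]. }
assert (E1 : G (0, PI) = W (RtoC (c / 2))).
{ unfold G. f_equal. rewrite polar_circ, exp_0. apply Ceq_intro.
  - rewrite circ_re, cos_PI. cbn. unfold r. lra.
  - rewrite circ_im, sin_PI. cbn. lra. }
assert (E2 : G (0, 0) = W (RtoC (1 + r))).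
{ unfold G. f_equal. rewrite polar_circ, exp_0. apply Ceq_intro.
  - rewrite circ_re, cos_0. cbn. lra.
  - rewrite circ_im, sin_0. cbn. lra. }
assert (E3 : Cmod ((0, PI) - (0, 0)) = PI).
{ replace ((0, PI) - (0, 0))%C with (RtoC PI * Ci)%C by (ceq; ring).
  rewrite Cmod_mult, Cmod_Ci, Cmod_R, Rabs_right; lra. }
rewrite E1, E2, E3 in B.
assert (B' : 100 * (eps * K) / (c / 2) * r * PI <= eps * (200 * K / c * PI)).
{ replace (eps * (200 * K / c * PI)) with (100 * (eps * K) / (c / 2) * 1 * PI) by (field; lra).
  apply Rmult_le_compat_r; [lra|]. apply Rmult_le_compat_l; [|unfold r; lra].
  apply Rmult_le_pos; [|left; apply Rinv_0_lt_compat; lra].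
  pose proof (Rmult_le_pos eps K ltac:(lra) hK). lra. }
destruct (disc_range hdisc i4 (c / 2)) as [r1 r2]; [cbn; lra|].
destruct (disc_range hdisc i2 (1 + r)) as [r3 r4]; [cbn; unfold r; lra|].
cbn [prev] in r1, r2, r3, r4.
assert (Hd : Rabs (Re (W (RtoC (c / 2))) - Re (W (RtoC (1 + r)))) < g).
{ rewrite <- Re_minus. eapply Rle_lt_trans; [apply re_le_Cmod|]. lra. }
set (u := Re (W (RtoC (c / 2)))) in *. set (v := Re (W (RtoC (1 + r)))) in *.
apply Rabs_def2 in Hd.
pose proof (hg i1 i3 (or_introl eq_refl) (or_introl eq_refl)).
pose proof (hg i2 i3 (or_intror eq_refl) (or_introl eq_refl)).
pose proof (hg i1 i4 (or_introl eq_refl) (or_intror eq_refl)).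
pose proof (hg i2 i4 (or_intror eq_refl) (or_intror eq_refl)).
assert (between : forall x y s, 0 <= (y - x) * (s - x) -> 0 <= (y - x) * (y - s) ->
  x <> y -> x <= s <= y \/ y <= s <= x).
{ intros x y s q1 q2 q3. destruct (Rtotal_order x y) as [l | [e | l]]; [left | lra | right]; split; nra. }
destruct (between _ _ _ r1 r2 n34), (between _ _ _ r3 r4 n12), ho as [-> | ->]; lra.
Qed.
End Estimates.

(** * Limits as eps tends to 0 *)

Lemma ev_intro (P : R -> Prop) e0 : 0 < e0 -> (forall e, 0 < e < e0 -> P e) -> at_right 0 P.
Proof.
intros h H. exists (mkposreal _ h). intros e he hp. apply H.
unfold ball in he; cbn in he. unfold AbsRing_ball, abs, minus, plus, opp in he; cbn in he.
apply Rabs_def2 in he. lra.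
Qed.

Lemma ev_small C s : 0 <= C -> 0 < s -> at_right 0 (fun e => 0 < e /\ e * C <= s).
Proof.
intros hC hs. apply (ev_intro _ (s / (C + 1))); [apply Rdiv_lt_0_compat; lra|].
intros e he. split; [lra|].
apply Rle_trans with (s / (C + 1) * (C + 1)).
- apply Rmult_le_compat; lra.
- right. field. lra.
Qed.

(** The region must be shown to be nonempty: the supremum over the empty set is minus infinity,
    which does not tend to 0. *)
Lemma tends_to_0_intro (A : Type) (S : R -> A -> Prop) (G : R -> A -> R) :
  (forall eta, 0 < eta -> at_right 0 (fun e => (exists x, S e x) /\ forall x, S e x -> 0 <= G e x <= eta)) ->
  tends_to_0 (fun e => sup_on (S e) (G e)).
Proof.
intros H eta. assert (h2 : 0 < eta / 2) by (pose proof (cond_pos eta); lra).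
generalize (H (eta / 2) h2). apply filter_imp. intros e [[x hx] hS].
unfold sup_on. set (E := fun r => exists s, S e s /\ r = G e s).
destruct (Lub_Rbar_correct E) as [ub lub].
split.
- apply Rbar_lt_le_trans with (G e x).
  + cbn. destruct (hS x hx). pose proof (cond_pos eta). lra.
  + apply ub. exists x. auto.
- apply Rbar_le_lt_trans with (eta / 2).
  + apply lub. intros r [y [hy ->]]. cbn. apply hS, hy.
  + cbn. lra.
Qed.

(** The first order expansion at eps = 0 of the angle between two lines; through it the difference
    of the Hessians becomes the rate of the exponential. *)
Lemma ev_angle u v e : 0 < e ->
  at_right 0 (fun t => Rabs (atan (t * u) - atan (t * v) - t * (u - v)) <= e * t).
Proof.
intros he.
assert (D : is_derive (fun t => atan (t * u) - atan (t * v)) 0 (u - v)).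
{ auto_derive; auto. rewrite !Rmult_0_l. field. }
destruct (derivable_eps _ _ _ D e he) as [d [hd Hd]].
apply (ev_intro _ d hd). intros t ht.
specialize (Hd t ltac:(rewrite Rabs_right; lra)).
rewrite Rplus_0_l, !Rmult_0_l, atan_0, (Rabs_right t) in Hd by lra.
replace (atan (t * u) - atan (t * v) - t * (u - v)) with
  (atan (t * u) - atan (t * v) - (0 - 0) - (u - v) * t) by ring. exact Hd.
Qed.

Lemma ev_angle_small u v d : 0 < d ->
  at_right 0 (fun t => Rabs (atan (t * u) - atan (t * v)) <= d).
Proof.
intros hd.
generalize (filter_and _ _ (ev_angle u v 1 Rlt_0_1) (ev_small (Rabs (u - v) + 1) d ltac:(pose proof (Rabs_pos (u - v)); lra) hd)).
apply filter_imp. intros t [h1 [h2 h3]].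
replace (atan (t * u) - atan (t * v)) with ((atan (t * u) - atan (t * v) - t * (u - v)) + t * (u - v)) by ring.
eapply Rle_trans; [apply Rabs_triang|]. rewrite (Rabs_mult t), (Rabs_right t) by lra. lra.
Qed.

Lemma ev_rotation u v s : 0 < s -> at_right 0 (fun t =>
  forall r, Rabs r <= Rabs (atan (t * u) - atan (t * v)) -> Cmod (Cexp (0, r) - 1) <= s).
Proof.
intros hs.
destruct (proj1 (continuous_Cmod_eps Cexp 0) (hol_continuous _ _ (hol_Cexp 0)) s hs) as [d [hd Hd]].
generalize (ev_angle_small u v (d / 2) ltac:(lra)). apply filter_imp. intros t ht r hr.
rewrite Cexp_0 in Hd. left. apply Hd.
replace ((0, r) - 0)%C with (RtoC r * Ci)%C by (ceq; ring).
rewrite Cmod_mult, Cmod_Ci, Cmod_R. lra.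
Qed.

(** The quotient of eps (u - v) by the true angle tends to 1, so the angle has the sign of u - v and
    [exp_ratio_close] applies. Only an upper bound L on the exponent is asked for, so that t may run
    to infinity on one side. *)
Lemma ev_exp u v L s : u <> v -> 0 < s -> at_right 0 (fun e =>
  0 < (atan (e * u) - atan (e * v)) * (u - v) /\
  forall t, (atan (e * u) - atan (e * v)) * t <= L ->
    Rabs (exp (e * (u - v) * t) - exp ((atan (e * u) - atan (e * v)) * t)) <= s).
Proof.
intros huv hs. destruct (exp_ratio_close L s hs) as [d [hd Hd]].
set (g := u - v). assert (hg : 0 < Rabs g) by (apply Rabs_pos_lt; unfold g; lra).
set (e0 := Rmin (Rabs g / 2) (d * (Rabs g / 2))).
assert (he0 : 0 < e0 /\ e0 <= Rabs g / 2 /\ e0 <= d * (Rabs g / 2)).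
{ unfold e0. split; [apply Rmin_pos; [lra|]; apply Rmult_lt_0_compat; lra | split; [apply Rmin_l | apply Rmin_r]]. }
generalize (filter_and _ _ (ev_angle u v e0 (proj1 he0)) (ev_small 0 1 ltac:(lra) Rlt_0_1)).
apply filter_imp. intros e [h1 [h2 _]]. fold g in h1 |- *.
set (om := atan (e * u) - atan (e * v)) in *.
assert (h3 : Rabs (om - e * g) <= e * (Rabs g / 2)) by nra.
assert (hom : e * (Rabs g / 2) <= Rabs om).
{ pose proof (Rabs_triang (e * g - om) om) as k. replace (e * g - om + om) with (e * g) in k by ring.
  rewrite Rabs_minus_sym in h3. rewrite (Rabs_mult e), (Rabs_right e) in k by lra. lra. }
assert (heg : 0 < e * (Rabs g / 2)) by (apply Rmult_lt_0_compat; lra).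
assert (om0 : om <> 0) by (intros E; rewrite E, Rabs_R0 in hom; lra).
split.
- assert (g0 : g <> 0) by (intros E; rewrite E, Rabs_R0 in hg; lra).
  apply Rabs_le_between in h3. unfold Rabs in h3, hg. destruct (Rcase_abs g); nra.
- intros t ht.
  replace (e * g * t) with ((e * g / om) * (om * t)) by (field; auto).
  apply Hd; auto.
  replace (e * g / om - 1) with ((e * g - om) * / om) by (field; auto).
  rewrite Rabs_mult, Rabs_inv, Rabs_minus_sym.
  apply Rmult_le_reg_r with (Rabs om); [lra|].
  rewrite Rmult_assoc, Rinv_l, Rmult_1_r by lra.
  apply Rle_trans with (1 := h1). nra.
Qed.

(** * Boundary circles of the regions *)

Lemma Cexp_PI s : Cexp (RtoC PI * (0, s))%C = (cos (PI * s), sin (PI * s)).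
Proof. rewrite Cexp_real_scale, Rmult_0_r, exp_0, Cexp_imag. ceq; ring. Qed.

Lemma D_main_circle_0 d s : 0 < d <= 1 / 2 -> 0 <= s <= 1 -> D_main d (phi (RtoC 0) d (0, s)).
Proof.
intros hd hs. pose proof PI_RGT_0.
assert (2 <= / d) by (rewrite <- (Rinv_inv 2); apply Rinv_le_contravar; lra).
assert (0 <= sin (PI * s)) by (apply sin_ge_0; nra).
assert (hm : Cmod (phi (RtoC 0) d (0, s)) = d).
{ unfold phi. rewrite Cexp_PI.
  replace (RtoC 0 + RtoC d * (cos (PI * s), sin (PI * s)))%C with (d * cos (PI * s), d * sin (PI * s)) by (ceq; ring).
  rewrite Cmod_pair_scale. apply Rabs_right; lra. }
apply D_main_intro; [lra| |rewrite hm; lra|].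
- unfold phi. rewrite Cexp_PI. creal. nra.
- pose proof (Cmod_triangle_minus (RtoC 1) (phi (RtoC 0) d (0, s)) 0) as T.
  replace (RtoC 1 - 0)%C with (RtoC 1) in T by ring.
  replace (phi (RtoC 0) d (0, s) - 0)%C with (phi (RtoC 0) d (0, s)) in T by ring.
  rewrite hm, Cmod_1, Cmod_minus_sym in T. lra.
Qed.

Lemma D_main_circle_1 d s : 0 < d <= 1 / 2 -> 0 <= s <= 1 -> D_main d (phi (RtoC 1) d (0, s)).
Proof.
intros hd hs. pose proof PI_RGT_0.
assert (2 <= / d) by (rewrite <- (Rinv_inv 2); apply Rinv_le_contravar; lra).
assert (0 <= sin (PI * s)) by (apply sin_ge_0; nra).
assert (hm : Cmod (phi (RtoC 1) d (0, s) - RtoC 1) = d).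
{ unfold phi. rewrite Cexp_PI.
  replace (RtoC 1 + RtoC d * (cos (PI * s), sin (PI * s)) - RtoC 1)%C with (d * cos (PI * s), d * sin (PI * s)) by (ceq; ring).
  rewrite Cmod_pair_scale. apply Rabs_right; lra. }
set (z := phi (RtoC 1) d (0, s)) in *.
pose proof (Cmod_triangle_minus z (RtoC 1) 0) as T. pose proof (Cmod_triangle_minus (RtoC 1) z 0) as T'.
replace (z - 0)%C with z in T, T' by ring. replace (RtoC 1 - 0)%C with (RtoC 1) in T, T' by ring.
rewrite (Cmod_minus_sym (RtoC 1) z) in T'. rewrite hm, Cmod_1 in T, T'.
apply D_main_intro; [lra| |lra|lra].
unfold z, phi. rewrite Cexp_PI. creal. nra.
Qed.

Lemma D_main_circle_infty d s : 0 < d <= 1 / 2 -> 0 <= s <= 1 -> D_main d (phi_infty d (0, s)).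
Proof.
intros hd hs. pose proof PI_RGT_0.
assert (2 <= / d) by (rewrite <- (Rinv_inv 2); apply Rinv_le_contravar; lra).
assert (0 <= sin (PI * s)) by (apply sin_ge_0; nra).
assert (E : phi_infty d (0, s) = (/ d * - cos (PI * s), / d * sin (PI * s))).
{ unfold phi_infty. replace (- (RtoC PI * (0, s)))%C with (RtoC PI * (0, (- s)%R))%C by (ceq; ring).
  rewrite Cexp_PI. replace (PI * - s) with (- (PI * s)) by ring. rewrite cos_neg, sin_neg. ceq; ring. }
assert (hm : Cmod (phi_infty d (0, s)) = / d).
{ rewrite E. replace (/ d * - cos (PI * s), / d * sin (PI * s)) with
    (/ d * cos (PI - PI * s), / d * sin (PI - PI * s)).
  - rewrite Cmod_pair_scale. apply Rabs_right; lra.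
  - rewrite cos_minus, sin_minus, cos_PI, sin_PI. f_equal; ring. }
apply D_main_intro; [lra| |rewrite hm; lra|].
- rewrite E. cbn. nra.
- pose proof (Cmod_triangle_minus (phi_infty d (0, s)) (RtoC 1) 0) as T.
  replace (phi_infty d (0, s) - 0)%C with (phi_infty d (0, s)) in T by ring.
  replace (RtoC 1 - 0)%C with (RtoC 1) in T by ring. rewrite hm, Cmod_1 in T. lra.
Qed.

Lemma disjoint_half d : 0 < d -> disjoint (D_at 0 d) (D_at 1 d) -> d <= 1 / 2.
Proof.
intros hd h. apply Rnot_lt_le. intros N. apply (h (RtoC (1 / 2))).
split; (split; [unfold upper_closed; cbn; lra|]); rewrite <- RtoC_minus, Cmod_R; unfold Rabs;
destruct Rcase_abs; lra.
Qed.

(** * Convergence *)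

(* The flat vertex of the pair to which i belongs. *)
Definition side_of (k k' i : idx) : idx := match i with i1 | i2 => k | i3 | i4 => k' end.

Section Limits.
Variables (a b p : idx -> R) (W : R -> C -> C) (z4 : R -> R) (d : R) (k k' : idx).
Hypothesis hd : 0 < d <= 1 / 2.
Hypothesis meet : forall i, a i * p i + b i = a (next i) * p i + b (next i).
Hypothesis cvx : forall i, 0 < (p (next i) - p i) * (p i - p (prev i)) * (a (next i) - a i).
Hypothesis hdisc : forall e, 0 < e -> disc a b p e (W e) (z4 e).
Hypothesis hk : k = i1 \/ k = i2.
Hypothesis hk' : k' = i3 \/ k' = i4.
Hypothesis ak : a k < a (next k).
Hypothesis ak' : a k' < a (next k').
Hypothesis cross : 0 < (p i3 - p i1) * (p i4 - p i2).

Lemma p_neq i : p (next i) <> p i.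
Proof. intros E. pose proof (cvx i) as c. rewrite E in c. lra. Qed.

Lemma ev_z4 c : 0 < c -> at_right 0 (fun e => 0 < e /\ 0 < z4 e < c).
Proof.
intros hc.
destruct (sides_gap a b p k k' meet cvx hk hk' ak ak' cross) as [o [g [ho [hg H]]]].
set (c' := Rmin c (1 / 2)). assert (hc' : 0 < c' <= 1 / 2 /\ c' <= c).
{ unfold c'. split; [split; [apply Rmin_pos; lra | apply Rmin_r] | apply Rmin_l]. }
pose proof (lin_const_ge_0 a b p). pose proof PI_RGT_0.
assert (hC : 0 <= 200 * lin_const a b p / c' * PI).
{ apply Rmult_le_pos; [|lra]. apply Rmult_le_pos; [lra|]. left. apply Rinv_0_lt_compat. lra. }
generalize (ev_small _ (g / 2) hC ltac:(lra)). apply filter_imp. intros e [he h].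
split; auto. pose proof (disc_z4 (hdisc e he)). split; [lra|].
apply Rlt_le_trans with c'; [|lra].
apply (z4_small a b p e (W e) (z4 e) he (hdisc e he) c' o g); auto; [lra| | |lra].
- apply not_eq_sym, (p_neq i1).
- apply not_eq_sym, (p_neq i3).
Qed.

Let reg (eta : R) (e : R) : Prop :=
  (forall z, D_main d z -> Cmod (W e z - RtoC (p k)) <= eta) /\
  (forall z, D_main d z -> Cmod (W e (RtoC (z4 e) * z) - RtoC (p k')) <= eta).

Lemma ev_region eta : 0 < eta -> at_right 0 (reg eta).
Proof.
intros he.
set (C0 := 4 * osc_const a b p d + lin_const a b p).
assert (hC : 0 <= C0).
{ unfold C0. pose proof (osc_const_ge_0 a b p d (proj1 hd)). pose proof (lin_const_ge_0 a b p). lra. }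
generalize (filter_and _ _ (ev_small C0 eta hC he) (ev_z4 (d / 2) ltac:(lra))).
apply filter_imp. intros e [[e0 h1] [_ h2]].
assert (fk : 0 < (p (next k) - p k) * (p k - p (prev k))) by now apply (flat_edges a p cvx).
assert (fk' : 0 < (p (next k') - p k') * (p k' - p (prev k'))) by now apply (flat_edges a p cvx).
assert (R2 : D_main d (RtoC 2)) by (apply D_main_real; auto).
assert (Rh : D_main d (RtoC (1 / 2))) by (apply D_main_real; auto).
assert (Rm : D_main d (RtoC (- (1)))) by (apply D_main_real; auto).
assert (T := main_region a b p e (W e) (z4 e) e0 (hdisc e e0) d).
split; intros z hz; eapply Rle_trans; try exact h1.
- replace z with (RtoC 1 * z)%C at 1 by ring.
  (* The points 1/2 and 2 lie on either side of the parameter 1, and 2 and -1 on either side of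
     infinity. After rescaling by z4, the points -1 and 1/2 surround 0. *)
  destruct hk as [E | E]; rewrite E in *.
  + apply (T 1 i1 (1 / 2) 2); auto; try lra; cbn; lra.
  + apply (T 1 i2 2 (- (1))); auto; try lra; cbn; lra.
- destruct hk' as [E | E]; rewrite E in *.
  + apply (T (z4 e) i3 (- (1)) (1 / 2)); auto; try lra; cbn; lra.
  + apply (T (z4 e) i4 (1 / 2) 2); auto; try lra; cbn; lra.
Qed.

Let side := side_of k k'.

Lemma region_edge eta e i s : reg eta e -> 0 < z4 e -> 0 <= s <= 1 ->
  Cmod (W e (phi_end i (z4 e) d (0, s)) - RtoC (p (side i))) <= eta.
Proof.
intros [r1 r2] hz hs.
assert (h0 : RtoC (z4 e) <> 0%C) by (intros E; apply RtoC_inj in E; lra).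
destruct i; unfold side; cbn [phi_end side_of]; unfold psi_inv.
- now apply r1, D_main_circle_1.
- now apply r1, D_main_circle_infty.
- apply r2. unfold psi. replace (RtoC 0 / RtoC (z4 e))%C with (RtoC 0) by (field; auto).
  now apply D_main_circle_0.
- apply r2. unfold psi. replace (RtoC (z4 e) / RtoC (z4 e))%C with (RtoC 1) by (field; auto).
  now apply D_main_circle_1.
Qed.

Lemma side_cases i : p (side i) - p i = 0 \/ a (next i) < a i.
Proof.
destruct (other_index a b p k k' meet cvx hk hk' ak ak' cross) as [o1 o2].
assert (dec : forall x y : idx, x = y \/ x <> y) by (intros [] []; auto; right; discriminate).
unfold side; destruct i; cbn [side_of].
- destruct (dec i1 k) as [E | n]; [left; rewrite <- E; ring | right; apply o1; auto].
- destruct (dec i2 k) as [E | n]; [left; rewrite <- E; ring | right; apply o1; auto].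
- destruct (dec i3 k') as [E | n]; [left; rewrite <- E; ring | right; apply o2; auto].
- destruct (dec i4 k') as [E | n]; [left; rewrite <- E; ring | right; apply o2; auto].
Qed.

(** The displacement [p (side i) - p i] seen on the boundary circle of the main region is the
    constant of the comparison map. [end_bound] spreads the agreement on the circle over the whole
    end, and [ev_exp] then replaces the angle. At a flat vertex the displacement is 0. *)
Lemma ev_end i eta : 0 < eta -> at_right 0 (fun e => 0 < e /\
  forall t s, t <= 0 -> 0 <= s <= 1 ->
    Cmod (W e (phi_end i (z4 e) d (t, s)) -
      RtoC (p i + (p (side i) - p i) * exp (e * (a i - a (next i)) * t))) <= eta).
Proof.
intros he.
set (c := p (side i) - p i).
set (K := Rabs c). assert (hK : 0 <= K) by apply Rabs_pos.
(* The errors add up to [(3 + 10 * K) * s0], which is at most [16 * (K + 1) * s0]. *)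
set (s0 := Rmin 1 (eta / (16 * (K + 1)))).
assert (hs0 : 0 < s0 <= 1 /\ 16 * (K + 1) * s0 <= eta).
{ assert (0 < eta / (16 * (K + 1))) by (apply Rdiv_lt_0_compat; lra).
  unfold s0. split; [split; [apply Rmin_pos; lra | apply Rmin_l]|].
  apply Rle_trans with (16 * (K + 1) * (eta / (16 * (K + 1)))).
  - apply Rmult_le_compat_l; [lra | apply Rmin_r].
  - right. field. lra. }
destruct hs0 as [hs0 hse].
assert (X : at_right 0 (fun e => c = 0 \/ a (next i) < a i /\
  0 < (atan (e * a i) - atan (e * a (next i))) * (a i - a (next i)) /\
  forall t, (atan (e * a i) - atan (e * a (next i))) * t <= 0 ->
    Rabs (exp (e * (a i - a (next i)) * t) - exp ((atan (e * a i) - atan (e * a (next i))) * t)) <= s0)).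
{ destruct (side_cases i) as [h | h].
  - apply (filter_imp (fun _ => True)); [now left | apply filter_true].
  - generalize (ev_exp (a i) (a (next i)) 0 s0 ltac:(lra) (proj1 hs0)).
    apply filter_imp. intros e h'. right. split; auto. }
assert (q4 : 0 < 1 / 4) by lra.
generalize (filter_and _ _ (filter_and _ _ X (ev_rotation (a i) (a (next i)) s0 (proj1 hs0)))
  (filter_and _ _ (filter_and _ _ (ev_region s0 (proj1 hs0)) (ev_z4 (1 / 4) q4))
   (filter_and _ _ (ev_small (Rabs (a i * p i + b i)) s0 (Rabs_pos _) (proj1 hs0))
     (ev_small (Rabs (a (next i))) s0 (Rabs_pos _) (proj1 hs0))))).
apply filter_imp. clear X. intros e [[hX hrot] [[hreg [e0 hz]] [[_ hy] [_ hal]]]].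
split; auto.
set (k0 := e * a (next i)) in *. set (k1 := e * a i) in *. set (om := atan k1 - atan k0) in *.
set (y := e * (a i * p i + b i)).
assert (hy' : Rabs y <= s0) by (unfold y; rewrite Rabs_mult, (Rabs_right e); lra).
assert (hk0 : Rabs k0 <= s0) by (unfold k0; rewrite Rabs_mult, (Rabs_right e); lra).
set (x := (p i, y) : C).
set (W0 := wedge x c k0 k1).
assert (EW : forall t s, W0 (t, s) =
  (x + Cconj (slope k0) * Cexp (0, (om * s)%R) * RtoC (c * exp (om * t)))%C).
{ intros t s. unfold W0, wedge. fold om. rewrite Cexp_real_scale, RtoC_mult. ring. }
assert (rot : forall s, 0 <= s <= 1 -> Cmod (Cexp (0, om * s) - 1) <= s0).
{ intros s hs. apply hrot. rewrite Rabs_mult, (Rabs_right s) by lra. pose proof (Rabs_pos om). nra. }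
assert (hsl : Cmod (Cconj (slope k0) - 1) <= s0) by (rewrite (proj2 (slope_close k0)); exact hk0).
assert (hxp : Cmod (x - RtoC (p i)) = Rabs y).
{ replace (x - RtoC (p i))%C with (RtoC y * Ci)%C by (unfold x; ceq; ring).
  rewrite Cmod_mult, Cmod_Ci, Cmod_R. ring. }
assert (hom : c = 0 \/ 0 < om) by (destruct hX as [h | [h1 [h2 _]]]; [now left | right; nra]).
assert (EB : forall t s, t <= 0 -> 0 <= s <= 1 ->
   Cmod (W e (phi_end i (z4 e) d (t, s)) - W0 (t, s)) <= 2 * s0 + 3 * K * s0).
{ apply (end_bound a b p e (W e) (z4 e) d (hdisc e e0) meet hd ltac:(lra) i c); [exact hom|].
  fold k0 k1 y x W0. intros s hs.
  apply Rle_trans with (1 := Cmod_triangle_minus _ (RtoC (p (side i))) _).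
  pose proof (region_edge s0 e i s hreg ltac:(lra) hs) as h1.
  assert (h2 : Cmod (RtoC (p (side i)) - W0 (0, s)) <= s0 + 3 * K * s0); [|lra].
  rewrite Cmod_minus_sym, EW, Rmult_0_r, exp_0, Rmult_1_r.
  replace (x + Cconj (slope k0) * Cexp (0, (om * s)%R) * RtoC c - RtoC (p (side i)))%C with
    ((x - RtoC (p i)) + (Cconj (slope k0) * Cexp (0, (om * s)%R) * RtoC c - RtoC c))%C
    by (unfold c; rewrite RtoC_minus; ring).
  eapply Rle_trans; [apply Cmod_triangle|]. rewrite hxp.
  assert (T := product_close (Cconj (slope k0)) (Cexp (0, om * s)) (RtoC c) (RtoC c) s0 0
    ltac:(lra) ltac:(lra) hsl (rot s hs) ltac:(rewrite Cmod_minus_self; lra)).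
  rewrite Cmod_R in T. fold K in T. lra. }
intros t s ht hs.
apply Rle_trans with (1 := Cmod_triangle_minus _ (W0 (t, s)) _).
specialize (EB t s ht hs).
assert (h2 : Cmod (W0 (t, s) - RtoC (p i + c * exp (e * (a i - a (next i)) * t))) <= s0 + (4 * (K * s0) + 3 * K * s0)).
{ rewrite EW. set (r := exp (e * (a i - a (next i)) * t)).
  replace (x + Cconj (slope k0) * Cexp (0, (om * s)%R) * RtoC (c * exp (om * t)) - RtoC (p i + c * r))%C with
    ((x - RtoC (p i)) + (Cconj (slope k0) * Cexp (0, (om * s)%R) * RtoC (c * exp (om * t)) - RtoC (c * r)))%C
    by (rewrite (RtoC_plus (p i)); ring).
  eapply Rle_trans; [apply Cmod_triangle|]. rewrite hxp.
  apply Rplus_le_compat; auto.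
  assert (hcr : Cmod (RtoC (c * exp (om * t)) - RtoC (c * r)) <= K * s0).
  { rewrite <- RtoC_minus, Cmod_R. replace (c * exp (om * t) - c * r) with (c * (exp (om * t) - r)) by ring.
    rewrite Rabs_mult. fold K. destruct hX as [h | [h1 [h3 h4]]].
    - unfold K. rewrite h, Rabs_R0. lra.
    - apply Rmult_le_compat_l; auto. rewrite Rabs_minus_sym. apply h4. destruct hom; nra. }
  assert (hr : Cmod (RtoC (c * r)) <= K).
  { rewrite Cmod_R, Rabs_mult, (Rabs_right r) by (left; apply exp_pos). fold K.
    destruct hX as [h | [h1 _]].
    - unfold K. rewrite h, Rabs_R0. lra.
    - assert (r <= 1); [|nra]. unfold r. rewrite <- exp_0.
      assert (hg : 0 < e * (a i - a (next i))) by (apply Rmult_lt_0_compat; lra).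
      assert (hle : e * (a i - a (next i)) * t <= 0) by nra.
      destruct hle as [hle | ->]; [left; now apply exp_increasing | lra]. }
  pose proof (product_close (Cconj (slope k0)) (Cexp (0, om * s)) (RtoC (c * exp (om * t))) (RtoC (c * r)) s0 (K * s0)
    ltac:(lra) ltac:(apply Rmult_le_pos; lra) hsl (rot s hs) hcr) as T.
  apply Rle_trans with (1 := T).
  apply Rplus_le_compat_l. apply Rmult_le_compat_r; lra. }
assert (0 <= K * s0) by (apply Rmult_le_pos; lra). fold c. lra.
Qed.

(** * The internal strip in the limit *)

Let t0 := - (1 / PI) * ln d.
Let t1 (e : R) := - (1 / PI) * ln (z4 e) + 1 / PI * ln d.

Lemma internal_times e : 0 < z4 e < d ^ 2 -> 0 < t0 < t1 e /\ t1 e < - (1 / PI) * ln (z4 e).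
Proof.
intros hz. pose proof PI_RGT_0 as hpi.
assert (ld : ln d < 0) by (rewrite <- ln_1; apply ln_increasing; lra).
assert (lz : ln (z4 e) < ln d + ln d).
{ rewrite <- ln_mult by lra. apply ln_increasing; [lra|]. replace (d * d) with (d ^ 2) by ring. lra. }
assert (hp : 0 < 1 / PI) by (apply Rdiv_lt_0_compat; lra).
unfold t0, t1. set (c := 1 / PI) in *. set (u := ln d) in *. set (v := ln (z4 e)) in *.
repeat split; nra.
Qed.

Lemma internal_edge_0 u : phi_int (t0, u) = phi (RtoC 0) d (0, 1 - u).
Proof.
unfold phi_int, phi. rewrite Cexp_PI. unfold Cexp. cbn [fst snd Re Im].
replace (- PI * t0) with (ln d) by (unfold t0; field; apply PI_neq0).
rewrite exp_ln by lra. ceq; ring.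
Qed.

(** The right end of the strip is the half circle of radius z4 / d, which after rescaling by z4 is
    the boundary of the disc around infinity. *)
Lemma internal_edge_1 e u : 0 < z4 e ->
  phi_int (t1 e, u) = (RtoC (z4 e) * phi_infty d (0, u))%C.
Proof.
intros hz. unfold phi_int, phi_infty.
replace (- (RtoC PI * (0, u)))%C with (RtoC PI * (0, (- u)%R))%C by (ceq; ring).
rewrite Cexp_PI. unfold Cexp. cbn [fst snd Re Im].
replace (- PI * t1 e) with (ln (z4 e) + - ln d) by (unfold t1; field; apply PI_neq0).
rewrite exp_plus, exp_Ropp, !exp_ln by lra.
replace (PI * (1 - u)) with (PI + PI * - u) by ring.
rewrite cos_plus, sin_plus, cos_PI, sin_PI. ceq; field; lra.
Qed.

Lemma region_internal eta e u : reg eta e -> 0 < z4 e -> 0 <= u <= 1 ->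
  Cmod (W e (phi_int (t0, u)) - RtoC (p k)) <= eta /\
  Cmod (W e (phi_int (t1 e, u)) - RtoC (p k')) <= eta.
Proof.
intros [r1 r2] hz hu. split.
- rewrite internal_edge_0. apply r1, D_main_circle_0; auto; lra.
- rewrite internal_edge_1 by auto. now apply r2, D_main_circle_infty.
Qed.

Lemma ev_internal_nonempty : at_right 0 (fun e => exists ts, Theta_int d (z4 e) ts).
Proof.
assert (hd2 : 0 < d ^ 2) by (apply pow_lt; lra).
generalize (ev_z4 (d ^ 2) hd2). apply filter_imp. intros e [_ hz].
destruct (internal_times e hz) as [h _].
exists ((t0 + t1 e) / 2, 0). unfold Theta_int; cbn [fst snd].
fold t0. fold (t1 e). lra.
Qed.

(** The flat vertex lies on only one of L_1 and L_3, hence it is not above their intersection. This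
    keeps the constant of the comparison map away from 0. *)
Lemma lines_at_flat : a i1 * p k + b i1 <> a i3 * p k + b i3.
Proof.
pose proof (lin_vertex_pos a b p 1 Rlt_0_1 meet cvx i3) as [h1 _].
pose proof (lin_vertex_pos a b p 1 Rlt_0_1 meet cvx i1) as [h2 _].
unfold lin in h1, h2. cbn in h1, h2. pose proof (meet i1) as m1. pose proof (meet i2) as m2. cbn in m1, m2.
pose proof (lin_vertex_pos a b p 1 Rlt_0_1 meet cvx i3) as [_ h3].
unfold lin in h3. cbn in h3.
destruct hk as [E | E]; rewrite E; intros N.
- rewrite N in h3. replace (1 * (a i3 * p i1 + b i3) - 1 * (a i3 * p i1 + b i3)) with 0 in h3 by ring. lra.
- rewrite m2, <- N in h2. replace (1 * (a i1 * p i2 + b i1) - 1 * (a i1 * p i2 + b i1)) with 0 in h2 by ring. lra.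
Qed.

(** The growth of the exponential along the strip is not known beforehand. It is bounded by the
    values of the map at the two ends, divided by the constant c, which is at least half the modulus
    of X0; in between the exponential is monotone. *)
Lemma ev_internal_wedge eta : a i1 <> a i3 -> 0 < eta ->
  let qx := (b i1 - b i3) / (a i3 - a i1) in
  at_right 0 (fun e => forall ts, Theta_int d (z4 e) ts ->
    Cmod (W e (phi_int ts) -
      RtoC (qx + (p k - qx) * exp (e * (a i1 - a i3) * fst ts))) <= eta).
Proof.
intros ha he qx.
assert (hqx : a i1 * qx + b i1 = a i3 * qx + b i3) by (unfold qx; field; lra).
set (X0 := p k - qx).
assert (hX0 : 0 < Rabs X0).
{ apply Rabs_pos_lt. unfold X0. intros E. apply lines_at_flat. replace (p k) with qx by lra. auto. }
set (K := Rabs X0 + Rabs (p k' - qx)). pose proof (Rabs_pos (p k' - qx)) as hp'.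
assert (hK : 0 < K) by (unfold K; lra).
set (CC := 200 * (1 + K)). assert (hCC : 200 <= CC /\ K <= CC) by (unfold CC; lra).
(* At the ends the modulus of c times the exponential is at most [2 * K], and c is at least
   [Rabs X0 / 2] in modulus. *)
set (Z := 4 * K / Rabs X0).
assert (hZ : 0 < Z) by (apply Rdiv_lt_0_compat; lra).
(* The coefficient of s in the final error, assembled in [Efin]. *)
set (TT := CC + 1 + 12 * CC * Z + 4 * K + 3 * K * (Z + 1)).
assert (hTT : 0 < TT).
{ unfold TT. pose proof (Rmult_lt_0_compat K Z hK hZ). pose proof (Rmult_lt_0_compat CC Z ltac:(lra) hZ). nra. }
set (s := Rmin (Rmin 1 (eta / TT)) (Rabs X0 / (6 * CC))).
assert (hs : 0 < s /\ s <= 1 /\ s * TT <= eta /\ 3 * CC * s <= Rabs X0 / 2).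
{ assert (q1 : 0 < eta / TT) by (apply Rdiv_lt_0_compat; lra).
  assert (q2 : 0 < Rabs X0 / (6 * CC)) by (apply Rdiv_lt_0_compat; lra).
  assert (s1 : s <= 1) by (unfold s; eapply Rle_trans; apply Rmin_l).
  assert (s2 : s <= eta / TT) by (unfold s; eapply Rle_trans; [apply Rmin_l | apply Rmin_r]).
  assert (s3 : s <= Rabs X0 / (6 * CC)) by apply Rmin_r.
  split; [unfold s; repeat apply Rmin_pos; lra | split; [auto | split]].
  - apply Rle_trans with (eta / TT * TT); [apply Rmult_le_compat_r; lra | right; field; lra].
  - apply Rle_trans with (3 * CC * (Rabs X0 / (6 * CC))); [apply Rmult_le_compat_l; lra | right; field; lra]. }
destruct hs as [s0 [s1 [sT sX]]].
assert (hd2 : 0 < d ^ 2) by (apply pow_lt; lra).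
set (y := a i1 * qx + b i1).
(* The left end t0 does not depend on e, so the exponential tends to 1 there, and c itself is close
   to X0. *)
assert (hexp : at_right 0 (fun e => Rabs (exp (- ((atan (e * a i1) - atan (e * a i3)) * t0)) - 1) <= s)).
{ assert (c0 : continuous exp 0) by apply continuous_exp.
  assert (L : locally (exp 0) (fun y => Rabs (y - 1) <= s)).
  { exists (mkposreal _ s0). intros v hv. rewrite exp_0 in hv. left. exact hv. }
  destruct (c0 _ L) as [dd Hdd].
  set (m := dd / (Rabs t0 + 1)). pose proof (Rabs_pos t0) as ht0. pose proof (cond_pos dd) as hdd.
  generalize (ev_angle_small (a i1) (a i3) (m / 2) ltac:(unfold m; apply Rdiv_lt_0_compat; [apply Rdiv_lt_0_compat; lra | lra])).
  apply filter_imp. intros e h. apply Hdd.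
  unfold ball; cbn. unfold AbsRing_ball, abs, minus, plus, opp; cbn.
  rewrite Ropp_0, Rplus_0_r, Rabs_Ropp, Rabs_mult.
  apply Rle_lt_trans with (m / 2 * (Rabs t0 + 1)).
  - apply Rmult_le_compat; try apply Rabs_pos; lra.
  - unfold m. replace (dd / (Rabs t0 + 1) / 2 * (Rabs t0 + 1)) with (dd / 2) by (field; lra). lra. }
generalize (filter_and _ _ (filter_and _ _ (filter_and _ _ hexp (ev_exp (a i1) (a i3) (ln Z) s ha s0))
   (ev_rotation (a i1) (a i3) s s0))
  (filter_and _ _ (filter_and _ _ (ev_region s s0) (ev_z4 (d ^ 2) hd2))
   (filter_and _ _ (ev_small (Rabs y) s (Rabs_pos _) s0)
     (ev_small (Rabs (a i3)) s (Rabs_pos _) s0)))).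
apply filter_imp. clear hexp.
intros e [[[hexp [hsgn hE]] hrot] [[hreg [e0 hz]] [[_ hy] [_ hal]]]].
destruct (internal_times e hz) as [ht01 ht1].
set (k1 := e * a i1) in *. set (k3 := e * a i3) in *. set (om := atan k1 - atan k3) in *.
assert (hk3 : Rabs k3 <= s) by (unfold k3; rewrite Rabs_mult, (Rabs_right e); lra).
assert (hqy : Rabs (e * y) <= s) by (rewrite Rabs_mult, (Rabs_right e); lra).
assert (hinv : Rabs (/ (1 + k3 ^ 2) - 1) <= s).
{ pose proof (pow2_ge_0 k3) as h2.
  replace (/ (1 + k3 ^ 2) - 1) with (- (k3 ^ 2 / (1 + k3 ^ 2))) by (field; lra).
  rewrite Rabs_Ropp, Rabs_right.
  - apply Rmult_le_reg_r with (1 + k3 ^ 2); [lra|].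
    replace (k3 ^ 2 / (1 + k3 ^ 2) * (1 + k3 ^ 2)) with (k3 ^ 2) by (field; lra).
    rewrite <- (pow2_abs k3). pose proof (Rabs_pos k3). nra.
  - apply Rle_ge, Rmult_le_pos; auto. left. apply Rinv_0_lt_compat. lra. }
destruct (internal_wedge a b p e (W e) (z4 e) t0 (t1 e) (hdisc e e0) ht01 ht1 qx s K (p k) (p k')
  hqx (conj (Rlt_le _ _ s0) s1) (Rlt_le _ _ hK) hk3 hqy hinv hrot) as [c [c0 [c1 hc]]].
{ fold X0. unfold K. lra. }
{ unfold K. lra. }
{ intros u hu. now apply region_internal. }
{ intros u hu. now apply region_internal. }
fold CC om k1 k3 in c0, c1, hc. fold X0 in c0.
assert (CCs : 0 <= CC * s) by (apply Rmult_le_pos; lra).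
assert (hcX : Rabs (c - X0) <= 3 * CC * s).
{ set (E := exp (- (om * t0))) in *.
  assert (Ec : c = c * exp (om * t0) * E).
  { unfold E. rewrite Rmult_assoc, <- exp_plus, Rplus_opp_r, exp_0. ring. }
  replace (c - X0) with ((c * exp (om * t0) - X0) * E + X0 * (E - 1)) by (rewrite Ec at 2; ring).
  assert (hE2 : Rabs E <= 2).
  { pose proof (Rabs_triang (E - 1) 1) as T. rewrite Rabs_R1 in T.
    replace (E - 1 + 1) with E in T by ring. lra. }
  eapply Rle_trans; [apply Rabs_triang|]. rewrite !Rabs_mult.
  assert (q1 : Rabs (c * exp (om * t0) - X0) * Rabs E <= CC * s * 2) by (apply Rmult_le_compat; auto using Rabs_pos).
  assert (q2 : Rabs X0 * Rabs (E - 1) <= CC * s) by (apply Rmult_le_compat; auto using Rabs_pos; unfold K in hCC; lra).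
  lra. }
assert (hcabs : Rabs X0 / 2 <= Rabs c).
{ pose proof (Rabs_triang (X0 - c) c) as T. replace (X0 - c + c) with X0 in T by ring.
  rewrite Rabs_minus_sym in hcX. lra. }
assert (grow : forall t, t0 <= t <= t1 e -> exp (om * t) <= Z).
{ assert (ends : forall T X, Rabs X <= K -> Rabs (c * exp (om * T) - X) <= CC * s -> exp (om * T) <= Z).
  { intros T X hX h. pose proof (exp_pos (om * T)) as hpos.
    pose proof (Rabs_triang (c * exp (om * T) - X) X) as T1.
    replace (c * exp (om * T) - X + X) with (c * exp (om * T)) in T1 by ring.
    rewrite Rabs_mult, (Rabs_right (exp _)) in T1 by lra.
    assert (Rabs X0 <= K) by (unfold K; lra).
    assert (q : Rabs X0 / 2 * exp (om * T) <= 2 * K).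
    { apply Rle_trans with (Rabs c * exp (om * T)); [apply Rmult_le_compat_r; lra | lra]. }
    unfold Z. apply Rmult_le_reg_l with (Rabs X0 / 2); [lra|].
    replace (Rabs X0 / 2 * (4 * K / Rabs X0)) with (2 * K) by (field; lra). exact q. }
  assert (g0 : exp (om * t0) <= Z) by (apply (ends t0 X0); auto; unfold K; lra).
  assert (g1 : exp (om * t1 e) <= Z) by (apply (ends (t1 e) (p k' - qx)); auto; unfold K; lra).
  intros t ht. destruct (Rle_dec 0 om) as [h | h].
  - apply Rle_trans with (2 := g1).
    assert (hh : om * t <= om * t1 e) by nra.
    destruct hh as [hh | ->]; [left; now apply exp_increasing | lra].
  - apply Rle_trans with (2 := g0).
    assert (hh : om * t <= om * t0) by nra.
    destruct hh as [hh | ->]; [left; now apply exp_increasing | lra]. }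
intros [t u] [htau hu]. cbn [fst snd] in htau, hu |- *.
fold t0 in htau. fold (t1 e) in htau.
specialize (hc t u ltac:(lra) hu).
pose proof (grow t ltac:(lra)) as gt. pose proof (exp_pos (om * t)) as gp.
assert (hEt := hE t). 
assert (hlt : om * t <= ln Z).
{ rewrite <- (ln_exp (om * t)). apply ln_le; auto. }
specialize (hEt hlt).
set (r := exp (e * (a i1 - a i3) * t)) in *.
assert (rot : Cmod (Cexp (0, om * u) - 1) <= s).
{ apply hrot. rewrite Rabs_mult, (Rabs_right u) by lra. pose proof (Rabs_pos om). nra. }
assert (hsl : Cmod (Cconj (slope k3) - 1) <= s) by (rewrite (proj2 (slope_close k3)); exact hk3).
assert (hX0K : Rabs X0 <= K) by (unfold K; lra).
assert (hclose : Cmod (RtoC (c * exp (om * t)) - RtoC (X0 * r)) <= 3 * CC * s * Z + K * s).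
{ rewrite <- RtoC_minus, Cmod_R.
  replace (c * exp (om * t) - X0 * r) with ((c - X0) * exp (om * t) + X0 * (exp (om * t) - r)) by ring.
  eapply Rle_trans; [apply Rabs_triang|]. rewrite !Rabs_mult, (Rabs_right (exp _)) by lra.
  rewrite (Rabs_minus_sym (exp _)).
  apply Rplus_le_compat; apply Rmult_le_compat; auto using Rabs_pos; lra. }
assert (hXr : Cmod (RtoC (X0 * r)) <= K * (Z + 1)).
{ rewrite Cmod_R, Rabs_mult. apply Rmult_le_compat; auto using Rabs_pos.
  rewrite Rabs_right by (left; apply exp_pos). apply Rabs_le_between in hEt. lra. }
assert (hpos0 : 0 <= 3 * CC * s * Z + K * s).
{ apply Rle_trans with (2 := hclose). apply Cmod_ge_0. }
pose proof (product_close (Cconj (slope k3)) (Cexp (0, om * u)) (RtoC (c * exp (om * t))) (RtoC (X0 * r)) s _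
  (conj (Rlt_le _ _ s0) s1) hpos0 hsl rot hclose) as T.
assert (T' : 3 * Cmod (RtoC (X0 * r)) * s <= 3 * (K * (Z + 1)) * s) by (apply Rmult_le_compat_r; lra).
set (w := wedge (qx, e * (a i1 * qx + b i1)) c k3 k1) in *.
apply Rle_trans with (1 := Cmod_triangle_minus _ (w (t, u)) _).
assert (hw : Cmod (w (t, u) - RtoC (qx + X0 * r)) <= s + (4 * (3 * CC * s * Z + K * s) + 3 * (K * (Z + 1)) * s)).
{ unfold w, wedge. fold om. rewrite Cexp_real_scale.
  replace ((qx, (e * (a i1 * qx + b i1))%R) + RtoC c * Cconj (slope k3) * (RtoC (exp (om * t)) * Cexp (0, (om * u)%R)) - RtoC (qx + X0 * r))%C
    with (RtoC (e * y) * Ci + (Cconj (slope k3) * Cexp (0, (om * u)%R) * RtoC (c * exp (om * t)) - RtoC (X0 * r)))%C.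
  - eapply Rle_trans; [apply Cmod_triangle|]. rewrite Cmod_mult, Cmod_Ci, Cmod_R. lra.
  - fold y. generalize (Cconj (slope k3)) (Cexp (0, om * u)) (exp (om * t)) (X0 * r). intros z1 z2 r1 r2.
    ceq; ring. }
assert (Efin : CC * s + (s + (4 * (3 * CC * s * Z + K * s) + 3 * (K * (Z + 1)) * s)) = s * TT) by (unfold TT; ring).
lra.
Qed.

(** With equal slopes the flow has constant speed. The map is bounded, so replacing the rotation
    [slope (e * a i3)] by 1 costs O(e), and the affine comparison on the strip gives the rest. *)
Lemma ev_internal_parallel eta : a i1 = a i3 -> 0 < eta ->
  at_right 0 (fun e => forall ts, Theta_int d (z4 e) ts ->
    Cmod (W e (phi_int ts) - RtoC (p k - (b i3 - b i1) * (e * fst ts))) <= eta).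
Proof.
intros ha he.
set (db := b i1 - b i3).
set (M := abs_sum p + abs_sum (fun i => a i * p i + b i) + Rabs (p k) + Rabs (p k') + 1).
assert (hM : 0 < M).
{ unfold M. pose proof (abs_sum_ge_0 p). pose proof (abs_sum_ge_0 (fun i => a i * p i + b i)).
  pose proof (Rabs_pos (p k)). pose proof (Rabs_pos (p k')). lra. }
set (N := Rabs (a i3) * M + Rabs (b i3) + Rabs db * (1 + Rabs t0)).
assert (hN : 0 <= N).
{ unfold N. pose proof (Rabs_pos (a i3)). pose proof (Rabs_pos (b i3)). pose proof (Rabs_pos db). pose proof (Rabs_pos t0).
  pose proof (Rmult_le_pos _ _ H (Rlt_le _ _ hM)). pose proof (Rmult_le_pos (Rabs db) (1 + Rabs t0) ltac:(lra) ltac:(lra)). lra. }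
set (s := Rmin 1 (eta / 10)).
assert (hs : 0 < s <= 1 /\ 10 * s <= eta).
{ unfold s. pose proof (Rmin_r 1 (eta / 10)). split; [split; [apply Rmin_pos; lra | apply Rmin_l] | lra]. }
assert (hd2 : 0 < d ^ 2) by (apply pow_lt; lra).
assert (h01 : 0 < 1) by lra. assert (h00 : 0 <= 1) by lra.
generalize (filter_and _ _ (filter_and _ _ (ev_region s (proj1 (proj1 hs))) (ev_z4 (d ^ 2) hd2))
   (filter_and _ _ (ev_small N s hN (proj1 (proj1 hs))) (ev_small 1 1 h00 h01))).
apply filter_imp. intros e [[hreg [e0 hz]] [[_ heN] [_ he1]]].
destruct (internal_times e hz) as [ht01 ht1].
set (g := fun z : C => W e (phi_int z)).
assert (hg : forall z, Cmod (g z) <= M).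
{ intros z. eapply Rle_trans; [apply Cmod_le_abs|].
  pose proof (disc_Re (hdisc e e0) (phi_int z)) as r1.
  pose proof (disc_Im (hdisc e e0) (phi_int z)) as r2.
  pose proof (abs_sum_ge_0 (fun i => a i * p i + b i)). pose proof (Rabs_pos (p k)). pose proof (Rabs_pos (p k')).
  unfold g, M. nra. }
assert (heN' : e * (Rabs (a i3) * M) + e * Rabs (b i3) + e * Rabs db * (1 + Rabs t0) <= s).
{ unfold N in heN. lra. }
assert (q1 : 0 <= e * (Rabs (a i3) * M)) by (apply Rmult_le_pos; [lra | apply Rmult_le_pos; [apply Rabs_pos | lra]]).
assert (q2 : 0 <= e * Rabs (b i3)) by (apply Rmult_le_pos; [lra | apply Rabs_pos]).
assert (q3 : 0 <= e * Rabs db) by (apply Rmult_le_pos; [lra | apply Rabs_pos]).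
assert (q4 : 0 <= e * Rabs db * Rabs t0) by (apply Rmult_le_pos; [auto | apply Rabs_pos]).
assert (sl : forall z, Cmod ((slope (e * a i3) - 1) * g z) <= e * (Rabs (a i3) * M)).
{ intros z. rewrite Cmod_mult, (proj1 (slope_close _)), Rabs_mult, (Rabs_right e), Rmult_assoc by lra.
  apply Rmult_le_compat_l; [lra|]. apply Rmult_le_compat_l; auto using Rabs_pos. }
set (P := fun z : C => (slope (e * a i3) * g z - RtoC (e * b i3) * Ci - RtoC (e * db) * z)%C).
assert (edge : forall T X u, 0 <= u <= 1 -> Cmod (g (T, u) - RtoC X) <= s ->
  Cmod (P (T, u) - RtoC (X - e * db * T)) <= 2 * s).
{ intros T X u hu hX.
  replace (P (T, u) - RtoC (X - e * db * T))%C with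
    ((slope (e * a i3) - 1) * g (T, u) + ((g (T, u) - RtoC X) + RtoC (- (e * b i3 + e * db * u)) * Ci))%C.
  2:{ unfold P. generalize (slope (e * a i3)) (g (T, u)). intros z1 z2. ceq; ring. }
  eapply Rle_trans; [apply Cmod_triangle|].
  eapply Rle_trans; [apply Rplus_le_compat_l, Cmod_triangle|].
  rewrite (Cmod_mult _ Ci), Cmod_Ci, Cmod_R, Rabs_Ropp.
  pose proof (sl (T, u)) as h1.
  pose proof (Rabs_triang (e * b i3) (e * db * u)) as h2.
  rewrite !Rabs_mult, (Rabs_right e), (Rabs_right u) in h2 by lra.
  assert (e * Rabs db * u <= e * Rabs db) by nra.
  lra. }
assert (IP := internal_parallel a b p e (W e) (z4 e) t0 (t1 e) (hdisc e e0) ht01 ht1 (2 * s) (p k) (p k') ha).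
cbv zeta in IP. fold db in IP.
assert (IP' : forall t u, t0 <= t <= t1 e -> 0 <= u <= 1 -> Cmod (P (t, u) - RtoC (p k - e * db * t0)) <= 3 * (2 * s)).
{ apply IP.
  - intros u hu. apply edge; auto. now apply region_internal.
  - intros u hu. apply edge; auto. now apply region_internal. }
intros [t u] [htau hu]. cbn [fst snd] in htau, hu |- *.
fold t0 in htau. fold (t1 e) in htau.
specialize (IP' t u ltac:(lra) hu).
change (W e (phi_int (t, u))) with (g (t, u)).
replace (g (t, u) - RtoC (p k - (b i3 - b i1) * (e * t)))%C with
  (- ((slope (e * a i3) - 1) * g (t, u)) + ((P (t, u) - RtoC (p k - e * db * t0)) +
     (RtoC (e * b i3 + e * db * u) * Ci + RtoC (- (e * db * t0)))))%C.
2:{ unfold P, db. generalize (slope (e * a i3)) (g (t, u)). intros z1 z2. ceq; ring. }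
eapply Rle_trans; [apply Cmod_triangle|].
eapply Rle_trans; [apply Rplus_le_compat_l, Cmod_triangle|].
eapply Rle_trans; [apply Rplus_le_compat_l, Rplus_le_compat_l, Cmod_triangle|].
rewrite Cmod_opp, (Cmod_mult _ Ci), Cmod_Ci, !Cmod_R, Rabs_Ropp.
pose proof (sl (t, u)) as h1.
pose proof (Rabs_triang (e * b i3) (e * db * u)) as h2.
rewrite !Rabs_mult, (Rabs_right e), (Rabs_right u) in h2 by lra.
rewrite (Rabs_mult (e * db)), (Rabs_mult e), (Rabs_right e) by lra.
assert (e * Rabs db * u <= e * Rabs db) by nra.
lra.
Qed.
End Limits.

(** * The gradient tree in closed form *)

Section Tree.
Variables (f : idx -> R -> R) (a b p : idx -> R) (T : tree) (k k' : idx).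
Hypothesis hf : forall i, is_quadratic (f i) (a i) (b i).
Hypothesis meet : forall i, a i * p i + b i = a (next i) * p i + b (next i).
Hypothesis cvx : forall i, 0 < (p (next i) - p i) * (p i - p (prev i)) * (a (next i) - a i).
Hypothesis hk : k = i1 \/ k = i2.
Hypothesis hk' : k' = i3 \/ k' = i4.
Hypothesis ak : a k < a (next k).
Hypothesis ak' : a k' < a (next k').
Hypothesis cross : 0 < (p i3 - p i1) * (p i4 - p i2).
Hypothesis hT : is_gradient_tree f p T.

Lemma flow_eq D i j I : gradient_flow_on D (fdiff f i j) I ->
  forall t, D t -> is_derive_in D I t (- ((a i - a j) * I t + (b i - b j))).
Proof. intros h t ht. specialize (h t ht). now rewrite (fdiff_Derive f a b) in h. Qed.

Lemma ext_flow i : forall t, t <= 0 -> ext T i t = p i + (ext T i 0 - p i) * exp (- (a (next i) - a i) * t).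
Proof.
destruct hT as [h _]. destruct (h i) as [h1 h2].
apply external_exp with (be := b (next i) - b i).
- intros E. pose proof (cvx i) as c. rewrite E in c. lra.
- pose proof (meet i). lra.
- now apply flow_eq.
Qed.

Lemma ext_flat i : a i < a (next i) -> forall t, t <= 0 -> ext T i t = p i.
Proof.
intros hi. destruct hT as [h _]. destruct (h i) as [h1 h2].
apply external_stable_const with (al := a (next i) - a i) (be := b (next i) - b i); auto; try lra.
- pose proof (meet i). lra.
- now apply flow_eq.
Qed.

(** The external edges of index zero are constant, at the distinct points p k and p k'. Shape a
    would identify them, and so would shape c when both are attached to the same end of the internal
    edge; in the other cases of shape c the internal flow would run against its initial velocity. *)
Lemma tree_shape_b : shape T = shape_b.
Proof.
pose proof (ext_flat k ak 0 (Rle_refl 0)) as e1. pose proof (ext_flat k' ak' 0 (Rle_refl 0)) as e2.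
destruct (sides_gap a b p k k' meet cvx hk hk' ak ak' cross) as [o [g [ho [hg H]]]].
pose proof (H k k' hk hk') as hgap.
assert (hne : p k <> p k') by (intros E; rewrite E in hgap; destruct ho as [-> | ->]; lra).
destruct hT as [_ h]. destruct (shape T); auto; exfalso.
- destruct h as [_ h]. rewrite (h k k') in e1. congruence.
- destruct h as [hl [hflow [h2 [h3 [h4 h1]]]]].
  pose proof (flow_direction (int_edge (len T)) (int T) (a i4 - a i2) (b i4 - b i2) 0 (len T) hl
    (fun t ht => ht) (flow_eq _ _ _ _ hflow)) as FD.
  destruct (no_shape_c_flow a b p k k' meet cvx hk hk' ak ak' cross) as [n1 n2].
  destruct hk as [Ek | Ek], hk' as [Ek' | Ek']; rewrite Ek, Ek' in *.
  + specialize (n1 eq_refl eq_refl). rewrite h1, h3, e1, e2 in FD. lra.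
  + congruence.
  + congruence.
  + specialize (n2 eq_refl eq_refl). rewrite h2, h4, e1, e2 in FD. lra.
Qed.

Lemma int_start : int T 0 = p k /\ ext T i1 0 = p k /\ ext T i2 0 = p k /\
  ext T i3 0 = p k' /\ ext T i4 0 = p k'.
Proof.
pose proof (ext_flat k ak 0 (Rle_refl 0)) as e1. pose proof (ext_flat k' ak' 0 (Rle_refl 0)) as e2.
destruct hT as [_ h]. rewrite tree_shape_b in h. destruct h as [_ [_ [h1 [h2 [h3 h4]]]]].
destruct hk as [Ek | Ek], hk' as [Ek' | Ek']; rewrite Ek, Ek' in *; repeat split; congruence.
Qed.

Lemma ext_formula i t : t <= 0 ->
  ext T i t = p i + (p (side_of k k' i) - p i) * exp ((a i - a (next i)) * t).
Proof.
intros ht. rewrite ext_flow by auto.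
replace (ext T i 0) with (p (side_of k k' i)).
- replace (- (a (next i) - a i) * t) with ((a i - a (next i)) * t) by ring. reflexivity.
- destruct int_start as [_ [h1 [h2 [h3 h4]]]]. destruct i; cbn; congruence.
Qed.

Lemma int_extension J : extends_int f T J -> J 0 = p k /\
  forall t, is_derive_in (fun _ => True) J t (- ((a i3 - a i1) * J t + (b i3 - b i1))).
Proof.
intros [h1 h2]. rewrite tree_shape_b in h2. split.
- rewrite h1; [apply int_start|]. destruct hT as [_ h]. rewrite tree_shape_b in h.
  destruct h as [hl _]. unfold int_edge. lra.
- intros t. now apply (flow_eq (fun _ => True)).
Qed.
End Tree.

(** * From the quadrilateral to sign conditions, and assembly of the limits *)

Lemma orient_vertices a b p i : 
  (forall i, a i * p i + b i = a (next i) * p i + b (next i)) ->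
  orient (p (prev i), a (prev i) * p (prev i) + b (prev i)) (p i, a i * p i + b i)
    (p (next i), a (next i) * p (next i) + b (next i)) =
  (p (next i) - p i) * (p i - p (prev i)) * (a (next i) - a i).
Proof.
intros meet. unfold orient. cbn [Re Im fst snd].
pose proof (meet (prev i)) as m1. pose proof (meet i) as m2.
replace (next (prev i)) with i in m1 by now destruct i.
rewrite m1. replace (b (next i)) with (a i * p i + b i - a (next i) * p i) by lra. ring.
Qed.

Theorem theorem3p1 :
  forall (f : idx -> R -> R) (a b : idx -> R)
    (x : R -> idx -> C) (p : idx -> R)
    (w : R -> C -> C) (z4 : R -> R)
    (T : tree) (delta : R) (k k' : idx),
  (forall i, is_quadratic (f i) (a i) (b i)) ->
  (forall i, a i <> a (next i)) ->
  (forall eps i, 0 < eps ->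
     graph_d eps (f i) (x eps i) /\ graph_d eps (f (next i)) (x eps i) /\
     Re (x eps i) = p i) ->
  (forall eps, 0 < eps -> ccw_convex (x eps)) ->
  (forall eps, 0 < eps -> is_schwarz_christoffel (x eps) (w eps) (z4 eps)) ->
  is_gradient_tree f p T ->
  0 < delta ->
  disjoint (D_at 0 delta) (D_at 1 delta) ->
  disjoint (D_at 0 delta) (D_infty delta) ->
  disjoint (D_at 1 delta) (D_infty delta) ->
  (k = i1 \/ k = i2) -> morse_index (fdiff f (next k) k) (p k) = 0%nat ->
  (k' = i3 \/ k' = i4) -> morse_index (fdiff f (next k') k') (p k') = 0%nat ->
  0 < (p i3 - p i1) * (p i4 - p i2) ->
  tends_to_0 (fun eps =>
    sup_on (D_main delta) (fun z => Cmod (w eps z - RtoC (p k))%C)) /\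
  tends_to_0 (fun eps =>
    sup_on (D_main delta)
      (fun z => Cmod (w eps (psi_inv (z4 eps) z) - RtoC (p k'))%C)) /\
  (forall i, tends_to_0 (fun eps =>
    sup_on Theta_ext (fun ts =>
      Cmod (w eps (phi_end i (z4 eps) delta ts)
            - RtoC (ext T i (eps * fst ts)%R))%C))) /\
  (forall J : R -> R, extends_int f T J ->
    tends_to_0 (fun eps =>
      sup_on (Theta_int delta (z4 eps)) (fun ts =>
        Cmod (w eps (phi_int ts) - RtoC (J (eps * fst ts)%R))%C))).
Proof.
intros f a b x p w z4 T delta k k' hf ha hx hccw hsc hT hdel hd01 hd0i hd1i hk mk hk' mk' cross.
assert (hd : 0 < delta <= 1 / 2) by (split; [auto | now apply disjoint_half]).
assert (Dq : forall i t, Derive (f i) t = a i * t + b i).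
{ intros i t. apply is_derive_unique, quadratic_derive, hf. }
assert (meet : forall i, a i * p i + b i = a (next i) * p i + b (next i)).
{ intros i. destruct (hx 1 i Rlt_0_1) as [h1 [h2 h3]]. unfold graph_d in h1, h2.
  rewrite Dq, h3 in h1. rewrite Dq, h3 in h2. lra. }
assert (xE : forall e, 0 < e -> x e = fun i => (p i, e * (a i * p i + b i))).
{ intros e he. apply functional_extensionality. intros i.
  destruct (hx e i he) as [h1 [_ h3]]. unfold graph_d in h1. rewrite Dq, h3 in h1.
  apply Ceq_intro; auto. }
assert (cvx : forall i, 0 < (p (next i) - p i) * (p i - p (prev i)) * (a (next i) - a i)).
{ intros i. rewrite <- (orient_vertices a b p i meet).
  pose proof (hccw 1 Rlt_0_1) as h. rewrite (xE 1 Rlt_0_1) in h.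
  specialize (h (prev i) (next i)). cbn beta in h. rewrite !Rmult_1_l in h.
  replace (next (prev i)) with i in h by now destruct i.
  apply h; destruct i; discriminate. }
assert (idx0 : forall i, morse_index (fdiff f (next i) i) (p i) = 0%nat -> a i < a (next i)).
{ intros i h. unfold morse_index in h. rewrite (fdiff_Derive2 f a b) in h by auto.
  destruct (Rlt_dec (a (next i) - a i) 0); [discriminate|]. pose proof (ha i). lra. }
pose proof (idx0 k mk) as ak. pose proof (idx0 k' mk') as ak'.
(* All estimates are made for this extension; it agrees with [w e] on the closed half plane, where
   every region and every strip is mapped. *)
set (W := fun e => wbar (w e)).
assert (hdisc : forall e, 0 < e -> disc a b p e (W e) (z4 e)).
{ intros e he. apply riemann_disc; auto. rewrite <- (xE e he). auto. }
assert (hz4 : forall e, 0 < e -> 0 < z4 e) by (intros e he; apply (disc_z4 (hdisc e he))).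
assert (hpos : at_right 0 (fun e => 0 < e)).
{ apply (ev_intro _ 1 Rlt_0_1). intros; lra. }
(* The witness that the main region is nonempty, picked up by [eauto] below. *)
assert (Ri : D_main delta (RtoC 2)) by (apply D_main_real; auto).
split; [|split; [|split]].
- apply (tends_to_0_intro C (fun _ => D_main delta) (fun e z => Cmod (w e z - RtoC (p k)))).
  intros eta he.
  generalize (ev_region a b p W z4 delta k k' hd meet cvx hdisc hk hk' ak ak' cross eta he).
  apply filter_imp. intros e [h _]. split; [eauto|].
  intros z hz. split; [apply Cmod_ge_0|]. rewrite <- (wbar_eq (w e)); [now apply h | apply hz].
- apply (tends_to_0_intro C (fun _ => D_main delta) (fun e z => Cmod (w e (psi_inv (z4 e) z) - RtoC (p k')))).
  intros eta he.
  generalize (filter_and _ _ hpos (ev_region a b p W z4 delta k k' hd meet cvx hdisc hk hk' ak ak' cross eta he)).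
  apply filter_imp. intros e [e0 [_ h]]. split; [eauto|].
  intros z hz. split; [apply Cmod_ge_0|]. rewrite <- (wbar_eq (w e)); [now apply h|].
  unfold psi_inv. rewrite im_scal_l. apply Rmult_le_pos; [left; auto | apply hz].
- intros i.
  apply (tends_to_0_intro (R * R) (fun _ => Theta_ext) (fun e ts =>
    Cmod (w e (phi_end i (z4 e) delta ts) - RtoC (ext T i (e * fst ts))))).
  intros eta he.
  assert (q4 : 0 < 1 / 4) by lra.
  generalize (filter_and _ _ (ev_z4 a b p W z4 k k' meet cvx hdisc hk hk' ak ak' cross _ q4)
    (ev_end a b p W z4 delta k k' hd meet cvx hdisc hk hk' ak ak' cross i eta he)).
  apply filter_imp. intros e [[_ hz] [e0 h]]. split.
  + exists (- (1), 0). unfold Theta_ext; cbn. lra.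
  + intros [t s] [ht hs]; cbn [fst snd] in *. split; [apply Cmod_ge_0|].
    rewrite <- (wbar_eq (w e)) by (apply (end_upper_closed (z4 e) delta); auto; lra).
    rewrite (ext_formula f a b p T k k') by (auto; nra).
    replace ((a i - a (next i)) * (e * t)) with (e * (a i - a (next i)) * t) by ring.
    apply h; lra.
- intros J hJ.
  destruct (int_extension f a b p T k k' hf meet cvx hk hk' ak ak' cross hT J hJ) as [J0 hflow].
  apply (tends_to_0_intro (R * R) (fun e => Theta_int delta (z4 e)) (fun e ts =>
    Cmod (w e (phi_int ts) - RtoC (J (e * fst ts))))).
  intros eta he.
  assert (tpos : forall e ts, Theta_int delta (z4 e) ts -> 0 < fst ts).
  { intros e ts [[h _] _]. apply Rle_lt_trans with (2 := h).
    assert (ln delta < 0) by (rewrite <- ln_1; apply ln_increasing; lra).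
    assert (0 < 1 / PI) by (apply Rdiv_lt_0_compat; [lra | apply PI_RGT_0]). nra. }
  assert (up : forall e ts, Theta_int delta (z4 e) ts -> 0 <= Im (phi_int ts)).
  { intros e ts [_ h]. cbn. apply Rmult_le_pos; [left; apply exp_pos|].
    pose proof PI_RGT_0. apply sin_ge_0; nra. }
  pose proof (ev_internal_nonempty a b p W z4 delta k k' hd meet cvx hdisc hk hk' ak ak' cross) as hne.
  (* The extended solution is determined by its value [p k] at 0: it is affine when the slopes agree
     and exponential around the abscissa qx of the intersection of L_1 and L_3 otherwise. *)
  destruct (Req_dec (a i1) (a i3)) as [E | N].
  + generalize (filter_and _ _ (filter_and _ _ hpos hne)
      (ev_internal_parallel a b p W z4 delta k k' hd meet cvx hdisc hk hk' ak ak' cross eta E he)).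
    apply filter_imp. intros e [[e0 hn] h]. split; auto.
    intros ts hts. split; [apply Cmod_ge_0|]. rewrite <- (wbar_eq (w e)) by eauto.
    assert (ht : 0 < e * fst ts) by (apply Rmult_lt_0_compat; eauto).
    pose proof (flow_lin (fun _ => True) J _ _ 0 _ ht (fun _ _ => Logic.I) (fun t _ => hflow t) ltac:(lra)) as F.
    replace (J (e * fst ts)) with (p k - (b i3 - b i1) * (e * fst ts)) by lra.
    now apply h.
  + generalize (filter_and _ _ (filter_and _ _ hpos hne)
      (ev_internal_wedge a b p W z4 delta k k' hd meet cvx hdisc hk hk' ak ak' cross eta N he)).
    apply filter_imp. intros e [[e0 hn] h]. split; auto.
    intros ts hts. split; [apply Cmod_ge_0|]. rewrite <- (wbar_eq (w e)) by eauto.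
    assert (ht : 0 < e * fst ts) by (apply Rmult_lt_0_compat; eauto).
    pose proof (flow_exp (fun _ => True) J _ _ 0 _ ht (fun _ _ => Logic.I) (fun t _ => hflow t) ltac:(lra)) as F.
    rewrite Rmult_0_r, exp_0, J0 in F.
    specialize (h ts hts). set (qx := (b i1 - b i3) / (a i3 - a i1)) in *.
    replace (J (e * fst ts)) with (qx + (p k - qx) * exp (e * (a i1 - a i3) * fst ts)); auto.
    set (t := e * fst ts) in *.
    replace (e * (a i1 - a i3) * fst ts) with (- ((a i3 - a i1) * t)) by (unfold t; ring).
    pose proof (exp_pos ((a i3 - a i1) * t)) as ep. rewrite exp_Ropp.
    set (E := exp ((a i3 - a i1) * t)) in *.
    assert (ea : (a i3 - a i1) * qx = b i1 - b i3) by (unfold qx; field; lra).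
    (* After multiplication by this nonzero factor the equation is the conserved quantity F. *)
    apply Rmult_eq_reg_l with ((a i3 - a i1) * E).
    2:{ apply Rmult_integral_contrapositive; lra. }
    replace ((a i3 - a i1) * E * (qx + (p k - qx) * / E)) with
      ((a i3 - a i1) * qx * E + (a i3 - a i1) * p k - (a i3 - a i1) * qx) by (field; lra).
    rewrite ea. lra.
Qed.
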